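(* Let $X$ be an infinite-dimensional complex Banach space and $T\in L(X)$. The following conditions are equivalent: (i) there exists a pair $(M,N)$ of closed $T$-invariant subspaces with $X=M\oplus N$ such that $T_M$ is bounded below and $T_N$ is Riesz; (ii) $T$ admits a GKRD and $0\notin\operatorname{int}\sigma_{ap}(T)$; (iii) $T$ admits a GKRD and $T$ has the SVEP at $0$; (iv) there exists a pair $(M,N)$ of closed $T$-invariant subspaces with $X=M\oplus N$ such that $T_M$ is upper semi-Browder and $T_N$ is Riesz; (v) $T$ admits a GKRD and $0\notin\operatorname{acc}\sigma_{\mathcal B_+}(T)$; (vi) $T$ admits a GKRD and $0\notin\operatorname{int}\sigma_{\mathcal B_+}(T)$; (vii) there exists a bounded projection $P$ on $X$ commuting with $T$ such that $T+P$ is upper semi-Browder and $TP$ is Riesz.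
   Context: $L(X)$ is the algebra of bounded operators on $X$. $S$ is Kato if $R(S)$ is closed and $N(S)\subset R(S^n)$ for all $n\in\mathbb N$. $S$ is Riesz if $S-\lambda$ is Fredholm for all $\lambda\ne0$. $S$ is bounded below if injective with closed range. $S$ is upper semi-Fredholm if $\dim N(S)<\infty$ and $R(S)$ closed, and upper semi-Browder if moreover it has finite ascent. For closed $T$-invariant $M,N$ with $X=M\oplus N$, $T_M,T_N$ are the restrictions; $T$ admits a GKRD if there is such a pair with $T_M$ Kato and $T_N$ Riesz. $\sigma_{ap}(T)=\{\lambda: T-\lambda \text{ not bounded below}\}$, $\sigma_{\mathcal B_+}(T)=\{\lambda: T-\lambda\text{ not upper semi-Browder}\}$; $\operatorname{int}$, $\operatorname{acc}$ denote interior and accumulation points. $T$ has the SVEP at $\lambda_0$ if for every open disc $D$ centered at $\lambda_0$ the only analytic $f:D\to X$ with $(T-\lambda)f(\lambda)=0$ on $D$ is $f\equiv0$. *)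

(* Defs.v *)
From mathcomp Require Import all_boot all_order all_algebra all_classical all_reals all_analysis.
From mathcomp Require Import complex.
Import numFieldNormedType.Exports.
Set Implicit Arguments. Unset Strict Implicit. Unset Printing Implicit Defensive.
Import Order.TTheory GRing.Theory Num.Theory.
Local Open Scope ring_scope. Local Open Scope classical_set_scope.

(* The complex numbers over a real type R, with their normed/topological
   structure as a field normed over itself. *)
Notation Cplx R := ((complex R)^o).

Section Ops.
Variables (R : realType) (X : completeNormedModType (Cplx R)).

Definition bounded_op (T : X -> X) : Prop :=
  (forall (a : Cplx R) (x y : X), T (a *: x + y) = a *: T x + T y) /\ continuous T.

Definition shift (T : X -> X) (l : Cplx R) : X -> X := fun x => T x - l *: x.

Definition subspace (M : set X) : Prop :=
  M 0 /\ forall (a : Cplx R) (x y : X), M x -> M y -> M (a *: x + y).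
Definition closed_subspace (M : set X) : Prop := subspace M /\ closed M.

Definition op_invariant (T : X -> X) (M : set X) : Prop := T @` M `<=` M.

Definition direct_sum (M N : set X) : Prop :=
  M `&` N = [set 0] /\ forall x : X, exists m n, [/\ M m, N n & x = m + n].

Definition finite_dim (A : set X) : Prop :=
  exists s : seq X, forall x, A x ->
    exists c : 'I_(size s) -> Cplx R, x = \sum_(i < size s) c i *: s`_i.

Definition kerM (M : set X) (S : X -> X) : set X := [set x | M x /\ S x = 0].
Definition ranM (M : set X) (S : X -> X) : set X := S @` M.

Definition finite_codim_in (M : set X) (S : X -> X) : Prop :=
  exists F : set X, [/\ finite_dim F, F `<=` M &
    forall x, M x -> exists r f, [/\ ranM M S r, F f & x = r + f]].

(* Properties of the restriction S_M (M a closed S-op_invariant subspace).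
   M is closed, so closedness of ranges in M or in X coincide. *)
Definition bounded_below_on (M : set X) (S : X -> X) : Prop :=
  kerM M S = [set 0] /\ closed (ranM M S).

Definition upper_semi_fredholm_on (M : set X) (S : X -> X) : Prop :=
  finite_dim (kerM M S) /\ closed (ranM M S).

Definition fredholm_on (M : set X) (S : X -> X) : Prop :=
  [/\ finite_dim (kerM M S), closed (ranM M S) & finite_codim_in M S].

Definition finite_ascent_on (M : set X) (S : X -> X) : Prop :=
  exists p : nat, kerM M (iter p S) = kerM M (iter p.+1 S).

Definition upper_semi_browder_on (M : set X) (S : X -> X) : Prop :=
  upper_semi_fredholm_on M S /\ finite_ascent_on M S.

Definition riesz_on (M : set X) (S : X -> X) : Prop :=
  forall l : Cplx R, l != 0 -> fredholm_on M (shift S l).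

Definition kato_on (M : set X) (S : X -> X) : Prop :=
  closed (ranM M S) /\ forall n : nat, kerM M S `<=` ranM M (iter n S).

Definition GKRD (T : X -> X) : Prop :=
  exists M N : set X, [/\ closed_subspace M, closed_subspace N,
    op_invariant T M, op_invariant T N & direct_sum M N] /\
    kato_on M T /\ riesz_on N T.

Definition ap_spectrum (T : X -> X) : set (Cplx R) :=
  [set l | ~ bounded_below_on setT (shift T l)].

Definition usb_spectrum (T : X -> X) : set (Cplx R) :=
  [set l | ~ upper_semi_browder_on setT (shift T l)].

(* single-valued extension property at l0 (analytic = complex differentiable) *)
Definition SVEP_at (T : X -> X) (l0 : Cplx R) : Prop :=
  forall r : Cplx R, 0 < r -> forall f : Cplx R -> X,
    (forall z, ball l0 r z -> derivable f z 1) ->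
    (forall z, ball l0 r z -> shift T z (f z) = 0) ->
    forall z, ball l0 r z -> f z = 0.

Definition projection (P : X -> X) : Prop := bounded_op P /\ P \o P = P.

End Ops.

(* Main.v *)
(** Every condition reduces to injectivity of the Kato summand [T_M]. If [T_M] is
    Kato but not injective, [T] maps the generalized range [Y] of [T_M], which
    contains [ker T_M], onto itself with bounded preimages. Solving
    [T x_(n+1) = x_n] from [x_0] in the kernel gives an analytic eigenfunction
    [f z = \sum z^n x_n], and since [T - l] is still onto [Y] for small [l], it
    has a nonzero kernel and infinite ascent there. This refutes (ii), (iii), (vi).

    Conversely, the same dichotomy applied to the powers of a Riesz operator shows
    that the set of [l <> 0] with [T_N - m] injective for all [m] near [l], [m <> l],
    is open and closed in each ray; it contains all large [l], so it is everything, and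
    [T_N - l] has finite ascent for every [l <> 0]. With the stability of bounded-below
    operators this controls [T - l] for small [l]; the SVEP on a whole disc then
    follows from the identity theorem.

    For (iv), a Jordan chain of maximal length in [ker T_M^p] is split off with a
    continuous functional that vanishes on [R(T_M^p)], by induction on [dim ker T_M]. *)

Require Import Defs.
From mathcomp Require Import all_boot all_order all_algebra all_classical all_reals all_analysis.
From mathcomp Require Import complex ring lra.
Import numFieldNormedType.Exports.
Import Order.TTheory GRing.Theory Num.Theory.
Local Open Scope ring_scope. Local Open Scope classical_set_scope.
(* mathcomp-analysis has its own [subspace] and [shift]. *)
Import Defs ComplexField.Normc.
Set Implicit Arguments. Unset Strict Implicit. Unset Printing Implicit Defensive.

(** * Real-valued norm and geometric series *)

(** The SVEP is tested on functions that are only assumed complex differentiable, so no power series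
    is available for them. The identity theorem is therefore built from Goursat's theorem on squares
    and a crude estimate of [f w] by 8 times the maximum of [f] away from [w]. The constant is
    harmless: the estimate is applied to [f z / z^n] for every [n]. Squares are cut into nine, not
    four, so that the centre lies inside a single piece; this is what gives the quotient
    [(f z - f w) / (z - w)] a zero integral although it is only known to be continuous at [w].

    The Riesz condition says nothing at 0, and eigenvalues of [T_N] may accumulate there. Good
    values of [l] are therefore found near some small nonzero [l1], not in a punctured disc about 0.

    In (iv), [T] is nilpotent on the chains that are split off, so [T - l] is bijective on them for
    [l <> 0] and they can join the Riesz summand. In (vii), [P] projects onto [N] along [M]: [T + P]
    is [T] on [M] and [T + 1] on [N], while [T P] is 0 on [M] and [T] on [N]. *)

Section RealNorm.
Variables (R : realType) (V : normedModType (Cplx R)).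
Implicit Types (x y z : V) (a : Cplx R).

(** The norm takes values in the complex numbers, which are only partially ordered. Its real part
    makes [inf], [sup] and linear arithmetic over [R] available. *)
Definition rnm (x : V) : R := complex.Re (`|x| : complex R).

Lemma normE x : `|x| = real_complex R (rnm x) :> Cplx R.
Proof. by rewrite [RHS]RRe_real // normr_real. Qed.

Lemma normcE_cplx a : `|a| = real_complex R (normc a) :> Cplx R.
Proof. by case: a. Qed.

Lemma rnm_ge0 x : 0 <= rnm x.
Proof. by rewrite -(@lecR R) -normE normr_ge0. Qed.

Lemma rnm0 : rnm 0 = 0.
Proof. by rewrite /rnm normr0. Qed.

Lemma rnm_eq0 x : rnm x = 0 -> x = 0.
Proof. by move=> h; apply/eqP; rewrite -normr_eq0 normE h. Qed.

Lemma rnm_gt0 x : x <> 0 -> 0 < rnm x.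
Proof. by move=> h; rewrite lt_def rnm_ge0 andbT; apply/eqP => /rnm_eq0. Qed.

Lemma rnmD x y : rnm (x + y) <= rnm x + rnm y.
Proof. by rewrite -(@lecR R) rmorphD /= -!normE ler_normD. Qed.

Lemma rnmN x : rnm (- x) = rnm x.
Proof. by rewrite /rnm normrN. Qed.

Lemma rnmZ a x : rnm (a *: x) = normc a * rnm x.
Proof.
apply: (@complexI R); rewrite rmorphM /= -!normE normrZ; congr (_ * _).
Qed.

Lemma rnmB x y : rnm (x - y) <= rnm x + rnm y.
Proof. by rewrite -(rnmN y) rnmD. Qed.

Lemma rnmBC x y : rnm (x - y) = rnm (y - x).
Proof. by rewrite -rnmN opprB. Qed.

Lemma rnmB_trans x y z : rnm (x - z) <= rnm (x - y) + rnm (y - z).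
Proof. by apply: le_trans (rnmD _ _); rewrite addrA subrK. Qed.

Lemma rnm_small x : (forall e : R, 0 < e -> rnm x <= e) -> x = 0.
Proof.
move=> h; apply: rnm_eq0; apply/eqP; rewrite eq_le rnm_ge0 andbT.
by apply/ler_addgt0Pl => e e0; rewrite addr0 h.
Qed.

Lemma rnm_sum n (u : nat -> V) : rnm (\sum_(i < n) u i) <= \sum_(i < n) rnm (u i).
Proof.
elim: n => [|n IH]; first by rewrite !big_ord0 rnm0.
by rewrite !big_ord_recr /=; apply: le_trans (rnmD _ _) _; rewrite lerD2r.
Qed.

Lemma nbhs_rnm x (P : set V) :
  nbhs x P <-> exists2 e : R, 0 < e & forall y, rnm (x - y) < e -> P y.
Proof.
split=> [/nbhs_normP[e /= e0 h]|[e e0 h]].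
  exists (complex.Re e); first by move: e0; rewrite ltcE => /andP[].
  move=> y hy; apply: h => /=; rewrite normE -[e]RRe_real ?ltcR //.
  by rewrite gtr0_real.
apply/nbhs_normP; exists (real_complex R e); first by rewrite /= ltcR.
by move=> y /=; rewrite normE ltcR; exact: h.
Qed.

Lemma closed_rnm (A : set V) : closed A <->
  forall x, (forall e : R, 0 < e -> exists2 y, A y & rnm (x - y) < e) -> A x.
Proof.
split=> [cA x h|h x cx].
  by apply: cA => B /nbhs_rnm[e e0 /= hB]; have [y Ay /hB By] := h _ e0; exists y.
apply: h => e e0.
have [|y [Ay hy]] := cx [set y | rnm (x - y) < e]; last by exists y.
by apply/nbhs_rnm; exists e.
Qed.

End RealNorm.

Section ComplexModulus.
Variable R : realType.
Implicit Types (a b z : Cplx R).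

Lemma normc_ge0 a : 0 <= normc a.
Proof. by case: a => x y; rewrite sqrtr_ge0. Qed.

Lemma normc_gt0 a : a != 0 -> 0 < normc a.
Proof.
move=> a0; rewrite lt_def normc_ge0 andbT; apply: contra_neq a0; exact: eq0_normc.
Qed.

Lemma normcX a n : normc (a ^+ n) = normc a ^+ n.
Proof. by elim: n => [|n IH]; rewrite ?normc1 // !exprS normcM IH. Qed.

Lemma normc_real (t : R) : 0 <= t -> normc (real_complex R t) = t.
Proof. by move=> t0 /=; rewrite expr0n /= addr0 sqrtr_sqr ger0_norm. Qed.

Lemma normcD a b : normc (a + b) <= normc a + normc b.
Proof. exact: le_normcD. Qed.

Lemma normcBC a b : normc (a - b) = normc (b - a).
Proof. by rewrite -normcN opprB. Qed.

Lemma rnm_cplx (a : Cplx R) : rnm a = normc a.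
Proof. by rewrite /rnm normcE_cplx. Qed.

Lemma nbhs_normc (z : Cplx R) (P : set (Cplx R)) :
  nbhs z P <-> exists2 e : R, 0 < e & forall w, normc (w - z) < e -> P w.
Proof.
split=> [/nbhs_rnm|] [e e0 h].
  by exists e => // w; rewrite normcBC -rnm_cplx; exact: h.
by apply/nbhs_rnm; exists e => // w; rewrite rnm_cplx normcBC; exact: h.
Qed.

Lemma ball_normc (r z : Cplx R) : ball (0 : Cplx R) r z ->
  exists2 e : R, r = real_complex R e & normc z < e.
Proof.
rewrite -ball_normE /= sub0r normrN => h.
have r0 : 0 < r by apply: le_lt_trans h; rewrite normr_ge0.
exists (complex.Re r); first by rewrite RRe_real // gtr0_real.
by rewrite -ltcR RRe_real ?gtr0_real // -normcE_cplx.
Qed.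

Lemma normc_ball (r : R) (z : Cplx R) :
  ball (0 : Cplx R) (real_complex R r : Cplx R) z <-> normc z < r.
Proof. by rewrite -ball_normE /= sub0r normrN normcE_cplx ltcR. Qed.

End ComplexModulus.

Section Completeness.
Variables (R : realType) (X : completeNormedModType (Cplx R)).

Definition tends (u : nat -> X) (l : X) :=
  forall e : R, 0 < e -> exists N, forall n, (N <= n)%N -> rnm (u n - l) < e.

Lemma tends_unique u l l' : tends u l -> tends u l' -> l = l'.
Proof.
move=> ul ul'; apply/eqP; rewrite -subr_eq0; apply/eqP; apply: rnm_small => e e0.
have e2 : 0 < e / 2 by rewrite divr_gt0.
have [N hN] := ul _ e2; have [N' hN'] := ul' _ e2.
have h1 := hN (maxn N N') (leq_maxl _ _); have h2 := hN' (maxn N N') (leq_maxr _ _).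
rewrite rnmBC in h1.
by have := rnmB_trans l (u (maxn N N')) l'; lra.
Qed.

Lemma cauchy_tends (u : nat -> X) :
  (forall e : R, 0 < e -> exists N, forall m n, (N <= m)%N -> (N <= n)%N ->
     rnm (u m - u n) < e) -> exists l, tends u l.
Proof.
move=> h.
have : cvg (u @ \oo).
  apply/cauchy_cvgP/cauchy_ballP => e e0.
  have [N hN] := h (complex.Re e) (ltac:(by move: e0; rewrite ltcE => /andP[])).
  exists ([set x | exists2 n, (N <= n)%N & x = u n], [set x | exists2 n, (N <= n)%N & x = u n]).
    by split; exists N => // n /= hn; exists n.
  move=> [x y] /= [[m hm ->] [n hn ->]].
  by rewrite -ball_normE /= normE -[e]RRe_real ?gtr0_real // ltcR hN.
move=> /cvg_ex[l hl]; exists l => e e0.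
have /= : nbhs (u @ \oo) [set y | rnm (l - y) < e].
  by apply: hl; apply/nbhs_rnm; exists e.
by case=> N _ hN; exists N => n hn; rewrite rnmBC; exact: hN.
Qed.

Lemma expr_small (q e : R) : 0 <= q -> q < 1 -> 0 < e ->
  exists N, forall n, (N <= n)%N -> q ^+ n < e.
Proof.
move=> q0 q1 e0.
have := @cvg_expr R q; rewrite ger0_norm // => /(_ q1) /cvgrPdist_lt /(_ e e0)[N _ hN].
exists N => n /hN /=; rewrite sub0r normrN ger0_norm // exprn_ge0 //.
Qed.

Lemma geo_sum (q : R) m n : 0 <= q -> q < 1 ->
  \sum_(i < n) q ^+ (m + i) <= q ^+ m / (1 - q).
Proof.
move=> q0 q1; have q10 : 0 < 1 - q by lra.
rewrite ler_pdivlMr // -mulrC mulr_sumr.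
suff -> : \sum_(i < n) (1 - q) * q ^+ (m + i) = q ^+ m - q ^+ (m + n).
  by rewrite gerBl exprn_ge0.
elim: n => [|n IH]; first by rewrite big_ord0 addn0 subrr.
by rewrite big_ord_recr /= IH addnS exprS; ring.
Qed.

(** The limit comes with the tail bound at every [n]: letting [n] grow gives convergence, and
    [n = 0] bounds the sum itself. *)
Lemma geo_series (u : nat -> X) (K q : R) : 0 <= K -> 0 <= q -> q < 1 ->
  (forall n, rnm (u n) <= K * q ^+ n) ->
  exists s, forall n, rnm (s - \sum_(i < n) u i) <= K * q ^+ n / (1 - q).
Proof.
move=> K0 q0 q1 hu; have q10 : 0 < 1 - q by lra.
have tail m n : rnm (\sum_(i < m + n) u i - \sum_(i < m) u i) <= K * q ^+ m / (1 - q).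
  have -> : \sum_(i < m + n) u i = \sum_(i < n) u (m + i)%N + \sum_(i < m) u i.
    by rewrite big_split_ord addrC.
  rewrite addrK.
  apply: le_trans (rnm_sum _ (fun i => u (m + i)%N)) _.
  apply: (@le_trans _ _ (\sum_(i < n) K * q ^+ (m + i))).
    by apply: ler_sum => i _; exact: hu.
  by rewrite -mulr_sumr -mulrA ler_wpM2l // geo_sum.
have sm e : 0 < e -> exists N, forall n, (N <= n)%N -> K * q ^+ n / (1 - q) < e.
  move=> e0.
  have [N hN] := @expr_small q (e * (1 - q) / (K + 1)) q0 q1
     (ltac:(by rewrite divr_gt0 ?mulr_gt0 //; lra)).
  exists N => n /hN; rewrite ltr_pdivlMr; last by lra.
  rewrite ltr_pdivrMr // => h; apply: le_lt_trans h.
  by rewrite mulrC ler_wpM2l ?exprn_ge0 //; lra.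
have [|l hl] := @cauchy_tends (fun n => \sum_(i < n) u i).
  move=> e e0; have [N hN] := sm (e / 2) (ltac:(lra)).
  exists N => m n hm hn.
  have := tail N (m - N)%N; have := tail N (n - N)%N; rewrite !subnKC //.
  have := hN N (leqnn _).
  have := rnmB_trans (\sum_(i < m) u i) (\sum_(i < N) u i) (\sum_(i < n) u i).
  rewrite (rnmBC (\sum_(i < N) u i) (\sum_(i < n) u i)); lra.
exists l => n; apply/ler_addgt0Pl => e e0.
have [N hN] := hl _ e0.
have := hN (n + N)%N (leq_addl _ _); have := tail n N.
have := rnmB_trans l (\sum_(i < n + N) u i) (\sum_(i < n) u i).
rewrite (rnmBC l (\sum_(i < n + N) u i)); lra.
Qed.

Lemma geo_tends (u : nat -> X) s (K q : R) : 0 <= q -> q < 1 ->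
  (forall n, rnm (s - u n) <= K * q ^+ n / (1 - q)) -> tends u s.
Proof.
move=> q0 q1 h e e0; have q10 : 0 < 1 - q by lra.
have K0 : 0 <= K.
  have := h 0%N; rewrite expr0 mulr1 => h0; have := le_trans (rnm_ge0 _) h0.
  by rewrite pmulr_lge0 // invr_gt0.
have [N hN] := @expr_small q (e * (1 - q) / (K + 1)) q0 q1
  (ltac:(by rewrite divr_gt0 ?mulr_gt0 //; lra)).
exists N => n /hN; rewrite ltr_pdivlMr; last by lra.
move=> h1; rewrite rnmBC; apply: le_lt_trans (h n) _.
rewrite ltr_pdivrMr //; apply: le_lt_trans h1.
by rewrite mulrC ler_wpM2l ?exprn_ge0 //; lra.
Qed.

Lemma closed_tends (A : set X) u l : closed A -> (forall n, A (u n)) -> tends u l -> A l.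
Proof.
move=> /closed_rnm cA Au ul; apply: cA => e e0; have [N hN] := ul _ e0.
by exists (u N) => //; rewrite rnmBC; apply: hN.
Qed.

End Completeness.

(** * Bounded operators and the open mapping theorem *)

Section Operators.
Variables (R : realType) (X : completeNormedModType (Cplx R)).
Local Notation C := (Cplx R).
Implicit Types (x y z : X) (M N Y L : set X).

Definition lin (T : X -> X) := forall (a : C) x y, T (a *: x + y) = a *: T x + T y.

Lemma lin0 T : lin T -> T 0 = 0.
Proof. by move=> hT; have := hT (-1) 0 0; rewrite scaler0 addr0 scaleN1r addNr. Qed.

Lemma linZ T a x : lin T -> T (a *: x) = a *: T x.
Proof. by move=> hT; have := hT a x 0; rewrite !addr0 (lin0 hT) addr0. Qed.

Lemma linD T x y : lin T -> T (x + y) = T x + T y.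
Proof. by move=> hT; have := hT 1 x y; rewrite !scale1r. Qed.

Lemma linN T x : lin T -> T (- x) = - T x.
Proof. by move=> hT; rewrite -scaleN1r (linZ _ _ hT) scaleN1r. Qed.

Lemma linB T x y : lin T -> T (x - y) = T x - T y.
Proof. by move=> hT; rewrite (linD _ _ hT) (linN _ hT). Qed.

Lemma lin_sum T n (u : nat -> X) : lin T ->
  T (\sum_(i < n) u i) = \sum_(i < n) T (u i).
Proof.
move=> hT; elim: n => [|n IH]; first by rewrite !big_ord0 lin0.
by rewrite !big_ord_recr /= (linD _ _ hT) IH.
Qed.

Lemma lin_iter T n : lin T -> lin (iter n T).
Proof. by move=> hT; elim: n => [|n IH] a x y //=; rewrite IH hT. Qed.

Definition bnd (T : X -> X) (K : R) := forall x, rnm (T x) <= K * rnm x.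

Lemma bounded_op_bnd T : bounded_op T -> lin T /\ exists2 K : R, 0 < K & bnd T K.
Proof.
move=> [lT cT]; split=> //.
have /nbhs_rnm[d d0 hd] : nbhs (0 : X) [set y | rnm (T y) < 1].
  apply: (cT 0 [set y | rnm y < 1]); apply/nbhs_rnm; exists 1 => // y.
  by rewrite (lin0 lT) sub0r rnmN.
exists (2 / d); first by rewrite divr_gt0.
move=> x; have [->|/eqP x0] := eqVneq x 0; first by rewrite (lin0 lT) rnm0 mulr0.
(* [t] scales [x] to norm [d / 2], inside the ball that continuity at 0 provides; hence the constant
   [2 / d]. *)
have rx := rnm_gt0 x0; set t := d / (2 * rnm x).
have t0 : 0 < t by rewrite divr_gt0 // mulr_gt0.
have := hd (real_complex R t *: x).
have tn : normc (real_complex R t) = t by rewrite normc_real // ltW.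
rewrite /= sub0r rnmN rnmZ tn (linZ _ _ lT) rnmZ tn.
have -> : t * rnm x = d / 2 by rewrite /t; field; rewrite gt_eqF.
move=> /(_ (ltac:(lra))); rewrite /t mulrC mulrA ltr_pdivrMr; last by rewrite mulr_gt0.
rewrite mul1r => h; rewrite mulrAC ler_pdivlMr //; exact: ltW.
Qed.

Lemma bnd_bounded_op T K : lin T -> bnd T K -> bounded_op T.
Proof.
move=> lT bT; split=> // x; apply/cvg_ballP => e e0.
have K1 : 0 < `|K| + 1 by rewrite ltr_wpDl.
rewrite near_map; apply/nbhs_rnm.
have e0' : 0 < complex.Re e by move: e0; rewrite ltcE => /andP[].
exists (complex.Re e / (`|K| + 1)); first by rewrite divr_gt0.
move=> y; rewrite ltr_pdivlMr // => h; rewrite -ball_normE /= normE -(linB _ _ lT).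
rewrite -[e]RRe_real ?gtr0_real // ltcR; apply: le_lt_trans h.
rewrite mulrC; apply: le_trans (bT _) _; rewrite ler_wpM2r ?rnm_ge0 //.
by rewrite (le_trans (ler_norm _)) // lerDl.
Qed.

Lemma bnd_tends T K u l : lin T -> 0 < K -> bnd T K -> tends u l ->
  tends (fun n => T (u n)) (T l).
Proof.
move=> lT K0 bT ul e e0; have [N hN] := ul (e / K) (divr_gt0 e0 K0).
exists N => n /hN; rewrite ltr_pdivlMr // => h; rewrite -(linB _ _ lT).
by apply: le_lt_trans h; rewrite mulrC.
Qed.

Lemma subspace0 M : subspace M -> M 0. Proof. by case. Qed.

Lemma subspaceZ M a x : subspace M -> M x -> M (a *: x).
Proof. by move=> [M0 hM] Mx; rewrite -[_ *: _]addr0; apply: hM. Qed.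

Lemma subspaceD M x y : subspace M -> M x -> M y -> M (x + y).
Proof. by move=> [M0 hM] Mx My; rewrite -[x]scale1r; apply: hM. Qed.

Lemma subspaceN M x : subspace M -> M x -> M (- x).
Proof. by move=> hM Mx; rewrite -scaleN1r; apply: subspaceZ. Qed.

Lemma subspaceB M x y : subspace M -> M x -> M y -> M (x - y).
Proof. by move=> hM Mx My; apply: subspaceD => //; apply: subspaceN. Qed.

Lemma subspace_sum M n (u : nat -> X) : subspace M ->
  (forall i, (i < n)%N -> M (u i)) -> M (\sum_(i < n) u i).
Proof.
move=> hM; elim: n => [|n IH] hu; first by rewrite big_ord0; apply: subspace0.
rewrite big_ord_recr /=; apply: subspaceD => //; last by apply: hu.
by apply: IH => i hi; apply: hu; rewrite ltnS ltnW.
Qed.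

(* [G y r] reads "[y] has a representation of size at most [r]". Taking preimages under an
   operator, or decompositions along a direct sum, gives the open mapping theorem on a
   subspace and the boundedness of projections without product spaces. *)
Section OpenMapping.
Variables (Y : set X) (G : X -> R -> Prop).
Hypothesis Gmono : forall y r r', G y r -> r <= r' -> G y r'.
Hypothesis Gseries : forall (u : nat -> X) y r, 0 <= r ->
  (forall n, G (u n) (r * 2^-1 ^+ n)) -> tends (fun n => \sum_(i < n) u i) y ->
  G y (2 * r).

(** Successive approximation: each correction halves the remainder, so the corrections have sizes
    [D |y| 2^-n] and sum to a representation of [y] of size [2 D |y|]. *)
Lemma gauge_iter (D : R) : 0 <= D ->
  (forall y, Y y -> exists y', [/\ Y (y - y'), G y' (D * rnm y) &
     rnm (y - y') <= rnm y / 2]) ->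
  forall y, Y y -> G y (2 * (D * rnm y)).
Proof.
move=> D0 h y Yy.
have [p hp] : {p : X -> X & forall y, Y y -> [/\ Y (y - p y), G (p y) (D * rnm y) &
     rnm (y - p y) <= rnm y / 2]}.
  apply: (@choice _ _ (fun y y' => Y y -> [/\ Y (y - y'), G y' (D * rnm y) &
     rnm (y - y') <= rnm y / 2])) => z.
  by have [Yz|nYz] := pselect (Y z); [have [y' ?] := h z Yz; exists y' | exists 0].
pose rem n := iter n (fun z => z - p z) y.
have Yr n : Y (rem n) by elim: n => //= n /hp[].
have nr n : rnm (rem n) <= rnm y * 2^-1 ^+ n.
  elim: n => [|n IH]; first by rewrite expr0 mulr1.
  have [_ _ /le_trans] := hp _ (Yr n); apply.
  by rewrite exprS; lra.
apply: (@Gseries (fun n => p (rem n))); first by rewrite mulr_ge0 ?rnm_ge0.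
  move=> n; have [_ g _] := hp _ (Yr n); apply: Gmono g _.
  by rewrite -mulrA ler_wpM2l.
have sE n : \sum_(i < n) p (rem i) = y - rem n.
  elim: n => [|n IH]; first by rewrite big_ord0 subrr.
  by rewrite big_ord_recr IH /= opprD opprK addrA.
apply: (@geo_tends _ _ _ _ (rnm y) 2^-1); rewrite ?invr_ge0 ?invf_lt1 ?ltr1n // => n.
rewrite sE opprB addrC subrK; apply: le_trans (nr n) _.
have : 0 <= rnm y * 2^-1 ^+ n by rewrite mulr_ge0 ?rnm_ge0 // exprn_ge0.
have -> : (1 - 2^-1)^-1 = 2 :> R by field.
lra.
Qed.

Hypothesis cY : closed_subspace Y.
Hypothesis Gall : forall y, Y y -> exists r, G y r.
Hypothesis GY : forall y r, G y r -> Y y.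
Hypothesis GB : forall y r y' r', G y r -> G y' r' -> G (y - y') (r + r').
Hypothesis GZ : forall a y r, G y r -> G (a *: y) (normc a * r).

(** Baire's argument, run by hand. If no set of vectors with a representation of size [n] were dense
    in a ball of [Y], nested balls could avoid these sets one after the other, and their common
    point would have no representation at all. *)
Lemma gauge_baire : exists (n : nat) y0 (e : R), [/\ Y y0, 0 < e &
  forall y, Y y -> rnm (y - y0) < e -> forall d : R, 0 < d ->
    exists2 z, G z n%:R & rnm (y - z) < d].
Proof.
apply: contrapT => hno.
have step : forall s : nat * (X * R), exists s' : X * R, Y s.2.1 -> 0 < s.2.2 ->
    [/\ Y s'.1, 0 < s'.2, rnm (s'.1 - s.2.1) <= s.2.2 / 2, s'.2 <= s.2.2 / 2 &
        forall z, G z s.1%:R -> s'.2 < rnm (s'.1 - z)].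
  move=> [n [y0 e]] /=.
  have [[Yy e0]|nn] := pselect (Y y0 /\ 0 < e); last first.
    by exists (0, 0) => Yy e0; case: nn.
  have : ~ (forall y, Y y -> rnm (y - y0) < e / 2 -> forall d : R, 0 < d ->
      exists2 z, G z n%:R & rnm (y - z) < d).
    by move=> h; apply: hno; exists n, y0, (e / 2); split=> //; lra.
  move=> /existsNP[y /not_implyP[Yy' /not_implyP[ye /existsNP[d /not_implyP[d0 hd]]]]].
  exists (y, Num.min (e / 2) (d / 2)) => _ _ /=; split=> //.
  - by rewrite lt_min !divr_gt0.
  - exact: ltW.
  - by rewrite ge_min lexx.
  - move=> z Gz; rewrite gt_min; apply/orP; right.
    rewrite ltNge; apply/negP => hz; apply: hd; exists z => //; lra.
have [f hf] := choice step.
pose s := fix s n := if n is m.+1 then f (m, s m) else ((0, 1) : X * R).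
have inv n : Y (s n).1 /\ 0 < (s n).2.
  elim: n => [|n [Yn pn]] /=; first by split; [apply: subspace0; case: cY|].
  by have [] := hf (n, s n) Yn pn.
have hs n := hf (n, s n) (inv n).1 (inv n).2.
have es n : (s n).2 <= 2^-1 ^+ n.
  elim: n => [|n IH]; first by rewrite expr0.
  by have [_ _ _ + _] := hs n; rewrite exprS /=; lra.
(* A step moves the centre by at most half the radius and shrinks the radius by at least as much, so
   the displacement is bounded by the loss of radius. *)
have dist k j : rnm ((s (k + j)%N).1 - (s k).1) <= (s k).2 - (s (k + j)%N).2.
  elim: j => [|j IH]; first by rewrite addn0 !subrr rnm0.
  have [_ _ h1 h2 _] := hs (k + j)%N; rewrite addnS.
  have := rnmB_trans (s (k + j).+1).1 (s (k + j)%N).1 (s k).1.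
  move: h1 h2 IH; rewrite /=; lra.
have dist' k n : (k <= n)%N -> rnm ((s n).1 - (s k).1) <= (s k).2.
  move=> kn; have := dist k (n - k)%N; rewrite subnKC //.
  by have [_] := inv n; lra.
have [|l hl] := @cauchy_tends _ _ (fun n => (s n).1).
  move=> e e0; have [N hN] := @expr_small R 2^-1 (e / 2)
    (ltac:(lra)) (ltac:(lra)) (ltac:(lra)).
  exists N => m n hm hn.
  have := dist' _ _ hm; have := dist' _ _ hn; have := hN N (leqnn _); have := es N.
  have := rnmB_trans (s m).1 (s N).1 (s n).1; rewrite (rnmBC (s N).1 (s n).1); lra.
have Yl : Y l by apply: (@closed_tends _ _ Y (fun n => (s n).1)) => //;
  [case: cY | move=> n; case: (inv n)].
have ls k : rnm (l - (s k).1) <= (s k).2.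
  apply/ler_addgt0Pl => e e0; have [N hN] := hl _ e0.
  have := hN (k + N)%N (leq_addl _ _); have := dist' k (k + N)%N (leq_addr _ _).
  have := rnmB_trans l (s (k + N)%N).1 (s k).1; rewrite (rnmBC l (s (k + N)%N).1); lra.
have [r Gr] := Gall Yl.
have [m Gm] : exists m : nat, G l m%:R.
  exists (Num.bound `|r|); apply: Gmono Gr _.
  by rewrite (le_trans (ler_norm _)) // ltW // archi_boundP.
have [_ _ _ _ /(_ l Gm)] := hs m; have := ls m.+1.
by rewrite rnmBC /=; lra.
Qed.

(** Differences move the density from a ball about [y0] to a ball about 0, scaling extends it to all
    of [Y], and [gauge_iter] turns approximation into equality. *)
Lemma gauge_open_mapping : exists2 D : R, 0 < D & forall y, Y y -> G y (D * rnm y).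
Proof.
have [n [y0 [e [Yy0 e0 h]]]] := gauge_baire.
have sY : subspace Y by case: cY.
have app y : Y y -> rnm y < e -> forall d : R, 0 < d ->
    exists2 z, G z (n%:R + n%:R) & rnm (y - z) < d.
  move=> Yy ye d d0; have d2 : 0 < d / 2 by lra.
  have [|z1 G1 h1] := h (y0 + y) (subspaceD sY Yy0 Yy) _ _ d2.
    by rewrite addrC addKr.
  have [|z2 G2 h2] := h y0 Yy0 _ _ d2; first by rewrite subrr rnm0.
  exists (z1 - z2); first exact: GB.
  have -> : y - (z1 - z2) = (y0 + y - z1) - (y0 - z2).
    by rewrite !opprB [RHS]addrC !addrA subrK (addrC y).
  by have := rnmB (y0 + y - z1) (y0 - z2); lra.
(* Scaling [y] to norm [e / 2] and back multiplies the size [2 n] by [2 |y| / e] and turns the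
   accuracy [e / 4] into [|y| / 2]. The summand 1 keeps [D] positive when [n = 0]. *)
set D := 4 * n%:R / e + 1.
have n0 : 0 <= n%:R :> R by [].
have D0 : 0 < D by rewrite ltr_wpDl // divr_ge0 ?mulr_ge0 // ltW.
exists (2 * D); first by lra.
move=> y Yy; rewrite -mulrA; apply: gauge_iter => //; first exact: ltW.
move=> {Yy}y Yy; have [->|/eqP yn0] := eqVneq y 0.
  have [r Gr] := Gall Yy; exists 0; rewrite subr0 rnm0; split; last by lra.
    exact: subspace0.
  by have := GZ 0 Gr; rewrite scale0r mulr0 normc0 mul0r.
have ry := rnm_gt0 yn0; pose t := e / (2 * rnm y).
have t0 : 0 < t by rewrite divr_gt0 // mulr_gt0.
have tn : normc (real_complex R t) = t by rewrite normc_real // ltW.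
have te : t * rnm y = e / 2 by rewrite /t; field; rewrite gt_eqF.
have [|||z Gz hz] := @app (real_complex R t *: y) _ _ (e / 4).
- exact: subspaceZ.
- by rewrite rnmZ tn te; lra.
- by lra.
have tc0 : real_complex R t != 0 by rewrite fmorph_eq0 gt_eqF.
exists ((real_complex R t)^-1 *: z).
have Gz' := GZ (real_complex R t)^-1 Gz.
split.
- by apply: subspaceB => //; apply: GY Gz'.
- apply: Gmono Gz' _; rewrite normcV tn /D /t.
  have -> : (e / (2 * rnm y))^-1 * (n%:R + n%:R) = 4 * n%:R / e * rnm y.
    by field; rewrite !gt_eqF.
  by rewrite ler_pM2r // lerDl.
- have -> : y - (real_complex R t)^-1 *: z = (real_complex R t)^-1 *: (real_complex R t *: y - z).
    by rewrite scalerBr scalerA mulVf // scale1r.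
  rewrite rnmZ normcV tn mulrC ler_pdivrMr // mulrC mulrA te; lra.
Qed.

End OpenMapping.

Lemma geo_half (u : nat -> X) (r : R) y : 0 <= r ->
  (forall n, rnm (u n) <= r * 2^-1 ^+ n) -> tends (fun n => \sum_(i < n) u i) y ->
  rnm y <= 2 * r.
Proof.
move=> r0 hu uy.
have [||s hs] := geo_series r0 _ _ hu; [lra|lra|].
have -> : y = s by apply: tends_unique uy _; apply: geo_tends hs; lra.
have := hs 0%N; rewrite big_ord0 subr0 expr0.
have -> : (1 - 2^-1)^-1 = 2 :> R by field.
lra.
Qed.

Lemma geo_half_ex (u : nat -> X) (r : R) : 0 <= r ->
  (forall n, rnm (u n) <= r * 2^-1 ^+ n) ->
  exists s, tends (fun n => \sum_(i < n) u i) s /\ rnm s <= 2 * r.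
Proof.
move=> r0 hu; have [||s hs] := geo_series r0 _ _ hu; [lra|lra|].
have ts : tends (fun n => \sum_(i < n) u i) s by apply: geo_tends hs; lra.
by exists s; split => //; apply: geo_half hu ts.
Qed.

Definition preim_gauge M (S : X -> X) y (r : R) := exists x, [/\ M x, S x = y & rnm x <= r].

Lemma preim_gauge_mono M S y r r' : preim_gauge M S y r -> r <= r' -> preim_gauge M S y r'.
Proof. by move=> [x [Mx Sx xr]] rr; exists x; split=> //; apply: le_trans rr. Qed.

Lemma preim_gauge_series M S K : closed_subspace M -> lin S -> 0 < K -> bnd S K ->
  forall (u : nat -> X) y r, 0 <= r ->
  (forall n, preim_gauge M S (u n) (r * 2^-1 ^+ n)) ->
  tends (fun n => \sum_(i < n) u i) y -> preim_gauge M S y (2 * r).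
Proof.
move=> [sM cM] lS K0 bS u y r r0 /choice[x hx] uy.
have [|s [ts rs]] := @geo_half_ex x r r0; first by move=> n; have [] := hx n.
exists s; split=> //.
  apply: closed_tends cM _ ts => n; apply: (@subspace_sum M n x) => // i _.
  by have [] := hx i.
apply: tends_unique uy; have := bnd_tends lS K0 bS ts.
suff -> : (fun n => S (\sum_(i < n) x i)) = (fun n => \sum_(i < n) u i) by [].
apply/funext => n; rewrite (lin_sum _ x lS); apply: eq_bigr => i _.
by have [] := hx i.
Qed.

Lemma ran_subspace M S : subspace M -> lin S -> subspace (ranM M S).
Proof.
move=> sM lS; split; first by exists 0; [exact: subspace0 | exact: lin0].
move=> a _ _ [x Mx <-] [y My <-]; exists (a *: x + y); last exact: lS.
by case: sM => _; apply.
Qed.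

(** [1 / D] is a lower bound for the reduced minimum modulus of [S] on [M]. *)
Lemma closed_range_preim M S K : closed_subspace M -> lin S -> 0 < K -> bnd S K ->
  closed (ranM M S) ->
  exists2 D : R, 0 < D & forall y, ranM M S y -> preim_gauge M S y (D * rnm y).
Proof.
move=> cM lS K0 bS cr; apply: gauge_open_mapping.
- exact: preim_gauge_mono.
- exact: preim_gauge_series bS.
- by split=> //; apply: ran_subspace => //; case: cM.
- by move=> y [x Mx Sx]; exists (rnm x), x.
- by move=> y r [x [Mx Sx _]]; exists x.
- move=> y r y' r' [x [Mx <- hx]] [x' [Mx' <- hx']]; exists (x - x'); split.
  + by apply: subspaceB => //; case: cM.
  + exact: linB.
  + exact: le_trans (rnmB _ _) (lerD _ _).
- move=> a y r [x [Mx <- hx]]; exists (a *: x); split.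
  + by apply: subspaceZ => //; case: cM.
  + exact: linZ.
  + by rewrite rnmZ ler_wpM2l // normc_ge0.
Qed.

Lemma direct_sum_uniq M N m n m' n' : subspace M -> subspace N -> M `&` N = [set 0] ->
  M m -> N n -> M m' -> N n' -> m + n = m' + n' -> m = m' /\ n = n'.
Proof.
move=> sM sN MN Mm Nn Mm' Nn' e.
have e' : m - m' = n' - n.
  have -> : m = m' + n' - n by rewrite -e addrK.
  by rewrite addrC !addrA addNr add0r.
have : (M `&` N) (m - m').
  by split; [exact: subspaceB | rewrite e'; exact: subspaceB].
rewrite MN /= => h; have h' : n' - n = 0 by rewrite -e'.
by split; apply/eqP; [rewrite -subr_eq0 h | rewrite eq_sym -subr_eq0 h'].
Qed.

Lemma direct_sum_bound M N : closed_subspace M -> closed_subspace N -> direct_sum M N ->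
  exists2 D : R, 0 < D & forall m n, M m -> N n ->
     rnm m <= D * rnm (m + n) /\ rnm n <= D * rnm (m + n).
Proof.
move=> [sM cM] [sN cN] [MN MNT].
pose G y (r : R) := exists m n, [/\ M m, N n, y = m + n, rnm m <= r & rnm n <= r].
have [|||||||D D0 hD] := @gauge_open_mapping setT G.
- move=> y r r' [m [n [? ? ? h1 h2]]] rr; exists m, n; split=> //; exact: le_trans rr.
- move=> u y r r0 /choice[m /choice[n h]] uy.
  have [|s [ts rs]] := @geo_half_ex m r r0; first by move=> i; have [] := h i.
  have [|t [tt rt]] := @geo_half_ex n r r0; first by move=> i; have [] := h i.
  exists s, t; split=> //.
  + apply: closed_tends cM _ ts => k; apply: (@subspace_sum M k m) => // i _.
    by have [] := h i.
  + apply: closed_tends cN _ tt => k; apply: (@subspace_sum N k n) => // i _.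
    by have [] := h i.
  + apply: tends_unique uy _ => e e0; have e2 : 0 < e / 2 by lra.
    have [N1 h1] := ts _ e2; have [N2 h2] := tt _ e2.
    exists (maxn N1 N2) => k; rewrite geq_max => /andP[k1 k2].
    have -> : \sum_(i < k) u i = \sum_(i < k) m i + \sum_(i < k) n i.
      by rewrite -big_split /=; apply: eq_bigr => i _; have [] := h i.
    rewrite opprD addrACA; apply: le_lt_trans (rnmD _ _) _.
    by have := h1 _ k1; have := h2 _ k2; lra.
- by split; [split | exact: closedT].
- move=> y _; have [m [n [Mm Nn ->]]] := MNT y.
  by exists (rnm m + rnm n), m, n; split=> //; rewrite ?lerDl ?lerDr rnm_ge0.
- by [].
- move=> _ r _ r' [m [n [Mm Nn -> hm hn]]] [m' [n' [Mm' Nn' -> hm' hn']]].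
  exists (m - m'), (n - n'); split; [exact: subspaceB|exact: subspaceB| | |].
  + by rewrite opprD addrACA.
  + exact: le_trans (rnmB _ _) (lerD _ _).
  + exact: le_trans (rnmB _ _) (lerD _ _).
- move=> a _ r [m [n [Mm Nn -> hm hn]]]; exists (a *: m), (a *: n).
  split; [exact: subspaceZ|exact: subspaceZ|exact: scalerDr| |];
  by rewrite rnmZ ler_wpM2l // normc_ge0.
exists D => // m n Mm Nn; have [m' [n' [Mm' Nn' e h1 h2]]] := hD (m + n) I.
by have [em en] := direct_sum_uniq sM sN MN Mm Nn Mm' Nn' e; rewrite em en in h1 h2 *.
Qed.

End Operators.

(** * Hahn-Banach *)

Section HahnBanach.
Variables (R : realType) (X : completeNormedModType (Cplx R)).
Local Notation C := (Cplx R).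
Local Notation "t %:C" := (real_complex R t : C).
Implicit Types (x y z : X) (L : set X) (q p : X -> R).

Definition sublin q := (forall x y, q (x + y) <= q x + q y) /\
  (forall (t : R) x, 0 < t -> q (t%:C *: x) <= t * q x).

Lemma sublin0 q : sublin q -> q 0 = 0.
Proof.
move=> [_ h]; have := h 2 0 (ltac:(lra)); have := h (1 / 2) 0 (ltac:(lra)).
by rewrite !scaler0; lra.
Qed.

Lemma sublinN q x : sublin q -> - q (- x) <= q x.
Proof. by move=> sq; have := sq.1 x (- x); rewrite subrr (sublin0 sq); lra. Qed.

Lemma sublinZ q (t : R) x : sublin q -> 0 <= t -> q (t%:C *: x) = t * q x.
Proof.
move=> sq; rewrite le_eqVlt => /orP[/eqP <-|t0].
  by rewrite mul0r rmorph0 scale0r (sublin0 sq).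
apply/eqP; rewrite eq_le (sq.2 _ _ t0) /=.
have := sq.2 t^-1 (t%:C *: x) (ltac:(by rewrite invr_gt0)).
rewrite scalerA -rmorphM mulVf ?gt_eqF // scale1r.
by rewrite mulrC ler_pdivlMr // mulrC.
Qed.

(** The members need not be sublinear one by one: each inequality may pass to another index [k].
    This serves chains in Zorn's lemma, [shift_sublin] and the distance to a subspace alike. *)
Lemma inf_sublin (I : Type) (P : set I) (f : I -> X -> R) (b : X -> R) :
  P !=set0 -> (forall i x, P i -> b x <= f i x) ->
  (forall i j x y, P i -> P j -> exists2 k, P k & f k (x + y) <= f i x + f j y) ->
  (forall i (t : R) x, P i -> 0 < t -> exists2 k, P k & f k (t%:C *: x) <= t * f i x) ->
  let q := fun x => inf [set f i x | i in P] in
  [/\ sublin q, forall i x, P i -> q x <= f i x & forall x, b x <= q x].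
Proof.
move=> P0 hb hD hZ q.
have lb x : has_lbound [set f i x | i in P] by exists (b x) => _ [i Pi <-]; exact: hb.
have qle i x : P i -> q x <= f i x by move=> Pi; apply: ge_inf => //; exists i.
have qge x c : (forall i, P i -> c <= f i x) -> c <= q x.
  move=> h; apply: lb_le_inf; last by move=> _ [i Pi <-]; exact: h.
  by case: P0 => i Pi; exists (f i x), i.
split=> //; last by move=> x; apply: qge => i; exact: hb.
split=> [x y|t x t0].
  rewrite -lerBlDr; apply: (qge x) => i Pi; rewrite lerBlDr -lerBlDl.
  apply: (qge y) => j Pj; rewrite lerBlDl; have [k Pk] := hD i j x y Pi Pj.
  exact/le_trans/qle.
rewrite mulrC -ler_pdivrMr //; apply: (qge x) => i Pi; rewrite ler_pdivrMr // mulrC.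
by have [k Pk] := hZ i t x Pi t0; exact/le_trans/qle.
Qed.

(* Zorn's lemma is applied to sublinear functionals rather than to partial extensions:
   by [shift_sublin] a minimal one is additive. *)
Lemma minimal_sublin p : sublin p -> exists q, [/\ sublin q, forall x, q x <= p x &
  forall q', sublin q' -> (forall x, q' x <= q x) -> forall x, q x <= q' x].
Proof.
move=> sp; pose Q q := sublin q /\ forall x, q x <= p x.
pose T := {q : X -> R | Q q}.
pose Rl (s t : T) := `[< forall x, sval t x <= sval s x >].
have [|||[q [sq qp]] hq] := @ZL_preorder T (exist Q p (conj sp (fun x => lexx _))) Rl.
- by move=> t; apply/asboolP.
- move=> r s t /asboolP h1 /asboolP h2; apply/asboolP => x; exact: le_trans (h2 x) (h1 x).
- move=> A tA; have [A0|nA] := pselect (A !=set0); last first.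
    by exists (exist Q p (conj sp (fun x => lexx _))) => s As; case: nA; exists s.
  have [|||sq hq _] := @inf_sublin T A (fun s => sval s) (fun x => - p (- x)) A0.
  + move=> [s [ss sp']] x _ /=; apply: le_trans (sublinN x ss).
    by rewrite lerN2.
  + move=> s t x y As At; have [/asboolP h|/asboolP h] := tA s t As At.
      exists t => //; case: t At h => t [st ?] /= At h.
      by apply: le_trans (st.1 _ _) _; rewrite lerD2r.
    exists s => //; case: s As h => s [ss ?] /= As h.
    by apply: le_trans (ss.1 _ _) _; rewrite lerD2l.
  + by move=> s t x As t0; exists s => //; case: s As => s [[_ hs] _] /= _; apply: hs.
  have qp x : inf [set sval i x | i in A] <= p x.
    by case: A0 => s As; apply: le_trans (hq s x As) _; case: s As => s [].
  by exists (exist Q _ (conj sq qp)) => s As; apply/asboolP => x; exact: hq.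
exists q; split=> // q' sq' h x.
have q'p y : q' y <= p y by apply: le_trans (h y) (qp y).
have /asboolP := hq (exist Q q' (conj sq' q'p)) (ltac:(exact/asboolP)).
exact.
Qed.

(** Take the infimum over [t >= 0] of [q (x + t y) - t q y]; [t = 0] and [t = 1] give the two
    bounds. If [q] is minimal, [q'] cannot be smaller, so [q x + q y <= q (x + y)]. *)
Lemma shift_sublin q y : sublin q ->
  exists q', [/\ sublin q', forall x, q' x <= q x & forall x, q' x <= q (x + y) - q y].
Proof.
move=> sq.
have [||||sq' h _] := @inf_sublin R [set t | 0 <= t]
   (fun t x => q (x + t%:C *: y) - t * q y) (fun x => - q (- x)).
- by exists 0 => /=.
- move=> t x /= t0; rewrite -(sublinZ _ sq t0) lerBrDr addrC -lerBrDr opprK.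
  have := sq.1 (x + t%:C *: y) (- x); by rewrite addrAC subrr add0r.
- move=> s t x z /= s0 t0; exists (s + t); first by rewrite /= addr_ge0.
  rewrite rmorphD /= scalerDl addrACA; have := sq.1 (x + s%:C *: y) (z + t%:C *: y).
  lra.
- move=> s t x /= s0 t0; exists (t * s); first by rewrite /= mulr_ge0 // ltW.
  rewrite rmorphM /= -scalerA -scalerDr; have := sq.2 t (x + s%:C *: y) t0; lra.
exists (fun x => inf [set q (x + t%:C *: y) - t * q y | t in [set t | 0 <= t]]).
split=> // x; first by have := h 0 x (lexx _); rewrite rmorph0 scale0r addr0 mul0r subr0.
by have := h 1 x ler01; rewrite rmorph1 scale1r mul1r.
Qed.

Lemma real_hahn_banach p e : sublin p -> exists u : X -> R,
  [/\ forall x y, u (x + y) = u x + u y, forall (t : R) x, u (t%:C *: x) = t * u x,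
      forall x, u x <= p x & p e <= u e].
Proof.
(* Minimising below [pe] rather than [p] secures the value at [e]: [pe (- e) <= - p e], so an
   additive [u <= pe] has [u e >= p e]. *)
move=> sp; have [pe [spe pep peN]] := shift_sublin e sp.
have [u [su upe hu]] := minimal_sublin spe.
have uD x y : u (x + y) = u x + u y.
  apply/eqP; rewrite eq_le su.1 /=; have [u' [su' h1 h2]] := shift_sublin y su.
  by have := hu u' su' h1 x; have := h2 x; lra.
have uN x : u (- x) = - u x.
  by have := uD x (- x); rewrite subrr (sublin0 su); lra.
exists u; split=> //.
- move=> t x; have [t0|t0] := lerP 0 t; first exact: sublinZ.
  have := sublinZ x su (ltac:(lra) : 0 <= - t).
  by rewrite rmorphN scaleNr uN; lra.
- by move=> x; apply: le_trans (upe x) (pep x).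
- have := peN (- e); rewrite addNr (sublin0 sp); have := upe (- e); rewrite uN; lra.
Qed.

(** [p] is the distance to [L]; the last two clauses express the infimum. *)
Lemma dist_sublin L : subspace L -> exists p,
  [/\ sublin p, forall x, 0 <= p x, forall x l, L l -> p x <= rnm (x - l) &
    forall x (c : R), (forall l, L l -> c <= rnm (x - l)) -> c <= p x].
Proof.
move=> sL; have L0 : L 0 by apply: subspace0.
have [||||sq h1 h2] := @inf_sublin X L (fun l x => rnm (x - l)) (fun=> 0).
- by exists 0.
- by move=> *; exact: rnm_ge0.
- move=> l m x y Ll Lm; exists (l + m); first exact: subspaceD.
  by rewrite opprD addrACA rnmD.
- move=> l t x Ll t0; exists (t%:C *: l); first exact: subspaceZ.
  by rewrite -scalerBr rnmZ normc_real // ltW.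
exists (fun x => inf [set rnm (x - l) | l in L]); split=> //.
  by move=> x l Ll; exact: h1.
move=> x c h; apply: lb_le_inf; last by move=> _ [l Ll <-]; exact: h.
by exists (rnm (x - 0)), 0.
Qed.

Lemma hahn_banach L e : closed_subspace L -> ~ L e -> exists psi : X -> C,
  [/\ forall (a : C) x y, psi (a *: x + y) = a * psi x + psi y,
      exists2 K : R, 0 < K & forall x, normc (psi x) <= K * rnm x,
      forall x, L x -> psi x = 0 & psi e = 1].
Proof.
move=> [sL cL] nLe; have [p [sp p0 pL ple]] := dist_sublin sL.
have pe : 0 < p e.
  have : ~ forall d : R, 0 < d -> exists2 y, L y & rnm (e - y) < d.
    by move=> h; apply: nLe; move/closed_rnm: cL; apply.
  move=> /existsNP[d /not_implyP[d0 hd]]; apply: lt_le_trans d0 _; apply: ple => l Ll.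
  by rewrite leNgt; apply/negP => hl; apply: hd; exists l.
have [u [uD uZ up ue]] := real_hahn_banach e sp.
have uN x : u (- x) = - u x.
  by have := uD 0 0; have := uD x (- x); rewrite subrr addr0; lra.
have pn x : p x <= rnm x by have := pL x 0 (subspace0 sL); rewrite subr0.
have ub x : `|u x| <= rnm x.
  rewrite ler_norml (le_trans (up x) (pn x)) andbT.
  by have := le_trans (up (- x)) (pn (- x)); rewrite rnmN uN; lra.
have uL x : L x -> u x = 0.
  have h y : L y -> u y <= 0.
    by move=> Ly; apply: le_trans (up y) _; have := pL y y Ly; rewrite subrr rnm0.
  move=> Lx; have := h x Lx; have := h (- x) (subspaceN sL Lx); rewrite uN; lra.
pose im : C := Complex 0 1.
(* The usual complexification [u x - i u (i x)] of a real functional. It is nonzero at [e] because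
   its real part there is at least the distance from [e] to [L]. *)
pose psi0 x : C := Complex (u x) (- u (im *: x)).
have psiE (a : C) x : a *: x = (complex.Re a)%:C *: x + (complex.Im a)%:C *: (im *: x).
  rewrite scalerA -scalerDl; congr (_ *: _); case: a => a b.
  by rewrite /= /im; apply/eqP; rewrite eq_complex /=; apply/andP; split; apply/eqP; ring.
have psi0L (a : C) x y : psi0 (a *: x + y) = a * psi0 x + psi0 y.
  have h1 : u (a *: x) = complex.Re a * u x + complex.Im a * u (im *: x).
    by rewrite psiE uD !uZ.
  have h2 : u (im *: (a *: x)) = complex.Re a * u (im *: x) - complex.Im a * u x.
    rewrite scalerA mulrC -scalerA psiE uD !uZ scalerA.
    have -> : im * im = -1.
      by rewrite /im; apply/eqP; rewrite eq_complex /=; apply/andP; split; apply/eqP; ring.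
    by rewrite scaleN1r uN mulrN.
  rewrite /psi0 scalerDr !uD h1 h2; case: a {h1 h2} => a b /=.
  by apply/eqP; rewrite eq_complex /=; apply/andP; split; apply/eqP; ring.
have p0e : psi0 e != 0.
  by apply/negP => /eqP[h _]; move: ue; rewrite h; lra.
exists (fun x => psi0 x / psi0 e); split.
- by move=> a x y; rewrite psi0L; field.
- exists (2 / normc (psi0 e)); first by rewrite divr_gt0 // normc_gt0.
  move=> x; rewrite normcM normcV mulrAC ler_pM2r ?invr_gt0 ?normc_gt0 //.
  have -> : psi0 x = (u x)%:C + (- u (im *: x))%:C * im.
    by apply/eqP; rewrite eq_complex /=; apply/andP; split; apply/eqP; ring.
  have n1 : normc im = 1 by rewrite /= expr0n expr1n add0r sqrtr1.
  have nr (t : R) : normc t%:C = `|t| by rewrite /= expr0n addr0 sqrtr_sqr.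
  apply: le_trans (normcD _ _) _; rewrite normcM n1 mulr1 !nr normrN.
  by have := ub x; have := ub (im *: x); rewrite rnmZ n1; lra.
- move=> x Lx; rewrite [psi0 x]/psi0 (uL _ Lx) (uL (im *: x)); last exact: subspaceZ.
  by rewrite oppr0 mul0r.
- by rewrite divff.
Qed.

End HahnBanach.

(** * Finite-dimensional subspaces *)

Section FiniteDim.
Variables (R : realType) (X : completeNormedModType (Cplx R)).
Local Notation C := (Cplx R).
Implicit Types (x y z e : X) (M N A B : set X) (s : seq X).

(** The linear span, peeled one generator at a time. Induction on the list [s] then takes the place
    of a theory of dimension. *)
Fixpoint spn s : set X :=
  if s is e :: s' then [set x | exists c : C, spn s' (x - c *: e)] else [set 0].

Lemma spn_subspace s : subspace (spn s).
Proof.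
elim: s => [|e s IH]; first by split=> // a x y -> ->; rewrite scaler0 addr0.
split=> [|a x y [c hc] [d hd]].
  by exists 0; rewrite scale0r subr0; apply: subspace0.
exists (a * c + d); rewrite scalerDl -scalerA opprD addrACA -scalerBr.
by case: IH => _; apply.
Qed.

Lemma spn_sum s x : spn s x <-> exists c : 'I_(size s) -> C, x = \sum_(i < size s) c i *: s`_i.
Proof.
elim: s x => [|e s IH] x /=.
  by split=> [->|[c ->]]; [exists (fun=> 0)|]; rewrite big_ord0.
split=> [[a /IH[c hc]]|[c ->]].
  exists (fun i => if unlift ord0 i is Some j then c j else a).
  rewrite big_ord_recl unlift_none /= addrC; apply/eqP; rewrite -subr_eq hc.
  by apply/eqP; apply: eq_bigr => i _; rewrite liftK.
exists (c ord0); apply/IH; exists (fun i => c (lift ord0 i)).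
by rewrite big_ord_recl /= addrC addKr.
Qed.

Lemma finite_dimP A : finite_dim A <-> exists s, A `<=` spn s.
Proof. by split=> -[s hs]; exists s => x /hs/spn_sum. Qed.

Lemma finite_dimS A B : A `<=` B -> finite_dim B -> finite_dim A.
Proof. by move=> AB [s hs]; exists s => x /AB/hs. Qed.

Lemma spn_cons_mem e s : spn (e :: s) e.
Proof. by exists 1; rewrite scale1r subrr; apply: subspace0 (spn_subspace s). Qed.

Lemma spn_consr e s x : spn s x -> spn (e :: s) x.
Proof. by move=> h; exists 0; rewrite scale0r subr0. Qed.

Lemma spn_cons_sub A e s : subspace A -> A e -> spn s `<=` A -> spn (e :: s) `<=` A.
Proof.
move=> sA Ae h x [c /h hx]; rewrite -(subrK (c *: e) x).
by apply: subspaceD => //; apply: subspaceZ.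
Qed.

Lemma spn_cat s t x y : spn s x -> spn t y -> spn (s ++ t) (x + y).
Proof.
elim: s x => [|e s IH] x /=; first by move=> ->; rewrite add0r.
by move=> [c hc] hy; exists c; rewrite addrAC; apply: IH.
Qed.

Lemma finite_dimD A B : finite_dim A -> finite_dim B ->
  finite_dim [set x | exists y z, [/\ A y, B z & x = y + z]].
Proof.
move=> /finite_dimP[s hs] /finite_dimP[t ht]; apply/finite_dimP; exists (s ++ t).
by move=> _ [y [z [/hs ys /ht zt ->]]]; apply: spn_cat.
Qed.

Lemma spn_map (T : X -> X) s x : lin T -> spn s x -> spn (map T s) (T x).
Proof.
move=> lT; elim: s x => [|e s IH] x /=; first by move=> ->; rewrite (lin0 lT).
by move=> [c /IH h]; exists c; rewrite -(linZ _ _ lT) -(linB _ _ lT).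
Qed.

Lemma finite_dim_image A (T : X -> X) : lin T -> finite_dim A -> finite_dim (T @` A).
Proof.
move=> lT /finite_dimP[s hs]; apply/finite_dimP; exists (map T s) => _ [x /hs hx <-].
exact: spn_map.
Qed.

Lemma finite_dim0 : finite_dim [set (0 : X)].
Proof. by apply/finite_dimP; exists [::]. Qed.

Lemma subspaceI A B : subspace A -> subspace B -> subspace (A `&` B).
Proof.
move=> sA sB; split; first by split; apply: subspace0.
by move=> a x y [Ax Bx] [Ay By]; split; [case: sA|case: sB] => _; apply.
Qed.

(** Gaussian elimination inside [A]: [a] has a nonzero coefficient at [e] and serves as the
    pivot. *)
Lemma spn_elim A e s a b : subspace A -> A a -> A b ->
  spn (e :: s) a -> ~ spn s a -> spn (e :: s) b ->
  exists d : C, spn s (b - d *: a) /\ A (b - d *: a).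
Proof.
move=> sA Aa Ab [c hc] na [c' hc'].
have c0 : c != 0 by apply/eqP => c0; apply: na; move: hc; rewrite c0 scale0r subr0.
exists (c' / c); split; last by apply: subspaceB => //; apply: subspaceZ.
have -> : b - (c' / c) *: a = (b - c' *: e) - (c' / c) *: (a - c *: e).
  by rewrite scalerBr scalerA divfK // opprB addrA subrK.
by apply: subspaceB hc' _; [|apply: subspaceZ hc]; exact: spn_subspace.
Qed.

Lemma spn_basis A s : subspace A -> A `<=` spn s ->
  exists2 s', A = spn s' & (size s' <= size s)%N.
Proof.
elim: s A => [|e s IH] A sA hA.
  exists [::] => //; apply/seteqP; split=> // x /= ->; exact: subspace0.
have [s' Es' ss'] := IH (A `&` spn s) (subspaceI sA (spn_subspace s)) (@subIsetr _ _ _).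
have [h|/existsNP[a /not_implyP[Aa na]]] := pselect (A `<=` spn s).
  by exists s'; [rewrite -Es'; apply/esym/setIidPl | rewrite /= ltnW].
exists (a :: s') => //; apply/seteqP; split=> [b Ab|].
  have [d [hd1 hd2]] := spn_elim sA Aa Ab (hA _ Aa) na (hA _ Ab).
  by exists d; rewrite -Es'; split.
by apply: spn_cons_sub => //; rewrite -Es'; exact: subIsetl.
Qed.

(** Drop the generator [e]. Either some [A k] already lies in the span of the rest, or every [A n]
    contains a pivot for [e], and stability of the traces on [spn s] carries over. *)
Lemma spn_stable (A : nat -> set X) s : (forall n, subspace (A n)) ->
  (forall n, A n.+1 `<=` A n) -> A 0%N `<=` spn s ->
  exists d, forall n, (d <= n)%N -> A d `<=` A n.
Proof.
move=> + + ; elim: s A => [|e s IH] A sA dA A0.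
  by exists 0%N => n _ x /A0 ->; apply: subspace0.
have mA m n : (m <= n)%N -> A n `<=` A m.
  by move=> /subnKC <-; elim: (n - m)%N => [|k IHk]; rewrite ?addn0 // addnS => x /dA/IHk.
have [|||d hd] := IH (fun n => A n `&` spn s).
- by move=> n; apply: subspaceI => //; exact: spn_subspace.
- by move=> n; apply: setSI.
- exact: subIsetr.
have [[k hk]|/forallNP hk] := pselect (exists k, A k `<=` spn s).
  exists (maxn d k) => n; rewrite geq_max => /andP[dn kn] x hx.
  have [] // := hd n dn x; split; first exact: mA (leq_maxl d k) _ hx.
  by apply: hk; exact: mA (leq_maxr d k) _ hx.
exists d => n dn b hb; have /existsNP[a /not_implyP[Aa na]] := hk n.
have hA m x : A m x -> spn (e :: s) x by move=> /(mA _ _ (leq0n m))/A0.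
have [t [h1 h2]] := spn_elim (sA d) (mA _ _ dn _ Aa) hb (hA _ _ Aa) na (hA _ _ hb).
have [h3 _] := hd n dn _ (conj h2 h1).
by rewrite -(subrK (t *: a) b); apply: subspaceD => //; apply: subspaceZ.
Qed.

(** Steinitz exchange. The exact drop by one in the number of generators drives the induction of
    [usb_split]. *)
Lemma spn_exchange e s : spn s e -> e <> 0 ->
  exists2 s', spn s `<=` spn (e :: s') & size s = (size s').+1.
Proof.
elim: s => [|f s IH] /=; first by move=> ->.
move=> [c hc] e0; have [c0|c0] := eqVneq c 0.
  move: hc; rewrite c0 scale0r subr0 => /IH /(_ e0)[s' h1 h2].
  exists (f :: s'); last by rewrite /= h2.
  apply: (@spn_cons_sub (spn [:: e, f & s'])); first exact: spn_subspace.
    by apply: spn_consr; apply: spn_cons_mem.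
  move=> x /h1[a ha]; exists a; exact: spn_consr.
exists s => //; apply: (@spn_cons_sub (spn (e :: s))); first exact: spn_subspace.
  exists c^-1.
  have -> : f - c^-1 *: e = - c^-1 *: (e - c *: f).
    by rewrite scaleNr scalerBr scalerA mulVf // scale1r opprB.
  by apply: subspaceZ => //; exact: spn_subspace.
by move=> x; exact: spn_consr.
Qed.

(** When [e] is not in [M], a continuous functional that vanishes on [M] and is 1 at [e] recovers
    the coefficient [c], so coefficients converge along with the vectors. *)
Lemma closed_line_add M e : closed_subspace M ->
  closed_subspace [set x | exists c : C, M (x - c *: e)].
Proof.
move=> [sM cM]; split.
  split=> [|a x y [c hc] [d hd]].
    by exists 0; rewrite scale0r subr0; apply: subspace0.
  exists (a * c + d); rewrite scalerDl -scalerA opprD addrACA -scalerBr.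
  by case: sM => _; apply.
have [Me|nMe] := pselect (M e).
  suff -> : [set x | exists c : C, M (x - c *: e)] = M by [].
  apply/seteqP; split=> x /= => [[c hc]|Mx].
    by rewrite -(subrK (c *: e) x); apply: subspaceD => //; apply: subspaceZ.
  by exists 0; rewrite scale0r subr0.
have [psi [lp [K K0 bp] p0 p1]] := hahn_banach (conj sM cM) nMe.
apply/closed_rnm => x hx; exists (psi x).
have pB y z : psi (y - z) = psi y - psi z.
  by rewrite -scaleN1r addrC lp mulN1r addrC.
move/closed_rnm: (cM); apply=> d d0.
have E0 : 0 < 1 + K * rnm e by rewrite ltr_pwDl // mulr_ge0 ?rnm_ge0 // ltW.
have [y [c hc] hy] := hx (d / (1 + K * rnm e)) (divr_gt0 d0 E0).
have pc : psi y = c.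
  have := p0 _ hc; rewrite pB => /eqP; rewrite subr_eq0 => /eqP ->.
  by rewrite -[c *: e]addr0 lp p1 (p0 _ (subspace0 sM)) mulr1 addr0.
exists (y - c *: e) => //.
have -> : x - psi x *: e - (y - c *: e) = (x - y) - psi (x - y) *: e.
  by rewrite pB pc scalerBl !opprB addrACA [RHS]addrACA; congr (_ + _); exact: addrC.
apply: le_lt_trans (rnmB _ _) _; rewrite rnmZ.
move: hy; rewrite ltr_pdivlMr // => /le_lt_trans; apply.
rewrite mulrDr mulr1 lerD2l mulrA ler_wpM2r ?rnm_ge0 // mulrC; exact: bp.
Qed.

Lemma closed_spn_add M s : closed_subspace M ->
  closed_subspace [set x | exists2 m, M m & spn s (x - m)].
Proof.
move=> cM; elim: s => [|e s IH].
  suff -> : [set x | exists2 m, M m & spn [::] (x - m)] = M by [].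
  apply/seteqP; split=> x /= => [[m Mm /eqP]|Mx]; first by rewrite subr_eq0 => /eqP ->.
  by exists x => //; rewrite subrr.
suff -> : [set x | exists2 m, M m & spn (e :: s) (x - m)] =
  [set x | exists c : C, [set x | exists2 m, M m & spn s (x - m)] (x - c *: e)].
  exact: closed_line_add.
apply/seteqP; split=> x /= => [[m Mm [c hc]]|[c [m Mm h]]].
  by exists c, m => //; rewrite addrAC.
by exists m => //; exists c; rewrite addrAC.
Qed.

Lemma closed_subspace0 : closed_subspace [set (0 : X)].
Proof.
split; first exact: (spn_subspace [::]).
apply/closed_rnm => x h /=; apply: rnm_small => e /h[_ ->]; rewrite subr0; exact: ltW.
Qed.

End FiniteDim.

(** * Closed ranges and Kato operators *)

Section ClosedRange.
Variables (R : realType) (X : completeNormedModType (Cplx R)).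
Local Notation C := (Cplx R).
Implicit Types (x y z e : X) (M N A B Y : set X) (S T : X -> X).

Definition invar T M := forall x, M x -> M (T x).

Lemma op_invariantP T M : op_invariant T M <-> invar T M.
Proof. by split=> [h x Mx|h _ [x Mx <-]]; [apply: h; exists x | apply: h]. Qed.

Lemma invar_iter T M n x : invar T M -> M x -> M (iter n T x).
Proof. by move=> hT Mx; elim: n => //= n; exact: hT. Qed.

Lemma iter_ran T M m n x : invar T M -> M x -> ranM M (iter m T) (iter (m + n) T x).
Proof. by move=> hT Mx; exists (iter n T x); [exact: invar_iter|rewrite iterD]. Qed.

Lemma ran_iter_dec T M m n : invar T M -> (m <= n)%N ->
  ranM M (iter n T) `<=` ranM M (iter m T).
Proof. by move=> hT mn _ [x Mx <-]; rewrite -(subnKC mn); exact: iter_ran. Qed.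

Lemma ran_iterS T M n : ranM M (iter n.+1 T) = T @` ranM M (iter n T).
Proof.
apply/seteqP; split=> [_ [x Mx <-]|_ [_ [x Mx <-] <-]]; last by exists x.
by exists (iter n T x) => //; exists x.
Qed.

Lemma lin_shift T (l : C) : lin T -> lin (shift T l).
Proof.
move=> lT a x y; rewrite /shift lT scalerDr opprD addrACA scalerBr !scalerA.
by rewrite (mulrC l).
Qed.

Lemma bnd_shift T (l : C) K : bnd T K -> bnd (shift T l) (K + normc l).
Proof.
move=> bT x; apply: le_trans (rnmB _ _) _.
by rewrite mulrDl rnmZ lerD2r.
Qed.

Lemma invar_shift T M (l : C) : subspace M -> invar T M -> invar (shift T l) M.
Proof. by move=> sM hT x Mx; apply: subspaceB; [|exact: hT|exact: subspaceZ]. Qed.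

Lemma ker_subspace M S : subspace M -> lin S -> subspace (kerM M S).
Proof.
move=> sM lS; split; first by split; [exact: subspace0|exact: lin0].
move=> a x y [Mx Sx] [My Sy]; split; first by case: sM => _; apply.
by rewrite lS Sx Sy scaler0 addr0.
Qed.

Section OneOperator.
Variables (M : set X) (S : X -> X) (K : R).
Hypotheses (cM : closed_subspace M) (lS : lin S) (K0 : 0 < K) (bS : bnd S K)
  (iS : invar S M) (cr : closed (ranM M S)).
Let sM : subspace M := cM.1.

(** Let [y = S u] be a limit of values [S x] with [x] in [B]. A small [v] with [S v = S x - y] makes
    [u + v] differ from [x] by a kernel vector, so [u + v] is in [B], and it is close to [u]. *)
Lemma image_closed B : subspace B -> closed B -> B `<=` M ->
  (forall x k, B x -> kerM M S k -> B (x + k)) -> closed (S @` B).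
Proof.
move=> sB cB BM sat.
have [D D0 hD] := closed_range_preim cM lS K0 bS cr.
apply/closed_rnm => y hy.
have [u Mu Su] : ranM M S y.
  move/closed_rnm: cr; apply=> e /hy[_ [x Bx <-] h]; exists (S x) => //.
  by exists x => //; exact: BM.
exists u => //; move/closed_rnm: cB; apply=> e e0.
have [_ [x Bx <-] h] := hy (e / D) (divr_gt0 e0 D0).
have [v [Mv Sv rv]] : preim_gauge M S (S x - y) (D * rnm (S x - y)).
  apply: hD; rewrite -Su -(linB _ _ lS); exists (x - u) => //.
  by apply: subspaceB => //; exact: BM.
exists (u + v); last first.
  rewrite opprD addNKr rnmN; apply: le_lt_trans rv _.
  by rewrite rnmBC mulrC -ltr_pdivlMr.
have -> : u + v = x + (u + v - x) by rewrite [RHS]addrC subrK.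
apply: sat => //; split.
  by apply: subspaceB => //; [exact: subspaceD|exact: BM].
by rewrite (linB _ _ lS) (linD _ _ lS) Su Sv [y + _]addrC subrK subrr.
Qed.

Lemma ran_iter_subspace n : subspace (ranM M (iter n S)).
Proof. by apply: ran_subspace => //; exact: lin_iter. Qed.

Lemma ran_iter_sub n : ranM M (iter n S) `<=` M.
Proof. by move=> _ [x Mx <-]; exact: invar_iter. Qed.

Lemma usf_ran_iter_closed n : finite_dim (kerM M S) -> closed (ranM M (iter n S)).
Proof.
move=> /finite_dimP[s0 hs0].
have [s Es _] := spn_basis (ker_subspace sM lS) hs0.
elim: n => [|n IH].
  suff -> : ranM M (iter 0 S) = M by case: cM.
  by apply/seteqP; split=> [_ [x Mx <-] //|x Mx]; exists x.
(* Adding the finite-dimensional kernel to the range keeps it closed, makes it kernel-saturated and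
   does not change its image. *)
pose B := [set x | exists2 m, ranM M (iter n S) m & spn s (x - m)].
have [sB cB] : closed_subspace B.
  by apply: closed_spn_add; split=> //; exact: ran_iter_subspace.
have BE : S @` B = ranM M (iter n.+1 S).
  rewrite ran_iterS; apply/seteqP; split=> [_ [x [m Bm hx] <-]|_ [x Bx <-]].
    exists m => //; move: hx; rewrite -Es => -[_ /eqP].
    by rewrite (linB _ _ lS) subr_eq0 => /eqP.
  exists x => //; exists x => //; rewrite subrr; exact: subspace0 (spn_subspace s).
rewrite -BE; apply: image_closed => //.
  move=> x [m Bm]; rewrite -Es => -[Mxm _]; rewrite -(subrK m x).
  by apply: subspaceD => //; exact: ran_iter_sub Bm.
move=> x k [m Bm hx] hk; exists m => //; rewrite addrAC.
by apply: subspaceD => //; [exact: spn_subspace|rewrite -Es].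
Qed.

(** The Kato condition makes every range kernel-saturated, which is what [image_closed] requires. *)
Lemma kato_ran_iter_closed n : (forall n, kerM M S `<=` ranM M (iter n S)) ->
  closed (ranM M (iter n S)).
Proof.
move=> hk; elim: n => [|n IH].
  suff -> : ranM M (iter 0 S) = M by case: cM.
  by apply/seteqP; split=> [_ [x Mx <-] //|x Mx]; exists x.
rewrite ran_iterS; apply: image_closed => //.
- exact: ran_iter_subspace.
- exact: ran_iter_sub.
- by move=> x k Bx /(hk n); apply: subspaceD => //; exact: ran_iter_subspace.
Qed.

(* [Y] is the generalized range [\bigcap_n R(S^n)]. *)
Lemma kato_core : (forall n, kerM M S `<=` ranM M (iter n S)) ->
  exists Y, [/\ closed_subspace Y, Y `<=` M, kerM M S `<=` Y &
   exists2 D : R, 0 < D & forall y, Y y -> preim_gauge Y S y (D * rnm y)].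
Proof.
move=> hk; exists [set x | forall n, ranM M (iter n S) x].
have [D D0 hD] := closed_range_preim cM lS K0 bS cr.
split.
- split.
    split=> [n|a x y hx hy n]; first exact: subspace0 (ran_iter_subspace n).
    by have [_] := ran_iter_subspace n; apply.
  apply/closed_rnm => x hx n; have /closed_rnm := kato_ran_iter_closed hk (n := n); apply.
  by move=> e /hx[y hy ?]; exists y.
- by move=> x /(_ 0%N)[y My <-].
- by move=> x kx n; exact: hk.
exists D => // y hy; have [x [Mx Sx rx]] := hD _ (hy 1%N).
(* The preimage [x] is in every range: if [y = S^(n+1) z], then [x] and [S^n z] differ by a kernel
   vector, which lies in the range of [S^n]. *)
exists x; split=> // n; have [z Mz zy] := hy n.+1.
rewrite -(subrK (iter n S z) x); apply: subspaceD; first exact: ran_iter_subspace.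
  apply: hk; split; first by apply: subspaceB => //; exact: invar_iter.
  by rewrite (linB _ _ lS) Sx -zy subrr.
by exists z.
Qed.

End OneOperator.

(** A preimage [x] of [y] under [S] is an approximate one under [S - l]: the remainder is [l x], at
    most half of [y], so [gauge_iter] applies. *)
Lemma shift_surj Y S K D (l : C) : closed_subspace Y -> lin S -> 0 < K -> bnd S K ->
  0 < D -> (forall y, Y y -> preim_gauge Y S y (D * rnm y)) -> normc l * D <= 1 / 2 ->
  forall y, Y y -> preim_gauge Y (shift S l) y (2 * (D * rnm y)).
Proof.
move=> cY lS K0 bS D0 hD lD; apply: gauge_iter.
- exact: preim_gauge_mono.
- apply: (@preim_gauge_series _ _ _ _ (K + normc l)) => //; first exact: lin_shift.
    by rewrite ltr_pwDl // normc_ge0.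
  exact: bnd_shift.
- exact: ltW.
move=> y Yy; have [x [Yx Sx rx]] := hD y Yy.
have hy : y - shift S l x = l *: x by rewrite /shift Sx opprB addrC subrK.
exists (shift S l x); rewrite hy; split.
- by apply: subspaceZ => //; case: cY.
- by exists x.
- rewrite rnmZ; apply: le_trans (ler_wpM2l (normc_ge0 l) rx) _.
  by rewrite mulrA; have := ler_wpM2r (rnm_ge0 y) lD; lra.
Qed.

(** Pulling [v0] back [p] times gives a vector killed by [L^(p+1)] but not by [L^p]. *)
Lemma surj_infinite_ascent Y M L v0 : Y `<=` M ->
  (forall y, Y y -> exists2 x, Y x & L x = y) -> Y v0 -> v0 <> 0 -> lin L -> L v0 = 0 ->
  ~ finite_ascent_on M L.
Proof.
move=> YM hL Yv v0n lL Lv [p hp].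
have [v Yv' hv] : exists2 v, Y v & iter p L v = v0.
  elim: p {hp} => [|p [v Yv' hv]]; first by exists v0.
  by have [x Yx Lx] := hL v Yv'; exists x => //; rewrite iterSr Lx.
have : kerM M (iter p.+1 L) v by split; [exact: YM|rewrite iterS hv].
by rewrite -hp => -[_]; rewrite hv.
Qed.

Lemma kato_perturb M S K : closed_subspace M -> lin S -> 0 < K -> bnd S K ->
  invar S M -> kato_on M S -> (exists2 x, kerM M S x & x <> 0) ->
  exists2 d : R, 0 < d & forall l : C, normc l < d ->
    (exists x, [/\ M x, x <> 0 & shift S l x = 0]) /\ ~ finite_ascent_on M (shift S l).
Proof.
move=> cM lS K0 bS iS [cr hk] [x0 kx0 x0n].
have [Y [cY YM kY [D D0 hD]]] := kato_core cM lS K0 bS iS cr hk.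
exists (1 / (2 * D)); first by rewrite divr_gt0 // mulr_gt0.
move=> l; rewrite ltr_pdivlMr ?mulr_gt0 // => hl.
have [||x [Yx hx rx]] := shift_surj cY lS K0 bS D0 hD (l := l) _ (y := x0).
- by lra.
- exact: kY.
(* Since [(S - l) x = x0] and [(S - l) x0 = - l x0], the vector [v] is killed. It is nonzero because
   [|l x| <= 2 D |l| |x0| < |x0|]. *)
set v := x0 + l *: x.
have Yv : Y v by apply: subspaceD; [case: cY|exact: kY|apply: subspaceZ => //; case: cY].
have vn : v <> 0.
  move=> /eqP; rewrite addr_eq0 => /eqP e; have := rnm_gt0 x0n.
  have : rnm x0 <= (normc l * (2 * D)) * rnm x0.
    rewrite {1}e rnmN rnmZ -mulrA ler_wpM2l ?normc_ge0 // -mulrA; exact: rx.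
  move=> h1 h2; have := ltr_pM2r h2 (normc l * (2 * D)) 1; rewrite hl mul1r; lra.
have Lv : shift S l v = 0.
  have lL := lin_shift l lS; rewrite (linD _ _ lL) (linZ _ _ lL) hx /shift.
  by case: kx0 => _ ->; rewrite sub0r addNr.
split; first by exists v; split=> //; exact: YM.
apply: (surj_infinite_ascent YM _ Yv vn (lin_shift l lS) Lv) => y Yy.
have [|z [Yz hz _]] := shift_surj cY lS K0 bS D0 hD (l := l) _ Yy; first by lra.
by exists z.
Qed.

End ClosedRange.

(** * Semi-Fredholm and Riesz operators *)

Section Semifredholm.
Variables (R : realType) (X : completeNormedModType (Cplx R)).
Local Notation C := (Cplx R).
Implicit Types (x y z e : X) (M N A B Y : set X) (S T : X -> X).

Lemma shiftE S (l : C) x : shift S l x = 0 -> S x = l *: x.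
Proof. by move/eqP; rewrite subr_eq0 => /eqP. Qed.

Lemma shiftD S (l m : C) : shift (shift S l) m = shift S (l + m).
Proof. by apply/funext => x; rewrite /shift scalerDl opprD addrA. Qed.

Lemma iter_eigen S (l : C) x n : lin S -> S x = l *: x -> iter n S x = l ^+ n *: x.
Proof.
move=> lS h; elim: n => [|n IH]; first by rewrite expr0 scale1r.
by rewrite iterS IH (linZ _ _ lS) h scalerA exprSr.
Qed.

(** The kernel meets the decreasing ranges in finite-dimensional spaces, constant from some [d] on.
    On the range of [S^d] the operator is therefore Kato: a nonzero kernel there persists under
    perturbation, while a zero one gives finite ascent and excludes small nonzero eigenvalues. *)
Lemma usf_dichotomy M S K : closed_subspace M -> lin S -> 0 < K -> bnd S K ->
  invar S M -> finite_dim (kerM M S) -> closed (ranM M S) ->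
  (exists2 d : R, 0 < d & forall l : C, normc l < d ->
     exists x, [/\ M x, x <> 0 & shift S l x = 0]) \/
  (finite_ascent_on M S /\ exists2 d : R, 0 < d & forall l : C, l != 0 -> normc l < d ->
     forall x, M x -> shift S l x = 0 -> x = 0).
Proof.
move=> cM lS K0 bS iS fk cr; have sM := cM.1.
have [s hs] := (finite_dimP _).1 fk.
have rs n := ran_iter_subspace cM lS n.
have rc n := usf_ran_iter_closed cM lS K0 bS iS cr (n := n) fk.
pose A n := kerM M S `&` ranM M (iter n S).
have [|||d hd] := @spn_stable _ _ A s.
- by move=> n; apply: subspaceI => //; exact: ker_subspace.
- by move=> n x [kx rx]; split=> //; apply: ran_iter_dec rx.
- by move=> x [/hs].
pose Md := ranM M (iter d S).
have cMd : closed_subspace Md by split; [exact: rs|exact: rc].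
have MdM : Md `<=` M by exact: ran_iter_sub.
have iMd : invar S Md.
  move=> _ [x Mx <-]; apply: (@ran_iter_dec _ _ S M d d.+1) => //; by exists x.
have crd : closed (ranM Md S) by rewrite /ranM -ran_iterS; exact: rc.
have [h0|/existsNP[x0 /not_implyP[[kx0 rx0] x0n]]] := pselect (A d `<=` [set 0]);
  [right|left].
  split.
    exists d; apply/seteqP; split=> [x [Mx hx]|x [Mx hx]]; split=> //.
      by rewrite iterS hx (lin0 lS).
    by apply: h0; split; [split; [exact: invar_iter|]|exists x].
  have [D D0 hD] := closed_range_preim cMd lS K0 bS crd.
  exists (1 / D); first by rewrite divr_gt0.
  move=> l l0; rewrite ltr_pdivlMr // => lD x Mx /shiftE hx.
  (* An eigenvector for [l <> 0] lies in every range, since [x = S^d (l^-d x)]. *)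
  have Mdx : Md x.
    exists ((l ^+ d)^-1 *: x); first exact: subspaceZ.
    rewrite (linZ _ _ (lin_iter d lS)) (iter_eigen _ lS hx) scalerA mulVf ?scale1r //.
    by rewrite expf_neq0.
  have [y [Mdy Sy ry]] := hD (S x) (ex_intro2 _ _ x Mdx erefl).
  have yx : y = x.
    apply/eqP; rewrite -subr_eq0; apply/eqP; apply: h0; split.
      split; last by rewrite (linB _ _ lS) Sy subrr.
      by apply: MdM; apply: subspaceB cMd.1 Mdy Mdx.
    exact: subspaceB cMd.1 Mdy Mdx.
  move: ry; rewrite yx hx rnmZ => h.
  apply: contrapT => /rnm_gt0 x0; move: h; rewrite mulrA mulrC leNgt.
  by rewrite mulrC gtr_pMl // mulrC lD.
(* The kernel on [Md] is contained in [A d], hence in the ranges of all [S^(d+n)]; this is the Kato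
   condition on [Md]. *)
have kA : kerM Md S `<=` A d by move=> x [Mdx Sx]; split=> //; split=> //; exact: MdM.
have [||e e0 he] := @kato_perturb _ _ Md S K cMd lS K0 bS iMd.
- split=> // n x /kA/(hd (d + n)%N (leq_addr _ _))[_ [y My <-]].
  by rewrite addnC iterD; exists (iter d S y) => //; exists y.
- by exists x0 => //; split=> //; case: kx0.
exists e => // l /he[[x [Mdx xn hx]] _]; exists x; split=> //; exact: MdM.
Qed.

Lemma cplx_near (l : C) (d : R) : 0 < d -> exists m : C, m != l /\ normc (m - l) < d.
Proof.
move=> d0; exists (l + real_complex R (d / 2)); split.
  by rewrite -subr_eq0 addrC addKr fmorph_eq0 gt_eqF // divr_gt0.
by rewrite addrC addKr normc_real ?divr_ge0 ?ltW //; lra.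
Qed.

Lemma riesz_discrete N T K : closed_subspace N -> lin T -> 0 < K -> bnd T K ->
  invar T N -> riesz_on N T -> forall l : C, l != 0 ->
  finite_ascent_on N (shift T l) /\ exists2 d : R, 0 < d & forall m : C, m != l ->
     normc (m - l) < d -> forall x, N x -> shift T m x = 0 -> x = 0.
Proof.
move=> cN lT K0 bT iT rT.
pose P (l : C) := exists2 d : R, 0 < d & forall m : C, m != l ->
     normc (m - l) < d -> forall x, N x -> shift T m x = 0 -> x = 0.
have dich (l : C) : l != 0 -> (exists2 d : R, 0 < d & forall m : C, normc (m - l) < d ->
     exists x, [/\ N x, x <> 0 & shift T m x = 0]) \/
     (finite_ascent_on N (shift T l) /\ P l).
  move=> l0; have [fk cr _] := rT l l0.
  have K' : 0 < K + normc l by rewrite ltr_pwDl // normc_ge0.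
  have [[d d0 hd]|[fa [d d0 hd]]] := usf_dichotomy cN (lin_shift l lT) K'
     (bnd_shift l bT) (invar_shift l cN.1 iT) fk cr; [left|right].
    by exists d => // m /hd[x]; rewrite shiftD addrC subrK; exists x.
  split=> //; exists d => // m ml md x Nx hx; apply: (hd (m - l)) => //.
    by rewrite subr_eq0.
  by rewrite shiftD addrC subrK.
have Plarge (l : C) : K < normc l -> P l.
  move=> hl; exists (normc l - K); first by rewrite subr_gt0.
  move=> m _ hm x Nx /shiftE hx; apply: contrapT => /rnm_gt0 x0.
  have := bT x; rewrite hx rnmZ ler_pM2r //.
  have := normcD m (l - m); rewrite addrC subrK (normcBC l m); lra.
have Popen (l : C) : P l -> exists2 e : R, 0 < e & forall l', normc (l' - l) < e -> P l'.
  move=> [d d0 hd]; exists d => // l' hl'.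
  have [->|ll] := eqVneq l' l; first by exists d.
  have n0 : 0 < normc (l' - l) by apply: normc_gt0; rewrite subr_eq0.
  exists (Num.min (normc (l' - l)) (d - normc (l' - l))).
    by rewrite lt_min n0 subr_gt0.
  move=> m ml; rewrite lt_min => /andP[h1 h2]; apply: hd.
    by apply/eqP => e; move: h1; rewrite e normcBC ltxx.
  have := normcD (m - l') (l' - l); rewrite addrA subrK; lra.
(* The first alternative of the dichotomy puts a full disc of eigenvalues about [l]. A point of [P]
   in that disc has neighbours that are not eigenvalues. *)
have Pclosed (l : C) : l != 0 -> (forall e : R, 0 < e -> exists2 l', P l' & normc (l' - l) < e) ->
    P l.
  move=> l0 h; have [[d d0 hd]|[]//] := dich l l0.
  have [l' [d' d'0 hd'] hl'] := h d d0.
  have [m [ml hm]] := @cplx_near l' (Num.min d' (d - normc (l' - l)))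
    (ltac:(by rewrite lt_min d'0 subr_gt0)).
  move: hm; rewrite lt_min => /andP[h1 h2].
  have [|x [Nx xn hx]] := hd m.
    have := normcD (m - l') (l' - l); rewrite addrA subrK; lra.
  by case: xn; apply: hd' hx.
have Pall (l : C) : l != 0 -> P l.
  move=> l0; have nl := normc_gt0 l0; apply: contrapT => nP.
  (* The bad parameters on the ray from [l] outwards, which stays away from 0. Points beyond [sup E]
     satisfy [P], hence so does the supremum by [Pclosed]; then [Popen] leaves no bad points just
     below it. *)
  pose E := [set t : R | 1 <= t /\ ~ P (real_complex R t * l)].
  have n1 (t u : R) : 0 <= t - u ->
      normc (real_complex R t * l - real_complex R u * l) = (t - u) * normc l.
    by move=> tu; rewrite -mulrBl -rmorphB normcM normc_real.
  have E1 : E 1 by split=> //; rewrite rmorph1 mul1r.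
  have ubE t : E t -> t <= K / normc l.
    move=> [t1 nPt]; rewrite leNgt; apply/negP; rewrite ltr_pdivrMr // => h; apply: nPt.
    by apply: Plarge; rewrite normcM normc_real //; lra.
  have hE : has_sup E by split; [exists 1|exists (K / normc l) => t /ubE].
  have s1 : 1 <= sup E by apply: ub_le_sup E1; case: hE.
  have Ps : P (real_complex R (sup E) * l).
    apply: Pclosed; first by rewrite mulf_neq0 // fmorph_eq0 gt_eqF //; lra.
    move=> e e0; pose t := sup E + e / (2 * normc l).
    have t0 : 0 < e / (2 * normc l) by rewrite divr_gt0 // mulr_gt0.
    exists (real_complex R t * l).
      apply: contrapT => nPt; have : t <= sup E.
        by apply: ub_le_sup; [case: hE|split=> //; rewrite /t; lra].
      by rewrite /t; lra.
    rewrite n1 /t; last by lra.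
    have -> : (sup E + e / (2 * normc l) - sup E) * normc l = e / 2.
      by field; rewrite gt_eqF.
    by lra.
  have [e e0 he] := Popen _ Ps.
  have [t Et ht] := sup_adherent (divr_gt0 e0 nl) hE.
  have [_ []] := Et; apply: he; rewrite normcBC n1; last first.
    by rewrite subr_ge0; apply: ub_le_sup Et; case: hE.
  by rewrite -ltr_pdivlMr //; lra.
(* A full disc of eigenvalues would contradict [P l], so the dichotomy yields finite ascent. *)
move=> l l0; split; last exact: Pall.
have [[d d0 hd]|[]//] := dich l l0; have [d' d'0 hd'] := Pall l l0.
have [m [ml]] := @cplx_near l (Num.min d d') (ltac:(by rewrite lt_min d0)).
rewrite lt_min => /andP[/hd[x [Nx xn hx]] h2].
by case: xn; apply: hd' hx.
Qed.

End Semifredholm.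

(** * Analytic eigenfunctions *)

Section Eigenfunction.
Variables (R : realType) (X : completeNormedModType (Cplx R)).
Local Notation C := (Cplx R).
Implicit Types (x y z e : X) (M N A B Y : set X) (S T : X -> X).

Lemma derivable_rnm (f : C -> X) (z : C) : derivable f z 1 <->
  exists l : X, forall e : R, 0 < e -> exists2 d : R, 0 < d &
    forall w : C, normc (w - z) < d -> rnm (f w - f z - (w - z) *: l) <= e * normc (w - z).
Proof.
split=> [/cvg_ex[l hl]|[l hl]].
  exists l => e e0.
  have /nbhs_rnm : nbhs l [set y | rnm (l - y) < e] by apply/nbhs_rnm; exists e.
  move=> /nbhs_rnm/hl hq.
  have /nbhs_normc[d d0 hd] : nbhs (0 : C) [set h | h != 0 ->
    rnm (l - h^-1 *: ((f \o pseudometric_normed_Zmodule.shift z) (h *: 1) - f z)) < e] := hq.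
  exists d => // w hw; have [->|wz] := eqVneq w z.
    by rewrite !subrr scale0r subrr rnm0 normc0 mulr0.
  have wz0 : w - z != 0 by rewrite subr_eq0.
  have := hd (w - z); rewrite subr0 => /(_ hw wz0).
  rewrite /= /pseudometric_normed_Zmodule.shift -[(w - z) *: 1]/((w - z) * 1) mulr1 subrK => h.
  have -> : f w - f z - (w - z) *: l = - ((w - z) *: (l - (w - z)^-1 *: (f w - f z))).
    by rewrite scalerBr scalerA mulfV // scale1r opprB.
  by rewrite rnmN rnmZ mulrC ler_wpM2r ?normc_ge0 // ltW.
apply/cvg_ex; exists l => P /nbhs_rnm[e e0 he].
have [d d0 hd] := hl (e / 2) (ltac:(lra)).
suff : nbhs (0 : C) [set h | h != 0 ->
  P (h^-1 *: ((f \o pseudometric_normed_Zmodule.shift z) (h *: 1) - f z))] by [].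
apply/nbhs_normc; exists d => // h.
rewrite subr0 => hh h0; apply: he.
have nh := normc_gt0 h0.
have := hd (z + h); rewrite addrAC subrr add0r => /(_ hh) hq.
rewrite /= -[h *: 1]/(h * 1) mulr1 [h + z]addrC.
have -> : l - h^-1 *: (f (z + h) - f z) = - (h^-1 *: (f (z + h) - f z - h *: l)).
  by rewrite [in RHS]scalerBr scalerA mulVf // scale1r opprB.
rewrite rnmN rnmZ normcV mulrC ltr_pdivrMr //; apply: le_lt_trans hq _.
by rewrite ltr_pM2r //; lra.
Qed.

Lemma tendsB (u v : nat -> X) x y : tends u x -> tends v y ->
  tends (fun n => u n - v n) (x - y).
Proof.
move=> hu hv e e0; have e2 : 0 < e / 2 by lra.
have [N1 h1] := hu _ e2; have [N2 h2] := hv _ e2.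
exists (maxn N1 N2) => n; rewrite geq_max => /andP[/h1 n1 /h2 n2].
have -> : u n - v n - (x - y) = (u n - x) - (v n - y).
  by rewrite !opprB addrACA [RHS]addrACA; congr (_ + _); exact: addrC.
by apply: le_lt_trans (rnmB _ _) _; lra.
Qed.

Lemma tendsZ (u : nat -> X) x (a : C) : tends u x -> tends (fun n => a *: u n) (a *: x).
Proof.
move=> hu e e0; have a0 : 0 < normc a + 1 by rewrite ltr_wpDl ?normc_ge0.
have [N hN] := hu _ (divr_gt0 e0 a0); exists N => n /hN.
rewrite ltr_pdivlMr // -scalerBr rnmZ => h; apply: le_lt_trans h.
by rewrite mulrC ler_wpM2l ?rnm_ge0 // lerDl.
Qed.

Lemma tendsS (u : nat -> X) x : tends u x -> tends (fun n => u n.+1) x.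
Proof. by move=> hu e /hu[N hN]; exists N => n hn; apply: hN; rewrite ltnW. Qed.

Lemma leq_2expn n : (n <= 2 ^ n)%N.
Proof. by rewrite ltnW // ltn_expl. Qed.

(** The remainder satisfies [E_(n+1) = w E_n + n z^(n-1) (w - z)^2]. Each summand is at most half of
    the next bound; the base [4 r] leaves room for the factor [n] through [n <= 2^n]. At [n = 0] the
    coefficient 0 hides the truncated exponent. *)
Lemma power_taylor (z w : C) (r : R) n : 0 < r -> normc z <= r -> normc w <= 2 * r ->
  normc (w ^+ n - z ^+ n - (n%:R * z ^+ n.-1) * (w - z)) <=
    r ^- 2 * (4 * r) ^+ n * normc (w - z) ^+ 2.
Proof.
move=> r0 hz hw; elim: n => [|n IH].
  rewrite !expr0 subrr mul0r mul0r subrr normc0 mulr1 mulr_ge0 ?sqr_ge0 //.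
  by rewrite invr_ge0 sqr_ge0.
set E := _ - _ - _ in IH; rewrite [n.+1.-1]/=.
have -> : w ^+ n.+1 - z ^+ n.+1 - n.+1%:R * z ^+ n * (w - z) =
    w * E + (n%:R * z ^+ n.-1) * (w - z) ^+ 2.
  have zn : n%:R * z ^+ n = n%:R * z ^+ n.-1 * z.
    by case: n {IH E} => [|n]; rewrite ?mul0r // exprSr mulrA.
  rewrite /E -natr1 mulrDl zn !exprS; ring.
apply: le_trans (normcD _ _) _; rewrite !normcM !normcX.
have nn : normc (n%:R : C) = n%:R.
  by rewrite -[n%:R]/(n%:R) -(rmorph_nat (real_complex R)) normc_real.
rewrite nn -(expr2 (normc (w - z))); set h2 := normc (w - z) ^+ 2.
have h20 : 0 <= h2 by rewrite sqr_ge0.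
have a1 : normc w * normc E <= 2 * r * (r ^- 2 * (4 * r) ^+ n * h2).
  by apply: ler_pM => //; rewrite normc_ge0.
have a2 : n%:R * normc z ^+ n.-1 <= 2 * r * (r ^- 2 * (4 * r) ^+ n).
  case: n {IH E nn a1} => [|n].
    rewrite mul0r; apply: mulr_ge0; first by lra.
    by rewrite mulr_ge0 // ?invr_ge0 ?sqr_ge0 // exprn_ge0 //; lra.
  have -> : 2 * r * (r ^- 2 * (4 * r) ^+ n.+1) = 8 * 4 ^+ n * r ^+ n.
    by rewrite exprMn !exprSr expr0 mul1r; field; rewrite gt_eqF.
  have h1 : normc z ^+ n <= r ^+ n by rewrite lerXn2r // nnegrE ?normc_ge0 // ltW.
  apply: ler_pM => //; first by rewrite exprn_ge0 // normc_ge0.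
  have : (n.+1 <= 2 * 2 ^ n)%N by rewrite -expnS leq_2expn.
  rewrite -(ler_nat R) natrM natrX => h; apply: le_trans h _.
  have : (2 : R) ^+ n <= 4 ^+ n by rewrite lerXn2r // ?nnegrE; lra.
  have : 0 <= (4 : R) ^+ n by rewrite exprn_ge0 //; lra.
  lra.
have := ler_wpM2r h20 a2.
rewrite [(4 * r) ^+ n.+1]exprS; move: a1; set Q := (4 * r) ^+ n; set I := r ^- 2; lra.
Qed.

(* [f z = \sum z^n x_n], where [S x_(n+1) = x_n] and [S x_0 = 0]. *)
Lemma kato_eigenfunction M S K : closed_subspace M -> lin S -> 0 < K -> bnd S K ->
  invar S M -> kato_on M S -> forall x0, kerM M S x0 ->
  exists2 r : R, 0 < r & exists f : C -> X,
    [/\ f 0 = x0, forall z : C, normc z < r -> derivable f z 1 &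
        forall z : C, normc z < r -> shift S z (f z) = 0].
Proof.
move=> cM lS K0 bS iS [cr hk] x0 kx0.
have [Y [cY YM kY [D D0 hD]]] := kato_core cM lS K0 bS iS cr hk.
have [g hg] : {g : X -> X & forall y, Y y -> [/\ Y (g y), S (g y) = y & rnm (g y) <= D * rnm y]}.
  apply: (@choice _ _ (fun y y' => Y y -> [/\ Y y', S y' = y & rnm y' <= D * rnm y])) => y.
  by have [Yy|nYy] := pselect (Y y); [have [x ?] := hD y Yy; exists x | exists 0].
pose x n := iter n g x0.
have Yx n : Y (x n) by elim: n => [|n IH]; [exact: kY|have [] := hg _ IH].
have Sx n : S (x n.+1) = x n by have [] := hg _ (Yx n).
have Sx0 : S (x 0%N) = 0 by case: kx0.
set B := rnm x0; have B0 : 0 <= B by exact: rnm_ge0.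
have bx n : rnm (x n) <= D ^+ n * B.
  elim: n => [|n IH]; first by rewrite expr0 mul1r.
  have [_ _ /le_trans] := hg _ (Yx n); apply.
  by rewrite exprS -mulrA ler_wpM2l // ltW.
(* The series converges for [|z| < 1 / D]. The factor 8 gives [4 r D = 1 / 2], the ratio of the
   series of Taylor remainders. *)
pose r := 1 / (8 * D).
have r0 : 0 < r by rewrite divr_gt0 // mulr_gt0.
have rD : r * D = 1 / 8 by rewrite /r; field; rewrite gt_eqF.
have half n : 0 <= (2^-1 : R) ^+ n by rewrite exprn_ge0.
have sum_ex (z : C) : exists s, normc z <= 2 * r -> tends (fun n => \sum_(i < n) z ^+ i *: x i) s.
  have [hz|nz] := pselect (normc z <= 2 * r); last by exists 0.
  have [|s [ts _]] := @geo_half_ex _ _ (fun i => z ^+ i *: x i) B B0; last by exists s.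
  move=> n; rewrite rnmZ normcX; apply: le_trans (ler_wpM2l _ (bx n)) _.
    by rewrite exprn_ge0 // normc_ge0.
  rewrite mulrA -exprMn mulrC ler_wpM2l // lerXn2r ?nnegrE ?mulr_ge0 ?normc_ge0 //.
    exact: ltW.
  have := ler_wpM2r (ltW D0) hz; rewrite -mulrA rD; lra.
have [f hf] := choice sum_ex; exists r => //; exists f; split.
- have h0 : normc (0 : C) <= 2 * r by rewrite normc0; lra.
  apply: tends_unique (tendsS (hf 0 h0)) _ => e e0; exists 0%N => n _.
  rewrite big_ord_recl expr0 scale1r big1 ?addr0 ?subrr ?rnm0 // => i _.
  by rewrite exprS mul0r scale0r.
- move=> z hz; apply/derivable_rnm.
  have [|l [tl _]] := @geo_half_ex _ _ (fun i => (i%:R * z ^+ i.-1) *: x i)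
    (4 * D * B) (ltac:(by rewrite !mulr_ge0 // ltW)).
    move=> [|n]; first by rewrite mul0r scale0r rnm0 expr0 mulr1 !mulr_ge0 // ltW.
    rewrite rnmZ normcM normcX.
    have -> : normc (n.+1%:R : C) = n.+1%:R.
      by rewrite -(rmorph_nat (real_complex R)) normc_real.
    have h1 : n.+1%:R <= 2 * 2 ^+ n :> R.
      by rewrite -exprS -natrX ler_nat leq_2expn.
    have h2 : normc z ^+ n <= r ^+ n by rewrite lerXn2r ?nnegrE ?normc_ge0 ?ltW.
    apply: le_trans (_ : (2 * 2 ^+ n * r ^+ n) * (D ^+ n.+1 * B) <= _).
      apply: ler_pM => //; rewrite ?rnm_ge0 ?mulr_ge0 ?exprn_ge0 ?normc_ge0 //.
      by apply: ler_pM => //; rewrite ?exprn_ge0 ?normc_ge0.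
    have -> : 2 * 2 ^+ n * r ^+ n * (D ^+ n.+1 * B) = 4 * D * B * (2^-1 * (2 * (r * D)) ^+ n).
      by rewrite !exprMn exprS; field.
    rewrite ler_wpM2l ?mulr_ge0 //; first exact: ltW.
    by rewrite rD exprS ler_wpM2l // lerXn2r ?nnegrE; lra.
  have hz' : normc z <= 2 * r by lra.
  set c := 2 * (r ^- 2 * B).
  have c0 : 0 <= c by rewrite !mulr_ge0 // invr_ge0 sqr_ge0.
  have key (w : C) : normc (w - z) < r ->
      rnm (f w - f z - (w - z) *: l) <= c * normc (w - z) ^+ 2.
    move=> hwz; have hw : normc w <= 2 * r.
      by have := normcD (w - z) z; rewrite subrK; lra.
    have c1 : 0 <= r ^- 2 * B * normc (w - z) ^+ 2.
      apply: mulr_ge0; last exact: sqr_ge0.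
      by apply: mulr_ge0 => //; rewrite invr_ge0 sqr_ge0.
    rewrite /c -mulrA; apply: (@geo_half _ _
      (fun i => (w ^+ i - z ^+ i - (i%:R * z ^+ i.-1) * (w - z)) *: x i)).
    + exact: c1.
    + move=> n; rewrite rnmZ.
      have h1 := power_taylor n r0 (ltW hz) hw.
      apply: le_trans (_ : r ^- 2 * (4 * r) ^+ n * normc (w - z) ^+ 2 * (D ^+ n * B) <= _).
        by apply: ler_pM => //; rewrite ?rnm_ge0 ?normc_ge0.
      have -> : r ^- 2 * (4 * r) ^+ n * normc (w - z) ^+ 2 * (D ^+ n * B) =
         r ^- 2 * B * normc (w - z) ^+ 2 * (4 * (r * D)) ^+ n.
        by rewrite !exprMn; ring.
      by rewrite ler_wpM2l // rD lerXn2r ?nnegrE; lra.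
    have := tendsB (tendsB (hf w hw) (hf z hz')) (tendsZ (w - z) tl).
    congr tends; apply/funext => n; rewrite -!sumrB scaler_sumr -sumrB.
    by apply: eq_bigr => i _; rewrite scalerA [(w - z) * _]mulrC !scalerBl.
  exists l => e e0; exists (Num.min r (e / (c + 1))).
    by rewrite lt_min r0 divr_gt0 //; lra.
  move=> w; rewrite lt_min => /andP[/key h1]; rewrite ltr_pdivlMr; last by lra.
  move=> h2; apply: le_trans h1 _; rewrite expr2 mulrA ler_wpM2r ?normc_ge0 //.
  by have := normc_ge0 (w - z); nra.
- move=> z hz; have hz' : normc z <= 2 * r by lra.
  have ts := hf z hz'; have t1 := tendsZ z ts.
  (* [S] kills [x_0] and lowers the other indices by one, so [S] of [n + 1] terms is [z] times [n]
     terms. *)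
  have t2 := tendsS (bnd_tends lS K0 bS ts).
  rewrite /shift; apply/eqP; rewrite subr_eq0; apply/eqP.
  apply: tends_unique t2 _; congr (tends _ _) : t1; apply/funext => n.
  rewrite (lin_sum _ (fun i => z ^+ i *: x i) lS) big_ord_recl.
  rewrite (linZ _ _ lS) Sx0 scaler0 add0r scaler_sumr; apply: eq_bigr => i _.
  by rewrite (linZ _ _ lS) Sx scalerA -exprS.
Qed.

End Eigenfunction.

(** * Cauchy's theorem on squares *)

Section Cousin.
Variable R : realType.

Lemma nested_intervals (lo a : nat -> R) : (forall n, 0 <= a n) ->
  (forall n, lo n <= lo n.+1) -> (forall n, lo n.+1 + a n.+1 <= lo n + a n) ->
  exists s, forall n, lo n <= s <= lo n + a n.
Proof.
move=> a0 h1 h2.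
have m1 m k : lo m <= lo (m + k)%N.
  by elim: k => [|k IH]; rewrite ?addn0 // addnS; apply: le_trans IH _.
have m2 m k : lo (m + k)%N + a (m + k)%N <= lo m + a m.
  by elim: k => [|k IH]; rewrite ?addn0 // addnS; apply: le_trans IH.
have key m n : lo m <= lo n + a n.
  apply: le_trans (m1 m n) _; have := m2 n m; rewrite addnC.
  by have := a0 (m + n)%N; lra.
have hs : has_sup (range lo).
  by split; [exists (lo 0%N), 0%N|exists (lo 0%N + a 0%N) => _ [n _ <-]].
exists (sup (range lo)) => n; apply/andP; split.
  by apply: ub_le_sup; [case: hs|exists n].
by apply: ge_sup; [case: hs|move=> _ [m _ <-]].
Qed.

(** Cousin's lemma, used in place of compactness: if [P] failed, some ninth would fail again, and
    the failing squares would shrink to a point [(s, t)] where [P] holds locally. Thirds are used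
    because [cint_center] needs a central piece. *)
Lemma cousin_square (P : R -> R -> R -> Prop) x0 y0 a0 : 0 < a0 ->
  (forall x y a, 0 < a ->
     (forall j k : nat, (j < 3)%N -> (k < 3)%N ->
        P (x + j%:R * (a / 3)) (y + k%:R * (a / 3)) (a / 3)) -> P x y a) ->
  (forall s t, x0 <= s <= x0 + a0 -> y0 <= t <= y0 + a0 -> exists2 d : R, 0 < d &
     forall x y a, 0 < a -> a < d -> x <= s <= x + a -> y <= t <= y + a ->
       x0 <= x -> x + a <= x0 + a0 -> y0 <= y -> y + a <= y0 + a0 -> P x y a) ->
  P x0 y0 a0.
Proof.
move=> a00 hsub hloc; apply: contrapT => nP.
have step : forall s : R * R * R, exists s' : R * R * R,
    0 < s.2 -> ~ P s.1.1 s.1.2 s.2 -> ~ P s'.1.1 s'.1.2 s'.2 /\ s'.2 = s.2 / 3 /\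
      [/\ s.1.1 <= s'.1.1, s'.1.1 + s'.2 <= s.1.1 + s.2,
      s.1.2 <= s'.1.2 & s'.1.2 + s'.2 <= s.1.2 + s.2].
  move=> [[x y] a] /=.
  have [[ap nPs]|nn] := pselect (0 < a /\ ~ P x y a); last first.
    by exists (0, 0, 0) => ap nPs; case: nn.
  have : ~ forall j k : nat, (j < 3)%N -> (k < 3)%N ->
        P (x + j%:R * (a / 3)) (y + k%:R * (a / 3)) (a / 3).
    by move=> h; apply: nPs; apply: hsub.
  move=> /existsNP[j /existsNP[k /not_implyP[j3 /not_implyP[k3 nP']]]].
  exists (x + j%:R * (a / 3), y + k%:R * (a / 3), a / 3) => _ _ /=.
  have b (i : nat) : (i < 3)%N -> 0 <= i%:R * (a / 3) /\ i%:R * (a / 3) <= 2 * (a / 3).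
    move=> i3; split; first by rewrite mulr_ge0 // divr_ge0 // ltW.
    by rewrite ler_pM2r ?divr_gt0 // (ler_nat R i 2).
  have [] := b _ j3; have [] := b _ k3.
  set u := j%:R * _; set v := k%:R * _; move=> ? ? ? ?.
  by split=> //; split=> //; split; lra.
have [f hf] := choice step.
pose s n := iter n f (x0, y0, a0).
have inv n : 0 < (s n).2 /\ ~ P (s n).1.1 (s n).1.2 (s n).2.
  elim: n => [//|n [h1 h2]]; have [h3 [h4 _]] := hf (s n) h1 h2.
  by split=> //; rewrite /= h4 divr_gt0.
have hs n := (hf (s n) (inv n).1 (inv n).2).2.
have ha n : (s n).2 = a0 * 3^-1 ^+ n.
  elim: n => [|n IH]; first by rewrite expr0 mulr1.
  by have [-> _] := hs n; rewrite IH exprSr mulrA.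
have [|||s1 h1] := @nested_intervals (fun n => (s n).1.1) (fun n => (s n).2).
- by move=> n; case: (inv n) => /ltW.
- by move=> n; have [_ []] := hs n.
- by move=> n; have [_ []] := hs n.
have [|||s2 h2] := @nested_intervals (fun n => (s n).1.2) (fun n => (s n).2).
- by move=> n; case: (inv n) => /ltW.
- by move=> n; have [_ []] := hs n.
- by move=> n; have [_ []] := hs n.
have [d d0 hd] := hloc s1 s2 (h1 0%N) (h2 0%N).
have [N hN] := @expr_small R 3^-1 (d / a0) (ltac:(lra)) (ltac:(lra)) (divr_gt0 d0 a00).
have [aN nPN] := inv N.
have bd n : [/\ x0 <= (s n).1.1, (s n).1.1 + (s n).2 <= x0 + a0,
    y0 <= (s n).1.2 & (s n).1.2 + (s n).2 <= y0 + a0].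
  elim: n => [//|n [i1 i2 i3 i4]]; have [_ [j1 j2 j3 j4]] := hs n.
  by split; [exact: le_trans j1|exact: le_trans j2 i2|exact: le_trans j3|exact: le_trans j4 i4].
have [b1 b2 b3 b4] := bd N.
apply: nPN; apply: hd => //.
by rewrite ha mulrC -ltr_pdivlMr //; apply: hN.
Qed.

Lemma cousin_interval (P : R -> R -> Prop) x0 a0 : 0 < a0 ->
  (forall x a, 0 < a -> (forall j : nat, (j < 3)%N -> P (x + j%:R * (a / 3)) (a / 3)) -> P x a) ->
  (forall s, x0 <= s <= x0 + a0 -> exists2 d : R, 0 < d &
     forall x a, 0 < a -> a < d -> x <= s <= x + a ->
       x0 <= x -> x + a <= x0 + a0 -> P x a) ->
  P x0 a0.
Proof.
move=> a00 hsub hloc; apply: (@cousin_square (fun x _ a => P x a) x0 0 a0) => //.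
  by move=> x _ a ap h; apply: hsub => // j j3; exact: (h j 0%N).
move=> s t /hloc[d d0 hd] _; exists d => // x y a ap ad xs _ b1 b2 _ _; exact: hd.
Qed.

End Cousin.

Ltac cplx_eq := apply/eqP; rewrite eq_complex /=; apply/andP; split; apply/eqP.

(** * Integral means along segments *)

Section Segments.
Variables (R : realType) (X : completeNormedModType (Cplx R)).
Local Notation C := (Cplx R).
Local Notation "t %:C" := (real_complex R t : C).
Implicit Types (p v z w : C) (g f : C -> X) (x : X).

Definition cont_at g z := forall e : R, 0 < e -> exists2 d : R, 0 < d &
  forall w, normc (w - z) < d -> rnm (g w - g z) < e.

Definition diff_at g z := exists l : X, forall e : R, 0 < e -> exists2 d : R, 0 < d &
  forall w, normc (w - z) < d -> rnm (g w - g z - (w - z) *: l) <= e * normc (w - z).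

Lemma diff_cont g z : diff_at g z -> cont_at g z.
Proof.
move=> [l hl] e e0; have [d d0 hd] := hl 1 ltr01.
have l0 : 0 < 1 + rnm l by rewrite ltr_pwDl // rnm_ge0.
exists (Num.min d (e / (1 + rnm l))); first by rewrite lt_min d0 divr_gt0.
move=> w; rewrite lt_min => /andP[/hd h1]; rewrite ltr_pdivlMr // => h2.
rewrite -(subrK ((w - z) *: l) (g w - g z)).
apply: le_lt_trans (rnmD _ _) _; rewrite rnmZ; lra.
Qed.

(* Left-endpoint Riemann mean of [g] on the segment [p, p+v], with [3^n] equal pieces. *)
Fixpoint seg_mean n g p v : X :=
  if n is m.+1 then (3^-1)%:C *: \sum_(0 <= j < 3)
     seg_mean m g (p + (j%:R / 3)%:C * v) ((3^-1)%:C * v)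
  else g p.

Definition on_seg p v (P : C -> Prop) := forall t : R, 0 <= t <= 1 -> P (p + t%:C * v).

Lemma on_seg_sub p v P j : on_seg p v P -> (j < 3)%N ->
  on_seg (p + (j%:R / 3)%:C * v) ((3^-1)%:C * v) P.
Proof.
move=> h j3 t /andP[t0 t1].
have -> : p + (j%:R / 3)%:C * v + t%:C * ((3^-1)%:C * v) = p + ((j%:R + t) / 3)%:C * v.
  by rewrite mulrA -rmorphM -addrA -mulrDl -rmorphD mulrDl.
apply: h; have j2 : j%:R <= 2 :> R by rewrite (ler_nat R j 2).
have j0 : 0 <= j%:R :> R by [].
by apply/andP; split; lra.
Qed.

Lemma sum3 (u : nat -> X) : \sum_(0 <= j < 3) u j = u 0%N + u 1%N + u 2%N.
Proof. by rewrite !big_nat_recl // big_geq // addr0 addrA. Qed.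

Lemma mean_close (u : nat -> X) c (e : R) : (forall j, (j < 3)%N -> rnm (u j - c) <= e) ->
  rnm ((3^-1)%:C *: \sum_(0 <= j < 3) u j - c) <= e.
Proof.
move=> h; have n3 : (3^-1)%:C * 3%:R = 1 :> C.
  by rewrite -(rmorph_nat (real_complex R)) -rmorphM mulVf // pnatr_eq0.
have -> : (3^-1)%:C *: \sum_(0 <= j < 3) u j - c =
    (3^-1)%:C *: \sum_(0 <= j < 3) (u j - c).
  rewrite sumrB scalerBr big_const_nat /= addr0.
  have -> : c + (c + c) = 3%:R *: c by rewrite (scaler_nat 3 c) mulrS mulr2n.
  by rewrite scalerA n3 scale1r.
rewrite rnmZ normc_real ?invr_ge0 // mulrC ler_pdivrMr // sum3.
have := h 0%N isT; have := h 1%N isT; have := h 2%N isT.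
have := rnmD (u 0%N - c + (u 1%N - c)) (u 2%N - c); have := rnmD (u 0%N - c) (u 1%N - c); lra.
Qed.

Lemma seg_mean_close n g p v c (e : R) : on_seg p v (fun z => rnm (g z - c) <= e) ->
  rnm (seg_mean n g p v - c) <= e.
Proof.
elim: n p v => [|n IH] p v h.
  by have := h 0 (ltac:(by rewrite lexx ler01)); rewrite rmorph0 mul0r addr0.
by apply: mean_close => j j3; apply: IH; apply: on_seg_sub.
Qed.

(** Cousin's lemma replaces uniform continuity: on a short piece about [s] all means are within
    [e / 2] of [g] at [s], and averaging three pieces keeps the bound at the cost of one level. *)
Lemma seg_mean_cauchy g p v : on_seg p v (cont_at g) -> forall e : R, 0 < e ->
  exists N, forall m n, (N <= m)%N -> (N <= n)%N ->
    rnm (seg_mean m g p v - seg_mean n g p v) <= e.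
Proof.
move=> cg e e0.
pose P (x a : R) := exists N, forall m n, (N <= m)%N -> (N <= n)%N ->
    rnm (seg_mean m g (p + x%:C * v) (a%:C * v) - seg_mean n g (p + x%:C * v) (a%:C * v)) <= e.
suff : P 0 1 by rewrite /P rmorph0 rmorph1 mul0r addr0 mul1r.
apply: cousin_interval => //.
  move=> x a a0 h.
  have [N hN] : exists N : nat, forall j, (j < 3)%N -> forall m n, (N <= m)%N -> (N <= n)%N ->
      let q := p + (x + j%:R * (a / 3))%:C * v in
      rnm (seg_mean m g q ((a / 3)%:C * v) - seg_mean n g q ((a / 3)%:C * v)) <= e.
    have [N0 h0] := h 0%N isT; have [N1 h1] := h 1%N isT; have [N2 h2] := h 2%N isT.
    exists (maxn N0 (maxn N1 N2)) => -[|[|[|//]]] _ m n;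
      rewrite !geq_max => /and3P[? ? ?] /and3P[? ? ?]; [exact: h0|exact: h1|exact: h2].
  exists N.+1 => -[//|m] [//|n]; rewrite !ltnS => hm hn /=.
  rewrite -scalerBr -sumrB; set S := \sum_(0 <= j < 3) _.
  have := @mean_close (fun j => seg_mean m g (p + x%:C * v + (j%:R / 3)%:C * (a%:C * v)) ((3^-1)%:C * (a%:C * v)) -
     seg_mean n g (p + x%:C * v + (j%:R / 3)%:C * (a%:C * v)) ((3^-1)%:C * (a%:C * v))) 0 e.
  rewrite subr0; apply => j j3; rewrite subr0; have := hN j j3 m n hm hn.
  have -> : p + (x + j%:R * (a / 3))%:C * v = p + x%:C * v + (j%:R / 3)%:C * (a%:C * v).
    by case: (v) => v1 v2; case: (p) => p1 p2; cplx_eq; field.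
  by have -> : (a / 3)%:C * v = (3^-1)%:C * (a%:C * v) by case: (v) => v1 v2; cplx_eq; field.
move=> s; rewrite add0r => hs; have e2 : 0 < e / 2 by lra.
have [d d0 hd] := cg s hs _ e2.
have v0 : 0 < normc v + 1 by rewrite ltr_wpDl ?normc_ge0.
exists (d / (normc v + 1)); first by rewrite divr_gt0.
move=> x a a0; rewrite ltr_pdivlMr // => ad /andP[xs sx] _ _; exists 0%N => m n _ _.
have cl k : rnm (seg_mean k g (p + x%:C * v) (a%:C * v) - g (p + s%:C * v)) <= e / 2.
  apply: seg_mean_close => t /andP[t0 t1]; apply/ltW/hd.
  have -> : p + x%:C * v + t%:C * (a%:C * v) - (p + s%:C * v) = (x + t * a - s)%:C * v.
    rewrite rmorphB rmorphD rmorphM; ring.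
  have nr (u : R) : normc u%:C = `|u| by rewrite /= expr0n addr0 sqrtr_sqr.
  rewrite normcM nr; apply: le_lt_trans ad.
  have ta : 0 <= t * a <= a by apply/andP; split; [rewrite mulr_ge0 // ltW|rewrite ger_pMl].
  have hb : `|x + t * a - s| <= a by rewrite ler_norml; move/andP: ta => [? ?]; apply/andP; split; lra.
  apply: le_trans (ler_wpM2r (normc_ge0 v) hb) _.
  by apply: ler_wpM2l; [exact: ltW|rewrite lerDl].
have := rnmB_trans (seg_mean m g (p + x%:C * v) (a%:C * v)) (g (p + s%:C * v))
   (seg_mean n g (p + x%:C * v) (a%:C * v)).
have := cl m; have := cl n; rewrite (rnmBC (g _)); lra.
Qed.

(** For continuous [g] this is the integral of [g (p + t v)] over [t] in [0, 1]; times [v] it is the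
    line integral. *)
Definition seg g p v : X := xget 0 [set l | tends (fun n => seg_mean n g p v) l].

Lemma seg_lim g p v : on_seg p v (cont_at g) -> tends (fun n => seg_mean n g p v) (seg g p v).
Proof.
move=> cg; apply: xgetPex; apply: cauchy_tends => e e0.
have [N hN] := seg_mean_cauchy cg (divr_gt0 e0 (ltr0n R 2)).
by exists N => m n hm hn; apply: le_lt_trans (hN _ _ hm hn) _; lra.
Qed.

Lemma seg_eq g p v l : tends (fun n => seg_mean n g p v) l -> seg g p v = l.
Proof. by move=> hl; apply: (tends_unique _ hl); apply: (@xgetPex _ 0 [set l' | tends _ l']); exists l. Qed.

Lemma tends_close (u : nat -> X) l c (e : R) : tends u l -> (forall n, rnm (u n - c) <= e) ->
  rnm (l - c) <= e.
Proof.
move=> ul h; apply/ler_addgt0Pl => d d0; have [N hN] := ul d d0.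
by have := hN N (leqnn _); have := h N; have := rnmB_trans l (u N) c; rewrite (rnmBC l (u N)); lra.
Qed.

Lemma seg_close g p v c (e : R) : on_seg p v (cont_at g) ->
  on_seg p v (fun z => rnm (g z - c) <= e) -> rnm (seg g p v - c) <= e.
Proof. by move=> /seg_lim h hc; apply: tends_close h _ => n; exact: seg_mean_close. Qed.

Lemma tendsD (u v : nat -> X) (x y : X) : tends u x -> tends v y ->
  tends (fun n => u n + v n) (x + y).
Proof.
move=> hu hv; have := tendsB hu (tendsZ (-1) hv).
by rewrite scaleN1r opprK; congr tends; apply/funext => n; rewrite scaleN1r opprK.
Qed.

Lemma seg_split g p v : on_seg p v (cont_at g) ->
  seg g p v = (3^-1)%:C *: \sum_(0 <= j < 3) seg g (p + (j%:R / 3)%:C * v) ((3^-1)%:C * v).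
Proof.
move=> cg; apply: seg_eq => /=.
have hj j : (j < 3)%N -> tends (fun n => seg_mean n g (p + (j%:R / 3)%:C * v) ((3^-1)%:C * v))
    (seg g (p + (j%:R / 3)%:C * v) ((3^-1)%:C * v)).
  by move=> j3; apply: seg_lim; exact: on_seg_sub.
have := tendsZ (3^-1)%:C (tendsD (tendsD (hj 0%N isT) (hj 1%N isT)) (hj 2%N isT)).
move=> h e e0; have [N hN] := h e e0; exists N.+1 => -[//|n] hn.
by rewrite /= !sum3; apply: hN.
Qed.

Lemma segB g1 g2 p v : on_seg p v (cont_at g1) -> on_seg p v (cont_at g2) ->
  seg (fun z => g1 z - g2 z) p v = seg g1 p v - seg g2 p v.
Proof.
move=> /seg_lim h1 /seg_lim h2; apply: seg_eq; have := tendsB h1 h2.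
congr tends; apply/funext => n; elim: n p v {h1 h2} => [//|n IH] p v /=.
by rewrite -scalerBr -sumrB; congr (_ *: _); apply: eq_bigr => j _; exact: IH.
Qed.

Lemma seg_affine c q l p v :
  seg (fun z => c + (z - q) *: l) p v = c + (p + (2^-1)%:C * v - q) *: l.
Proof.
apply: seg_eq.
(* At level [n] the left endpoints average to the parameter [(1 - 3^-n) / 2], which tends to the
   midpoint. *)
have E n : seg_mean n (fun z => c + (z - q) *: l) p v =
    c + (p + ((1 - 3^-1 ^+ n) / 2)%:C * v - q) *: l.
  elim: n p v => [|n IH] p v.
    by rewrite /= expr0 subrr mul0r rmorph0 mul0r addr0.
  rewrite /= sum3 !IH.
  have avg (a1 a2 a3 : C) : (3^-1)%:C *: (c + a1 *: l + (c + a2 *: l) + (c + a3 *: l)) =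
     c + ((3^-1)%:C * (a1 + a2 + a3)) *: l.
    rewrite (addrACA c (a1 *: l)) -scalerDl (addrACA (c + c)) -scalerDl scalerDr scalerA; congr (_ + _).
    have -> : c + c + c = 3%:R *: c by rewrite (scaler_nat 3 c) mulrS mulr2n addrA.
    rewrite scalerA -(rmorph_nat (real_complex R)) -rmorphM mulVf ?pnatr_eq0 //.
    exact: scale1r.
  rewrite avg; congr (_ + _ *: _).
  by rewrite exprS; set T := 3^-1 ^+ n; case: (v) => v1 v2; case: (q) => q1 q2; case: (p) => p1 p2; cplx_eq; field.
have := @tendsD (fun n => c + (p + (2^-1)%:C * v - q) *: l)
  (fun n => (3^-1 ^+ n)%:C *: (- ((2^-1)%:C * v)) *: l) (c + (p + (2^-1)%:C * v - q) *: l) 0.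
rewrite addr0 => h; have : tends (fun n => c + (p + (2^-1)%:C * v - q) *: l +
   ((3^-1 ^+ n)%:C *: (- ((2^-1)%:C * v))) *: l) (c + (p + (2^-1)%:C * v - q) *: l).
  apply: h => e e0; first by exists 0%N => n _; rewrite subrr rnm0.
  set Q := - ((2^-1)%:C * v); have Q0 : 0 < rnm (Q *: l) + 1 by rewrite ltr_wpDl ?rnm_ge0.
  have [N hN] := @expr_small R 3^-1 (e / (rnm (Q *: l) + 1)) (ltac:(lra)) (ltac:(lra)) (divr_gt0 e0 Q0).
  exists N => n /hN; rewrite ltr_pdivlMr // => h'; rewrite subr0.
  rewrite -[(_ *: Q) *: l]scalerA rnmZ normc_real ?exprn_ge0 ?invr_ge0 //.
  by apply: le_lt_trans h'; rewrite ler_wpM2l ?exprn_ge0 ?invr_ge0 // lerDl.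
congr tends; apply/funext => n; rewrite E -addrA -scalerDl; congr (_ + _ *: _).
set T := 3^-1 ^+ n; case: (v) => v1 v2; case: (q) => q1 q2; case: (p) => p1 p2.
by cplx_eq; field.
Qed.

End Segments.

(** * Goursat's theorem for squares *)

Section Goursat.
Variables (R : realType) (X : completeNormedModType (Cplx R)).
Local Notation C := (Cplx R).
Local Notation "t %:C" := (real_complex R t : C).
Implicit Types (p v z w : C) (g f : C -> X) (x y a s t : R).

Lemma subr_interchange (u v w q : X) : u - v - (w - q) = u - w - (v - q).
Proof. by rewrite !opprB addrACA [RHS]addrACA; congr (_ + _); exact: addrC. Qed.

Definition in_sq x y a z := x <= complex.Re z <= x + a /\ y <= complex.Im z <= y + a.

Lemma on_segH x y a (P : C -> Prop) : 0 <= a ->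
  (forall s, x <= s <= x + a -> P (Complex s y)) -> on_seg (Complex x y) (Complex a 0) P.
Proof.
move=> a0 h t /andP[t0 t1].
have -> : (Complex x y : C) + t%:C * Complex a 0 = Complex (x + t * a) y by cplx_eq; ring.
by apply: h; rewrite lerDl mulr_ge0 //= lerD2l; nra.
Qed.

Lemma on_segV x y a (P : C -> Prop) : 0 <= a ->
  (forall s, y <= s <= y + a -> P (Complex x s)) -> on_seg (Complex x y) (Complex 0 a) P.
Proof.
move=> a0 h t /andP[t0 t1].
have -> : (Complex x y : C) + t%:C * Complex 0 a = Complex x (y + t * a) by cplx_eq; ring.
by apply: h; rewrite lerDl mulr_ge0 //= lerD2l; nra.
Qed.

Let I : C := Complex 0 1.

Let normI : normc I = 1. Proof. by rewrite /= expr0n expr1n add0r sqrtr1. Qed.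

Definition hz g x y a := seg g (Complex x y) (Complex a 0).
Definition vt g x y a := seg g (Complex x y) (Complex 0 a).

(** The anticlockwise integral over the boundary of the square: bottom minus top, plus [I] times
    right minus left. The factor [a] turns means into integrals. *)
Definition cint x y a g : X := a%:C *: ((hz g x y a - hz g x (y + a) a) +
  I *: (vt g (x + a) y a - vt g x y a)).

Lemma tele3 (u : nat -> X) : \sum_(0 <= k < 3) (u k - u k.+1) = u 0%N - u 3%N.
Proof.
rewrite -opprB -(@telescope_sumr _ 0 3 u) // -sumrN.
by apply: eq_bigr => i _; rewrite opprB.
Qed.

Section Square.
Variables (g : C -> X) (x y a : R).
Hypotheses (a0 : 0 < a) (cg : forall z, in_sq x y a z -> cont_at g z).

Lemma sq_contH t : y <= t <= y + a -> on_seg (Complex x t) (Complex a 0) (cont_at g).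
Proof. by move=> ht; apply: on_segH => [|s hs]; [exact: ltW|exact: cg]. Qed.

Lemma sq_contV s : x <= s <= x + a -> on_seg (Complex s y) (Complex 0 a) (cont_at g).
Proof. by move=> ht; apply: on_segV => [|t hs]; [exact: ltW|exact: cg]. Qed.

Lemma hz_split t : y <= t <= y + a ->
  hz g x t a = (3^-1)%:C *: \sum_(0 <= j < 3) hz g (x + j%:R * (a / 3)) t (a / 3).
Proof.
move=> /sq_contH/seg_split; rewrite /hz => ->; congr (_ *: _); apply: eq_bigr => j _.
by congr seg; cplx_eq; field.
Qed.

Lemma vt_split s : x <= s <= x + a ->
  vt g s y a = (3^-1)%:C *: \sum_(0 <= k < 3) vt g s (y + k%:R * (a / 3)) (a / 3).
Proof.
move=> /sq_contV/seg_split; rewrite /vt => ->; congr (_ *: _); apply: eq_bigr => j _.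
by congr seg; cplx_eq; field.
Qed.

(** Edges shared by two subsquares cancel, horizontally and vertically, as telescoping sums. *)
Lemma cint_split : cint x y a g = \sum_(0 <= j < 3) \sum_(0 <= k < 3)
   cint (x + j%:R * (a / 3)) (y + k%:R * (a / 3)) (a / 3) g.
Proof.
pose H (j k : nat) := hz g (x + j%:R * (a / 3)) (y + k%:R * (a / 3)) (a / 3).
pose V (j k : nat) := vt g (x + j%:R * (a / 3)) (y + k%:R * (a / 3)) (a / 3).
have sub j k : cint (x + j%:R * (a / 3)) (y + k%:R * (a / 3)) (a / 3) g =
    (a / 3)%:C *: ((H j k - H j k.+1) + I *: (V j.+1 k - V j k)).
  have e (z : R) (n : nat) : z + n%:R * (a / 3) + a / 3 = z + n.+1%:R * (a / 3).
    by rewrite -natr1; ring.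
  by rewrite /cint !e.
under eq_bigr => j _ do under eq_bigr => k _ do rewrite sub.
under eq_bigr => j _ do rewrite -scaler_sumr big_split /= -scaler_sumr tele3.
rewrite -scaler_sumr big_split /= -scaler_sumr exchange_big /=.
have -> : \sum_(0 <= k < 3) \sum_(0 <= j < 3) (V j.+1 k - V j k) =
    \sum_(0 <= k < 3) (V 3%N k - V 0%N k).
  by apply: eq_bigr => k _; rewrite (@telescope_sumr _ 0 3 (fun j => V j k)).
rewrite !sumrB /cint.
have b0 : y <= y <= y + a by rewrite lexx lerDl ltW.
have b1 : y <= y + a <= y + a by rewrite lexx lerDl ltW.
have c0 : x <= x <= x + a by rewrite lexx lerDl ltW.
have c1 : x <= x + a <= x + a by rewrite lexx lerDl ltW.
rewrite (hz_split b0) (hz_split b1) (vt_split c0) (vt_split c1).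
have e3 (z : R) : z + 3%:R * (a / 3) = z + a by field.
have e0 (z : R) : z + 0%:R * (a / 3) = z by rewrite mul0r addr0.
rewrite /H /V !e3 !e0 -!scalerBr [I *: (_ *: _)]scalerA [I * _]mulrC -scalerA -scalerDr.
by rewrite scalerA -rmorphM.
Qed.

Lemma cint_le (e : R) : (forall z, in_sq x y a z -> rnm (g z) <= e) ->
  rnm (cint x y a g) <= 4 * a * e.
Proof.
move=> ge; have b0 : y <= y <= y + a by rewrite lexx lerDl ltW.
have b1 : y <= y + a <= y + a by rewrite lexx lerDl ltW.
have c0 : x <= x <= x + a by rewrite lexx lerDl ltW.
have c1 : x <= x + a <= x + a by rewrite lexx lerDl ltW.
have hb t : y <= t <= y + a -> rnm (hz g x t a) <= e.
  move=> ht; rewrite -[hz _ _ _ _]subr0; apply: seg_close; first exact: sq_contH.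
  by apply: on_segH => [|s hs]; [exact: ltW|rewrite subr0; exact: ge].
have vb s : x <= s <= x + a -> rnm (vt g s y a) <= e.
  move=> ht; rewrite -[vt _ _ _ _]subr0; apply: seg_close; first exact: sq_contV.
  by apply: on_segV => [|t hs]; [exact: ltW|rewrite subr0; exact: ge].
rewrite rnmZ normc_real; last exact: ltW.
rewrite [4 * a]mulrC -mulrA ler_wpM2l //; first exact: ltW.
apply: le_trans (rnmD _ _) _; rewrite rnmZ normI mul1r.
have := rnmB (hz g x y a) (hz g x (y + a) a); have := rnmB (vt g (x + a) y a) (vt g x y a).
have := hb _ b0; have := hb _ b1; have := vb _ c0; have := vb _ c1; lra.
Qed.

End Square.

Lemma cintB g1 g2 x y a : 0 < a -> (forall z, in_sq x y a z -> cont_at g1 z) ->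
  (forall z, in_sq x y a z -> cont_at g2 z) ->
  cint x y a (fun z => g1 z - g2 z) = cint x y a g1 - cint x y a g2.
Proof.
move=> a0 h1 h2.
have b0 : y <= y <= y + a by rewrite lexx lerDl ltW.
have b1 : y <= y + a <= y + a by rewrite lexx lerDl ltW.
have c0 : x <= x <= x + a by rewrite lexx lerDl ltW.
have c1 : x <= x + a <= x + a by rewrite lexx lerDl ltW.
have [e1 e2 e3 e4] : [/\ on_seg (Complex x y) (Complex a 0) (cont_at g1),
    on_seg (Complex x y) (Complex a 0) (cont_at g2),
    on_seg (Complex x (y + a)) (Complex a 0) (cont_at g1) &
    on_seg (Complex x (y + a)) (Complex a 0) (cont_at g2)].
  by split; [exact: sq_contH h1 _ b0|exact: sq_contH h2 _ b0|exact: sq_contH h1 _ b1|exact: sq_contH h2 _ b1].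
have [e5 e6 e7 e8] : [/\ on_seg (Complex x y) (Complex 0 a) (cont_at g1),
    on_seg (Complex x y) (Complex 0 a) (cont_at g2),
    on_seg (Complex (x + a) y) (Complex 0 a) (cont_at g1) &
    on_seg (Complex (x + a) y) (Complex 0 a) (cont_at g2)].
  by split; [exact: sq_contV h1 _ c0|exact: sq_contV h2 _ c0|exact: sq_contV h1 _ c1|exact: sq_contV h2 _ c1].
rewrite /cint /hz /vt !segB //.
rewrite -[in RHS]scalerBr [in RHS]opprD [in RHS]addrACA -[in RHS]scalerBr.
by congr (_ *: (_ + _ *: _)); exact: subr_interchange.
Qed.

Lemma cint_affine c q (l : X) x y a : cint x y a (fun z => c + (z - q) *: l) = 0.
Proof.
rewrite /cint /hz /vt !seg_affine.
have B (u w : C) : c + u *: l - (c + w *: l) = (u - w) *: l.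
  by rewrite opprD addrACA subrr add0r scalerBl.
rewrite !B scalerA -scalerDl scalerA.
suff -> : a%:C * ((Complex x y : C) + (2^-1)%:C * Complex a 0 - q -
   (Complex x (y + a) + (2^-1)%:C * Complex a 0 - q) +
   I * ((Complex (x + a) y : C) + (2^-1)%:C * Complex 0 a - q -
        (Complex x y + (2^-1)%:C * Complex 0 a - q))) = 0 :> C by rewrite scale0r.
by case: (q) => q1 q2; cplx_eq; ring.
Qed.

Lemma normc_le (u v : R) : normc (Complex u v : C) <= `|u| + `|v|.
Proof.
have -> : (Complex u v : C) = u%:C + v%:C * I by cplx_eq; ring.
have nr (t : R) : normc t%:C = `|t| by rewrite /= expr0n addr0 sqrtr_sqr.
by apply: le_trans (normcD _ _) _; rewrite normcM normI mulr1 !nr.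
Qed.

Lemma sq_diam x y a z w : in_sq x y a z -> in_sq x y a w -> normc (w - z) <= 2 * a.
Proof.
case: z => z1 z2; case: w => w1 w2; rewrite /in_sq /=.
move=> [/andP[? ?] /andP[? ?]] [/andP[? ?] /andP[? ?]].
apply: le_trans (normc_le (w1 - z1) (w2 - z2)) _.
have -> : 2 * a = a + a by ring.
by apply: lerD; rewrite ler_norml; apply/andP; split; lra.
Qed.

Lemma in_sq_sub x0 y0 a0 x y a z : x0 <= x -> x + a <= x0 + a0 -> y0 <= y ->
  y + a <= y0 + a0 -> in_sq x y a z -> in_sq x0 y0 a0 z.
Proof. by move=> ? ? ? ? [/andP[? ?] /andP[? ?]]; split; apply/andP; split; lra. Qed.

Lemma sub_bounds (x0 x a a0 : R) j : (j < 3)%N -> 0 < a -> x0 <= x -> x + a <= x0 + a0 ->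
  x0 <= x + j%:R * (a / 3) /\ x + j%:R * (a / 3) + a / 3 <= x0 + a0.
Proof.
move=> j3 a0' h1 h2.
have b0 : 0 <= j%:R * (a / 3) by rewrite mulr_ge0 // divr_ge0 // ltW.
have b1 : j%:R * (a / 3) <= 2 * (a / 3) by rewrite ler_pM2r ?divr_gt0 // (ler_nat R j 2).
by split; lra.
Qed.

(** The bound [e a^2] on the integral is additive under division into nine, so by [cousin_square] it
    only has to hold on small squares about each point, where [f] is nearly affine. *)
Lemma goursat f x0 y0 a0 : 0 < a0 -> (forall z, in_sq x0 y0 a0 z -> diff_at f z) ->
  cint x0 y0 a0 f = 0.
Proof.
move=> a00 df; have cf z : in_sq x0 y0 a0 z -> cont_at f z by move=> /df/diff_cont.
apply: rnm_small => e1 e10; set e := e1 / a0 ^+ 2.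
have e0 : 0 < e by rewrite divr_gt0 // exprn_gt0.
have -> : e1 = e * a0 ^+ 2 by rewrite /e; field; rewrite gt_eqF.
pose P x y a := x0 <= x -> x + a <= x0 + a0 -> y0 <= y -> y + a <= y0 + a0 ->
  rnm (cint x y a f) <= e * a ^+ 2.
suff : P x0 y0 a0 by apply.
apply: cousin_square => //.
  move=> x y a ap h h1 h2 h3 h4.
  rewrite cint_split //; last by move=> z hz; apply: cf; apply: in_sq_sub hz.
  have hjk j k : (j < 3)%N -> (k < 3)%N ->
      rnm (cint (x + j%:R * (a / 3)) (y + k%:R * (a / 3)) (a / 3) f) <= e * (a / 3) ^+ 2.
    move=> j3 k3; have [? ?] := sub_bounds j3 ap h1 h2; have [? ?] := sub_bounds k3 ap h3 h4.
    exact: h.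
  have S3 (u : nat -> X) d : (forall j, (j < 3)%N -> rnm (u j) <= d) ->
      rnm (\sum_(0 <= j < 3) u j) <= 3 * d.
    move=> hu; rewrite sum3; have := hu 0%N isT; have := hu 1%N isT; have := hu 2%N isT.
    by have := rnmD (u 0%N + u 1%N) (u 2%N); have := rnmD (u 0%N) (u 1%N); lra.
  have -> : e * a ^+ 2 = 3 * (3 * (e * (a / 3) ^+ 2)) by field.
  pose c (j k : nat) := cint (x + j%:R * (a / 3)) (y + k%:R * (a / 3)) (a / 3) f.
  apply: (S3 (fun j => \sum_(0 <= k < 3) c j k)) => j j3.
  by apply: (S3 (c j)) => k k3; exact: hjk.
move=> s t hs ht; have [l hl] := df (Complex s t) (conj hs ht).
(* A square of side [a] has diameter at most [2 a] and perimeter [4 a], so the error after removing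
   the affine part is at most [4 a (e / 16) (2 a)], which is below [e a^2]. *)
have [d d0 hd] := hl (e / 16) (ltac:(lra)).
exists (d / 2); first by lra.
move=> x y a ap ad xs yt h1 h2 h3 h4.
have cf' z : in_sq x y a z -> cont_at f z by move=> hz; apply: cf; apply: in_sq_sub hz.
pose aff z := f (Complex s t) + (z - Complex s t) *: l.
have daff z : diff_at aff z.
  exists l => d' d'0; exists 1 => // w _; rewrite /aff opprD addrACA subrr add0r -scalerBl.
  have -> : w - Complex s t - (z - Complex s t) = w - z by rewrite opprB addrA subrK.
  by rewrite subrr rnm0 mulr_ge0 ?normc_ge0 // ltW.
move=> _ _ _ _; have -> : cint x y a f = cint x y a (fun z => f z - aff z).
  rewrite cintB // ?cint_affine ?subr0 // => z _; exact/diff_cont/daff.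
apply: le_trans (_ : 4 * a * (e / 16 * (2 * a)) <= _); last by rewrite expr2; nra.
apply: cint_le => //.
  move=> z hz e' e'0; have e2 : 0 < e' / 2 by lra.
  have [d1 d10 k1] := cf' _ hz _ e2; have [d2 d20 k2] := diff_cont (daff z) e2.
  exists (Num.min d1 d2); first by rewrite lt_min d10.
  move=> w; rewrite lt_min => /andP[/k1 q1 /k2 q2].
  have -> : f w - aff w - (f z - aff z) = f w - f z - (aff w - aff z).
    exact: subr_interchange.
  by have := rnmB (f w - f z) (aff w - aff z); lra.
move=> z hz; have dz : normc (z - Complex s t) <= 2 * a by apply: sq_diam hz; split.
rewrite /aff opprD addrA; apply: le_trans (hd z _) _; first by lra.
by rewrite ler_wpM2l //; lra.
Qed.

(* Module identities in three vectors are reduced to ring identities between coefficients. *)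
Lemma comb3 (F G L : X) : exists nf : C -> C -> C -> X,
  [/\ F = nf 1 0 0, G = nf 0 1 0 & L = nf 0 0 1] /\
  [/\ forall a b c a' b' c' : C, nf a b c + nf a' b' c' = nf (a + a') (b + b') (c + c'),
      forall s a b c : C, s *: nf a b c = nf (s * a) (s * b) (s * c) &
      forall a b c : C, - nf a b c = nf (- a) (- b) (- c)].
Proof.
exists (fun a b c : C => a *: F + b *: G + c *: L); split; split=> *.
- by rewrite scale1r !scale0r !addr0.
- by rewrite scale1r !scale0r add0r addr0.
- by rewrite scale1r !scale0r !add0r.
- by rewrite addrACA -scalerDl addrACA -!scalerDl.
- by rewrite !scalerDr !scalerA.
- by rewrite !opprD !scaleNr.
Qed.

Lemma diff_at_const (c : X) z : diff_at (fun=> c) z.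
Proof.
exists 0 => e e0; exists 1 => // w _; rewrite subrr scaler0 subrr rnm0.
by rewrite mulr_ge0 ?normc_ge0 // ltW.
Qed.

Lemma diff_atB g1 g2 z : diff_at g1 z -> diff_at g2 z -> diff_at (fun u => g1 u - g2 u) z.
Proof.
move=> [l1 h1] [l2 h2]; exists (l1 - l2) => e e0; have e2 : 0 < e / 2 by lra.
have [d1 d10 k1] := h1 _ e2; have [d2 d20 k2] := h2 _ e2.
exists (Num.min d1 d2); first by rewrite lt_min d10.
move=> w; rewrite lt_min => /andP[/k1 q1 /k2 q2].
rewrite scalerBr (subr_interchange (g1 w)) (subr_interchange (g1 w - g1 z)); apply: le_trans (rnmB _ _) _; lra.
Qed.

Lemma diff_at_ext g1 g2 z (d : R) : 0 < d ->
  (forall w, normc (w - z) < d -> g1 w = g2 w) -> diff_at g1 z -> diff_at g2 z.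
Proof.
move=> d0 E [l hl]; exists l => e /hl[d' d'0 h]; exists (Num.min d d').
  by rewrite lt_min d0.
have z0 : normc (z - z) < d by rewrite subrr normc0.
by move=> w; rewrite lt_min => /andP[wd /h]; rewrite (E _ wd) (E _ z0).
Qed.

Lemma diff_at_div f z w : z != w -> diff_at f z -> diff_at (fun u => (u - w)^-1 *: f u) z.
Proof.
move=> zw [l hl]; set k := (z - w)^-1.
have zw0 : z - w != 0 by rewrite subr_eq0.
have n0 := normc_gt0 zw0.
set N := normc k; have N0 : 0 < N by rewrite /N normcV invr_gt0.
exists (k *: l - k ^+ 2 *: f z) => e e0.
set B := 2 * N ^+ 2 * rnm l + 2 * N ^+ 3 * rnm (f z).
have B0 : 0 <= B by rewrite addr_ge0 // !mulr_ge0 ?rnm_ge0 ?exprn_ge0 // ltW.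
have [d d0 hd] := hl (e / (4 * N)) (ltac:(by rewrite divr_gt0 // mulr_gt0)).
exists (Num.min d (Num.min (normc (z - w) / 2) (e / (2 * (B + 1))))).
  by rewrite !lt_min d0 !divr_gt0 // mulr_gt0 //; lra.
move=> u; rewrite !lt_min => /and3P[hu1 hu2 hu3].
have nuw : normc (z - w) / 2 <= normc (u - w).
  by have := normcD (u - w) (z - u); rewrite addrC addrA subrK (normcBC z u); lra.
have uw0 : u - w != 0.
  by apply/eqP => h; move: nuw; rewrite h normc0; lra.
set q := (u - w)^-1; set h := u - z.
have nq : normc q <= 2 * N.
  have -> : 2 * N = (normc (z - w) / 2)^-1 by rewrite /N /k normcV; field; rewrite gt_eqF.
  by rewrite /q normcV lef_pV2 ?posrE ?normc_gt0 ?divr_gt0.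
have q0 := normc_ge0 q.
have E1 : q - k = - (h * q * k).
  by rewrite /q /k /h; field; rewrite uw0 zw0.
(* The first term is the error of [f] itself; the other two are quadratic in [h]. Since
   [|q| <= 2 N], their coefficients add up to at most [B]. *)
have -> : q *: f u - k *: f z - h *: (k *: l - k ^+ 2 *: f z) =
    q *: (f u - f z - h *: l) + (q - k) *: (h *: l) + (q - k + h * k ^+ 2) *: f z.
  have [nf [[-> -> ->] [D3 Z3 N3]]] := comb3 (f u) (f z) l.
  by rewrite !(Z3, N3, D3); congr nf; ring.
have hn : h * k ^+ 2 - h * q * k = h ^+ 2 * q * k ^+ 2.
  by rewrite /q /k /h; field; rewrite uw0 zw0.
have -> : q - k + h * k ^+ 2 = h ^+ 2 * q * k ^+ 2 by rewrite E1 addrC.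
apply: le_trans (rnmD _ _) _; apply: le_trans (lerD (rnmD _ _) (lexx _)) _.
rewrite !rnmZ.
have -> : normc (q - k) = normc h * normc q * N by rewrite E1 normcN normcM (normcM h).
have -> : normc (h ^+ 2 * q * k ^+ 2) = normc h ^+ 2 * normc q * N ^+ 2.
  by rewrite normcM (normcM (h ^+ 2)) !normcX.
have m0 := normc_ge0 h; have a1 := hd u hu1.
have h4 : normc h * (2 * (B + 1)) < e by rewrite -ltr_pdivlMr // mulr_gt0 //; lra.
have t1 : normc q * rnm (f u - f z - h *: l) <= e / 2 * normc h.
  apply: le_trans (ler_pM q0 (rnm_ge0 _) nq a1) _.
  have -> : 2 * N * (e / (4 * N) * normc (u - z)) = e / 2 * normc h by field; rewrite gt_eqF.
  by [].
have t2 : normc h * normc q * N * (normc h * rnm l) <= normc h ^+ 2 * (2 * N ^+ 2 * rnm l).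
  have -> : normc h * normc q * N * (normc h * rnm l) = normc h ^+ 2 * (N * rnm l) * normc q by ring.
  have -> : normc h ^+ 2 * (2 * N ^+ 2 * rnm l) = normc h ^+ 2 * (N * rnm l) * (2 * N) by ring.
  by rewrite ler_wpM2l // !mulr_ge0 ?rnm_ge0 ?sqr_ge0 // ltW.
have t3 : normc h ^+ 2 * normc q * N ^+ 2 * rnm (f z) <= normc h ^+ 2 * (2 * N ^+ 3 * rnm (f z)).
  have -> : normc h ^+ 2 * normc q * N ^+ 2 * rnm (f z) = normc h ^+ 2 * (N ^+ 2 * rnm (f z)) * normc q by ring.
  have -> : normc h ^+ 2 * (2 * N ^+ 3 * rnm (f z)) = normc h ^+ 2 * (N ^+ 2 * rnm (f z)) * (2 * N) by ring.
  by rewrite ler_wpM2l // !mulr_ge0 ?rnm_ge0 ?sqr_ge0 // ltW.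
have t4 : normc h ^+ 2 * B <= e / 2 * normc h by rewrite expr2; nra.
have t5 : normc h ^+ 2 * B = normc h ^+ 2 * (2 * N ^+ 2 * rnm l) + normc h ^+ 2 * (2 * N ^+ 3 * rnm (f z)).
  by rewrite /B mulrDr.
by rewrite -/h; lra.
Qed.

End Goursat.

(** * Cauchy's estimate *)

Section Identity.
Variables (R : realType) (X : completeNormedModType (Cplx R)).
Local Notation C := (Cplx R).
Local Notation "t %:C" := (real_complex R t : C).
Implicit Types (z w : C) (g f : C -> X) (x y a s t : R).
Let I : C := Complex 0 1.

(** The value [l] at [w] is left open; [quotient_cont] takes the derivative of [f] there. Only
    continuity at [w] is ever used. *)
Definition quotient f w (l : X) z : X := if z == w then l else (z - w)^-1 *: (f z - f w).

Lemma quotient_diff f w l z : z != w -> diff_at f z -> diff_at (quotient f w l) z.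
Proof.
move=> zw df; have zw0 : z - w != 0 by rewrite subr_eq0.
apply: (@diff_at_ext _ _ (fun u => (u - w)^-1 *: (f u - f w)) _ _ _ (normc_gt0 zw0)).
  move=> u hu; rewrite /quotient; case: eqP => // uw.
  by move: hu; rewrite uw normcBC ltxx.
apply: (@diff_at_div _ _ (fun u => f u - f w)) => //.
by apply: diff_atB => //; exact: diff_at_const.
Qed.

Lemma quotient_cont f w : diff_at f w -> exists l, cont_at (quotient f w l) w.
Proof.
move=> [l hl]; exists l => e e0; have [d d0 hd] := hl (e / 2) (ltac:(lra)).
exists d => // z hz; rewrite /quotient eqxx; case: eqP => [_|/eqP zw].
  by rewrite subrr rnm0.
have zw0 : z - w != 0 by rewrite subr_eq0.
have -> : (z - w)^-1 *: (f z - f w) - l = (z - w)^-1 *: (f z - f w - (z - w) *: l).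
  by rewrite [in RHS]scalerBr scalerA mulVf // scale1r.
rewrite rnmZ normcV mulrC ltr_pdivrMr ?normc_gt0 //; apply: le_lt_trans (hd z hz) _.
by rewrite ltr_pM2r ?normc_gt0 //; lra.
Qed.

Section Center.
Variables (f : C -> X) (u v a : R).
Let w : C := Complex u v.
Hypotheses (a0 : 0 < a) (df : forall z, in_sq (u - a / 2) (v - a / 2) a z -> diff_at f z).

Let w_in b : 0 < b -> in_sq (u - b / 2) (v - b / 2) b w.
Proof. by move=> b0; split=> /=; apply/andP; split; lra. Qed.

Let sq_sub b z : b <= a -> in_sq (u - b / 2) (v - b / 2) b z -> in_sq (u - a / 2) (v - a / 2) a z.
Proof. by move=> ba; apply: in_sq_sub; lra. Qed.

Let contq l : cont_at (quotient f w l) w -> forall b z, b <= a ->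
  in_sq (u - b / 2) (v - b / 2) b z -> cont_at (quotient f w l) z.
Proof.
move=> cl b z ba hz; have [->//|zw] := eqVneq z w.
by apply: diff_cont; apply: quotient_diff => //; apply: df; exact: sq_sub hz.
Qed.

(* Of the nine subsquares only the central one contains [w]. *)
Lemma cint_center l b : cont_at (quotient f w l) w -> 0 < b -> b <= a ->
  cint (u - b / 2) (v - b / 2) b (quotient f w l) =
  cint (u - b / 3 / 2) (v - b / 3 / 2) (b / 3) (quotient f w l).
Proof.
move=> cl b0 ba; rewrite cint_split //; last by move=> z; exact: contq.
have Z j k : (j < 3)%N -> (k < 3)%N -> (j != 1)%N || (k != 1)%N ->
    cint (u - b / 2 + j%:R * (b / 3)) (v - b / 2 + k%:R * (b / 3)) (b / 3) (quotient f w l) = 0.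
  move=> j3 k3 jk; apply: goursat; first by rewrite divr_gt0.
  move=> z hz; apply: quotient_diff; last first.
    have lx := lexx (u - b / 2); have ly := lexx (v - b / 2).
    have [? ?] := sub_bounds j3 b0 lx (lexx (u - b / 2 + b)).
    have [? ?] := sub_bounds k3 b0 ly (lexx (v - b / 2 + b)).
    by apply: df; apply: (sq_sub ba); apply: in_sq_sub hz.
  apply/eqP => zw; move: hz; rewrite zw => -[/= /andP[h1 h2] /andP[h3 h4]].
  move: jk j3 k3 h1 h2 h3 h4.
  by case: j => [|[|[|//]]]; case: k => [|[|[|//]]] //= _ _ _; lra.
rewrite !sum3 (Z 0%N 0%N) // (Z 0%N 1%N) // (Z 0%N 2%N) // (Z 1%N 0%N) // (Z 1%N 2%N) //
  (Z 2%N 0%N) // (Z 2%N 1%N) // (Z 2%N 2%N) // !addr0 !add0r.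
have e (t : R) : t - b / 2 + 1%:R * (b / 3) = t - b / 3 / 2 by field.
by rewrite !e.
Qed.

(** [cint_center] shrinks the square to side [a 3^-n] without changing the integral, while the
    quotient stays bounded near [w]; so the integral is arbitrarily small. *)
Lemma cint_quotient l : cont_at (quotient f w l) w ->
  cint (u - a / 2) (v - a / 2) a (quotient f w l) = 0.
Proof.
move=> cl; have [d d0 hd] := cl 1 ltr01.
have step n : cint (u - a / 2) (v - a / 2) a (quotient f w l) =
    cint (u - a * 3^-1 ^+ n / 2) (v - a * 3^-1 ^+ n / 2) (a * 3^-1 ^+ n) (quotient f w l).
  elim: n => [|n ->]; first by rewrite expr0 mulr1.
  have p1 : 3^-1 ^+ n <= 1 :> R by rewrite exprn_ile1 // invf_le1 // ler1n.
  have p0 : 0 < 3^-1 ^+ n :> R by rewrite exprn_gt0.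
  rewrite cint_center //; [|by rewrite mulr_gt0|by rewrite ger_pMr].
  by rewrite exprSr !mulrA.
apply: rnm_small => e e0; set B := rnm l + 1.
have B0 : 0 < B by rewrite ltr_wpDl ?rnm_ge0.
have m0 : 0 < Num.min (d / (2 * a)) (e / (4 * a * B)).
  by rewrite lt_min !divr_gt0 // !mulr_gt0.
have [N hN] := @expr_small R 3^-1 _ (ltac:(lra)) (ltac:(lra)) m0.
have := hN N (leqnn _); rewrite (step N) lt_min.
have p1 : 3^-1 ^+ N <= 1 :> R by rewrite exprn_ile1 // invf_le1 // ler1n.
have p0 : 0 < 3^-1 ^+ N :> R by rewrite exprn_gt0.
set T := 3^-1 ^+ N in p1 p0 * => /andP[h1 h2].
have Ta : a * T <= a by rewrite ger_pMr.
have T0 : 0 < a * T by rewrite mulr_gt0.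
apply: le_trans (@cint_le _ _ (quotient f w l) _ _ (a * T) T0 _ B _) _.
- by move=> z; exact: contq.
- move=> z hz; have h := sq_diam (w_in T0) hz.
  have : normc (z - w) < d.
    apply: le_lt_trans h _; move: h1; rewrite ltr_pdivlMr ?mulr_gt0 //; lra.
  move=> /hd; rewrite /quotient eqxx -/(quotient f w l z) => h3.
  by have := rnmD (quotient f w l z - l) l; rewrite subrK /B; lra.
move: h2; rewrite ltr_pdivlMr ?mulr_gt0 //; lra.
Qed.

(* On each side of the square centred at [w], [dz / (z - w)] stays within 5/4 of [3i/2] per
   half side, so that its integral over the boundary cannot vanish. *)
Lemma kernel_approx s : -1 <= s <= 1 ->
  normc (2%:C / Complex s (-1) - Complex 0 (3 / 2) : C) <= 5 / 4.
Proof.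
move=> /andP[s1 s2].
have c0 : (Complex s (-1) : C) != 0 by apply/eqP => -[_ /eqP]; rewrite oppr_eq0 oner_eq0.
have -> : 2%:C / Complex s (-1) - Complex 0 (3 / 2) = Complex (1 / 2) (- (3 / 2) * s) / Complex s (-1) :> C.
  apply: (mulIf c0); rewrite mulrBl !divfK //.
  by cplx_eq; field.
rewrite normcM normcV ler_pdivrMr ?normc_gt0 //=.
have -> : 5 / 4 = Num.sqrt ((5 / 4) ^+ 2) :> R by rewrite sqrtr_sqr ger0_norm.
rewrite -sqrtrM ?sqr_ge0 // ler_sqrt; first by rewrite !expr2; nra.
by rewrite mulr_ge0 ?addr_ge0 ?sqr_ge0.
Qed.

(** The unit [D] rotates the bottom side onto the others: 1, [I], -1 and [- I] stand for bottom,
    right, top and left, and [z = w + D (a / 2) (s - i)] runs along the side. *)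
Lemma edge_close l (D : C) s z M : normc D = 1 -> -1 <= s <= 1 ->
  z - w = D * ((a / 2)%:C * Complex s (-1)) -> rnm (f z) <= M ->
  rnm (quotient f w l z + (D^-1 * ((a^-1)%:C * Complex 0 (3 / 2))) *: f w) <=
    (2 * M + 5 / 4 * rnm (f w)) / a.
Proof.
move=> nD hs ezw fM.
have D0 : D != 0 by apply/eqP => h; move: nD; rewrite h normc0 => /eqP; rewrite eq_sym oner_eq0.
have c0 : (Complex s (-1) : C) != 0 by apply/eqP => -[_ /eqP]; rewrite oppr_eq0 oner_eq0.
have a20 : (a / 2)%:C != 0 by rewrite fmorph_eq0 gt_eqF // divr_gt0.
have zw0 : z - w != 0 by rewrite ezw !mulf_neq0.
have zw : z != w by rewrite -subr_eq0.
rewrite /quotient (negPf zw).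
have kE : (z - w)^-1 = D^-1 * ((a^-1)%:C * (2%:C / Complex s (-1))).
  have aE : (a^-1)%:C = ((a / 2)%:C * 2%:C)^-1.
    by rewrite -rmorphM -fmorphV; congr (_%:C); field; rewrite gt_eqF.
  rewrite ezw aE; have : 2%:C != 0 :> C by rewrite fmorph_eq0 pnatr_eq0.
  move: a20 c0; move: (a / 2)%:C (Complex s (-1) : C) (2%:C : C) => p k q p0 k0 q0.
  by field; rewrite ?(D0, p0, k0, q0).
rewrite scalerBr -addrA.
have -> : - ((z - w)^-1 *: f w) + (D^-1 * ((a^-1)%:C * Complex 0 (3 / 2))) *: f w =
   - (D^-1 * ((a^-1)%:C * (2%:C / Complex s (-1) - Complex 0 (3 / 2)))) *: f w.
  rewrite -scaleNr -scalerDl kE; congr (_ *: _).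
  by move: (2%:C / Complex s (-1) : C) (Complex 0 (3 / 2) : C) => p q; ring.
apply: le_trans (rnmD _ _) _; rewrite !rnmZ normcN !normcM !normcV nD invr1 mul1r.
rewrite -[normc (_ / _ - _)]/(normc (2%:C / Complex s (-1) - Complex 0 (3 / 2) : C)).
have nzw : a / 2 <= normc (z - w).
  have a2p : 0 < a / 2 by rewrite divr_gt0.
  rewrite ezw normcM nD mul1r normcM (normc_real (ltW a2p)) ler_peMr ?(ltW a2p) //=.
  rewrite -[leLHS]sqrtr1 ler_wsqrtr //.
  by rewrite sqrrN expr1n lerDr sqr_ge0.
have t1 : (normc (z - w))^-1 * rnm (f z) <= 2 * M / a.
  have -> : 2 * M / a = (a / 2)^-1 * M by field; rewrite gt_eqF.
  apply: ler_pM => //; rewrite ?invr_ge0 ?normc_ge0 ?rnm_ge0 //.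
  by rewrite lef_pV2 // posrE ?normc_gt0 // divr_gt0.
have t2 : normc (a^-1)%:C * normc (2%:C / Complex s (-1) - Complex 0 (3 / 2) : C) * rnm (f w)
   <= a^-1 * (5 / 4) * rnm (f w).
  apply: ler_wpM2r; first exact: rnm_ge0.
  rewrite normc_real ?invr_ge0 ?(ltW a0) //; apply: ler_wpM2l; first by rewrite invr_ge0 ltW.
  exact: kernel_approx.
have -> : (2 * M + 5 / 4 * rnm (f w)) / a = 2 * M / a + a^-1 * (5 / 4) * rnm (f w) by ring.
exact: lerD.
Qed.

(** The integral of the quotient is zero, so the four kernel terms, of total size
    [4 (3 / 2) |f w| / a], are balanced by four errors [(2 M + 5/4 |f w|) / a]. Thus
    [6 |f w| <= 8 M + 5 |f w|], which is where the 8 comes from. *)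
Lemma cauchy_estimate M : (forall z, in_sq (u - a / 2) (v - a / 2) a z ->
   a / 2 <= normc (z - w) -> rnm (f z) <= M) -> rnm (f w) <= 8 * M.
Proof.
move=> fM; have [l cl] := quotient_cont (df (w_in a0)).
have := cint_quotient cl; rewrite /cint.
set q := quotient f w l; set k : C := (a^-1)%:C * Complex 0 (3 / 2).
set e := (2 * M + 5 / 4 * rnm (f w)) / a.
have cq z : in_sq (u - a / 2) (v - a / 2) a z -> cont_at q z by apply: contq.
have ha : `|a / 2| = a / 2 by rewrite ger0_norm // divr_ge0 // ltW.
have far (z : C) : `|complex.Re z - u| = a / 2 \/ `|complex.Im z - v| = a / 2 ->
    a / 2 <= normc (z - w).
  case: z => z1 z2 /= h.
  rewrite -ha -sqrtr_sqr ler_wsqrtr //.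
  case: h => /(congr1 (fun t => t ^+ 2)); rewrite real_normK ?num_real // => <-.
    by rewrite lerDl sqr_ge0.
  by rewrite lerDr sqr_ge0.
have edge (D z c : C) s : normc D = 1 -> -1 <= s <= 1 ->
    z - w = D * ((a / 2)%:C * Complex s (-1)) -> D * c = - k ->
    in_sq (u - a / 2) (v - a / 2) a z -> a / 2 <= normc (z - w) ->
    rnm (q z - c *: f w) <= e.
  move=> nD hs ez ck hz hf.
  have D0 : D != 0 by apply/eqP => h; move: nD; rewrite h normc0 => /eqP; rewrite eq_sym oner_eq0.
  have -> : c = - (D^-1 * k) by rewrite -mulrN -ck mulKf.
  rewrite scaleNr opprK; apply: edge_close ez _ => //; exact: fM.
have sb (t : R) c : c - a / 2 <= t <= c - a / 2 + a -> -1 <= (t - c) / (a / 2) <= 1.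
  move=> /andP[h1 h2]; have a20 : 0 < a / 2 by rewrite divr_gt0.
  by rewrite ler_pdivlMr // ler_pdivrMr //; apply/andP; split; lra.
have a2n : a / 2 != 0 by rewrite gt_eqF // divr_gt0.
have bnd0 c : c - a / 2 <= c - a / 2 <= c - a / 2 + a by rewrite lexx lerDl ltW.
have bnd1 c : c - a / 2 <= c - a / 2 + a <= c - a / 2 + a by rewrite lexx lerDl ltW.
have sbN (t : R) c : c - a / 2 <= t <= c - a / 2 + a -> -1 <= - ((t - c) / (a / 2)) <= 1.
  by move=> /sb/andP[? ?]; rewrite lerN2 lerNl; apply/andP.
have n1 : normc (1 : C) = 1 by exact: normc1.
have nI : normc I = 1 by rewrite /= expr0n expr1n add0r sqrtr1.
have II : I * I = -1 by cplx_eq; ring.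
have e1 : rnm (hz q (u - a / 2) (v - a / 2) a - (- k) *: f w) <= e.
  apply: seg_close; first exact: sq_contH cq _ (bnd0 v).
  apply: on_segH => [|t ht]; first exact: ltW.
  apply: (edge 1 _ _ ((t - u) / (a / 2))) => //; [exact: sb| |by rewrite mul1r|].
  - by cplx_eq; field; rewrite gt_eqF.
  - by apply: far; right; rewrite /= (_ : v - a / 2 - v = - (a / 2)) ?normrN //; ring.
have e2 : rnm (vt q (u - a / 2 + a) (v - a / 2) a - (I * k) *: f w) <= e.
  apply: seg_close; first exact: sq_contV cq _ (bnd1 u).
  apply: on_segV => [|t ht]; first exact: ltW.
  apply: (edge I _ _ ((t - v) / (a / 2))) => //; [exact: sb| |by rewrite mulrA II mulN1r|].
  - by cplx_eq; field; rewrite gt_eqF.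
  - by apply: far; left; rewrite /= (_ : u - a / 2 + a - u = a / 2) //; field.
have e3 : rnm (hz q (u - a / 2) (v - a / 2 + a) a - k *: f w) <= e.
  apply: seg_close; first exact: sq_contH cq _ (bnd1 v).
  apply: on_segH => [|t ht]; first exact: ltW.
  apply: (edge (-1) _ _ (- ((t - u) / (a / 2)))) => //; rewrite ?normcN //;
    [exact: sbN| |by rewrite mulN1r|].
  - by cplx_eq; field; rewrite gt_eqF.
  - by apply: far; right; rewrite /= (_ : v - a / 2 + a - v = a / 2) //; field.
have e4 : rnm (vt q (u - a / 2) (v - a / 2) a - (- (I * k)) *: f w) <= e.
  apply: seg_close; first exact: sq_contV cq _ (bnd0 u).
  apply: on_segV => [|t ht]; first exact: ltW.
  apply: (edge (- I) _ _ (- ((t - v) / (a / 2)))) => //; rewrite ?normcN //;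
    [exact: sbN| |by rewrite mulrNN mulrA II mulN1r|].
  - by cplx_eq; field; rewrite gt_eqF.
  - by apply: far; left; rewrite /= (_ : u - a / 2 - u = - (a / 2)) ?normrN //; ring.
move: e1 e2 e3 e4; set h1 := hz _ _ _ _; set h2 := hz _ _ _ _; set v1 := vt _ _ _ _.
set v2 := vt _ _ _ _ => e1 e2 e3 e4 h.
have h0 : h1 - h2 + I *: (v1 - v2) = 0.
  move: h => /eqP; rewrite scaler_eq0 => /orP[|/eqP //].
  by rewrite fmorph_eq0 gt_eqF.
have two : 2%:C = 2%:R :> C by exact: rmorph_nat.
have E : (4%:C * k) *: f w = (h1 - (- k) *: f w) - (h2 - k *: f w) +
   I *: ((v1 - (I * k) *: f w) - (v2 - (- (I * k)) *: f w)).
  have -> : h1 - (- k) *: f w - (h2 - k *: f w) = h1 - h2 + (2%:C * k) *: f w.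
    rewrite subr_interchange -scalerBl -scaleNr; congr (_ + _ *: _).
    by move: (k) => k'; rewrite two; ring.
  have -> : v1 - (I * k) *: f w - (v2 - (- (I * k)) *: f w) = v1 - v2 - (2%:C * (I * k)) *: f w.
    rewrite subr_interchange -scalerBl; congr (_ - _ *: _).
    by move: (k) => k'; rewrite two; ring.
  rewrite scalerBr addrACA h0 add0r scalerA -scaleNr -scalerDl; congr (_ *: _).
  have -> : I * (2%:C * (I * k)) = (I * I) * (2%:C * k) by move: (2%:C : C) (k) => b c; ring.
  rewrite II; have -> : 4%:C = 2%:C + 2%:C :> C by rewrite -rmorphD -natrD.
  by move: (2%:C : C) (k) => b c; ring.
have := rnmD ((h1 - (- k) *: f w) - (h2 - k *: f w))
  (I *: ((v1 - (I * k) *: f w) - (v2 - (- (I * k)) *: f w))).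
rewrite -E !rnmZ nI mul1r normcM normc_real //.
have := rnmB (h1 - (- k) *: f w) (h2 - k *: f w).
have := rnmB (v1 - (I * k) *: f w) (v2 - (- (I * k)) *: f w).
have nk : normc k = 3 / 2 / a.
  have -> : k = (3 / 2 / a)%:C * I by rewrite /k; cplx_eq; ring.
  by rewrite normcM nI mulr1 normc_real // !divr_ge0 // ltW.
rewrite nk => i1 i2 i3.
have : 3 / 2 / a * rnm (f w) <= e by lra.
rewrite /e ler_pdivlMr // mulrAC divfK ?gt_eqF //; lra.
Qed.

End Center.
End Identity.

(** * The identity theorem *)

Section IdentityTheorem.
Variables (R : realType) (X : completeNormedModType (Cplx R)).
Local Notation C := (Cplx R).
Local Notation "t %:C" := (real_complex R t : C).
Implicit Types (z w p : C) (g f : C -> X) (x y a s t : R).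

Lemma sq_bounded f x0 y0 a0 : 0 < a0 -> (forall z, in_sq x0 y0 a0 z -> cont_at f z) ->
  exists M, forall z, in_sq x0 y0 a0 z -> rnm (f z) <= M.
Proof.
move=> a00 cf.
apply: (@cousin_square R (fun x y a => exists M, forall z, in_sq x y a z -> rnm (f z) <= M)) => //.
  move=> x y a ap h.
  have cov (c t : R) : c <= t <= c + a -> exists2 j : nat, (j < 3)%N &
      c + j%:R * (a / 3) <= t <= c + j%:R * (a / 3) + a / 3.
    move=> /andP[c1 c2]; have [h1|h1] := lerP t (c + a / 3).
      by exists 0%N => //; apply/andP; split; lra.
    have [h2|h2] := lerP t (c + 2 * (a / 3)).
      by exists 1%N => //; apply/andP; split; lra.
    by exists 2%N => //; apply/andP; split; lra.
  have h' (j k : nat) : exists M, (j < 3)%N -> (k < 3)%N -> forall z,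
      in_sq (x + j%:R * (a / 3)) (y + k%:R * (a / 3)) (a / 3) z -> rnm (f z) <= M.
    have [[j3 k3]|nn] := pselect ((j < 3)%N /\ (k < 3)%N).
      by have [M hM] := h j k j3 k3; exists M.
    by exists 0 => j3 k3; case: nn.
  pose M j k := sval (cid (h' j k)); have hM j k := svalP (cid (h' j k)) : _ -> _ -> forall z, _ -> _ <= M j k.
  exists (\sum_(j < 3) \sum_(k < 3) `|M j k|) => z [/cov[j j3 hj] /cov[k k3 hk]].
  apply: le_trans (hM j k j3 k3 z (conj hj hk)) _; apply: le_trans (ler_norm _) _.
  rewrite (bigD1 (Ordinal j3)) //= (bigD1 (Ordinal k3)) //= -addrA lerDl addr_ge0 //.
    by apply: sumr_ge0.
  by apply: sumr_ge0 => i _; apply: sumr_ge0.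
move=> s t hs ht; have [d d0 hd] := cf (Complex s t) (conj hs ht) 1 ltr01.
exists (d / 2); first by lra.
move=> x y a ap ad xs yt _ _ _ _; exists (rnm (f (Complex s t)) + 1) => z hz.
have : normc (z - Complex s t) < d.
  by apply: le_lt_trans (@sq_diam _ x y a _ _ _ hz) _; [split|lra].
by move=> /hd h; have := rnmD (f z - f (Complex s t)) (f (Complex s t)); rewrite subrK; lra.
Qed.

(* [f z / z^n] is again differentiable, and on the boundary of the square [|z| >= 3 |w|]. *)
Lemma identity_local f (r d : R) : 0 < d -> (forall z, normc z < r -> diff_at f z) ->
  (forall z, normc z < d -> f z = 0) -> forall w, normc w < r / 20 -> f w = 0.
Proof.
move=> d0 df f0 w hw; have [->|w0] := eqVneq w 0; first by apply: f0; rewrite normc0.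
have nw := normc_gt0 w0; set m := normc w in nw hw.
pose F n z := (z^-1) ^+ n *: f z.
have dF n z : normc z < r -> diff_at (F n) z.
  elim: n z => [|n IH] z hz.
    apply: (@diff_at_ext _ _ f _ _ 1) => // [u _|]; last exact: df.
    by rewrite /F expr0 scale1r.
  have [->|z0] := eqVneq z 0.
    (* [f] vanishes near 0, hence so does [F], whatever the value of [0^-1]. *)
    apply: (@diff_at_ext _ _ (fun=> 0) _ _ d) => // [u|]; last exact: diff_at_const.
    by rewrite subr0 => /f0 fu; rewrite /F fu scaler0.
  apply: (@diff_at_ext _ _ (fun u => (u - 0)^-1 *: F n u) _ _ 1) => // [u _|].
    by rewrite /F scalerA subr0 -exprS.
  by apply: diff_at_div => //; exact: IH.
have [u [v wE]] : exists u v, w = Complex u v by case: (w) => u v; exists u, v.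
(* Points of the square satisfy [|z| <= 2 a + m = 17 m < r], whence the radius [r / 20]; those with
   [|z - w| >= a / 2 = 4 m] satisfy [|z| >= 3 m]. *)
pose a := 8 * m; have a0 : 0 < a by rewrite mulr_gt0.
have inr z : in_sq (u - a / 2) (v - a / 2) a z -> normc z < r.
  move=> hz; have w_in : in_sq (u - a / 2) (v - a / 2) a w.
    by rewrite wE; split=> /=; apply/andP; split; lra.
  have := sq_diam w_in hz; have := normcD (z - w) w; rewrite subrK -/m /a; lra.
have [M hM] := @sq_bounded f (u - a / 2) (v - a / 2) a a0 (fun z hz => diff_cont (df z (inr z hz))).
have M0 : 0 <= M.
  apply: le_trans (rnm_ge0 (f w)) (hM _ _).
  by rewrite wE; split=> /=; apply/andP; split; lra.
(* Cauchy's estimate for [f z / z^n] compares [m^-n |f w|] with [8 M (3 m)^-n]. *)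
have key n : rnm (f w) <= 8 * M * 3^-1 ^+ n.
  have := @cauchy_estimate _ _ (F n) u v a a0 (fun z hz => dF n z (inr z hz)) (M * (3 * m) ^- n).
  rewrite -wE /F rnmZ normcX normcV -/m => h.
  have : m^-1 ^+ n * rnm (f w) <= 8 * (M * (3 * m) ^- n).
    apply: h => z hz hzw; rewrite rnmZ normcX normcV mulrC -exprVn.
    have zm : 3 * m <= normc z.
      by have := normcD z (- w); rewrite normcN -/m; move: hzw; rewrite /a; lra.
    have m3 : 0 < 3 * m by rewrite mulr_gt0.
    apply: ler_pM; rewrite ?rnm_ge0 ?exprn_ge0 ?invr_ge0 ?normc_ge0 //; first exact: hM.
    rewrite lerXn2r ?nnegrE ?invr_ge0 ?normc_ge0 ?(ltW m3) //.
    by rewrite lef_pV2 ?posrE //; apply: lt_le_trans zm.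
  rewrite exprVn ler_pdivrMl ?exprn_gt0 // exprMn => /le_trans; apply.
  rewrite le_eqVlt; apply/orP; left; apply/eqP; rewrite exprVn; field.
  by rewrite !expf_neq0 // gt_eqF.
apply: rnm_small => e e0.
have [N hN] := @expr_small R 3^-1 (e / (8 * M + 1)) (ltac:(lra)) (ltac:(lra))
  (ltac:(by rewrite divr_gt0 //; lra)).
have := hN N (leqnn _); rewrite ltr_pdivlMr; last by lra.
have := key N; have : 0 <= 3^-1 ^+ N :> R by rewrite exprn_ge0 // invr_ge0.
set T := 3^-1 ^+ N; lra.
Qed.

(** Vanishing is carried from [p] to [w] along equally spaced points closer than [rho / 20]. All
    discs of radius [rho] about them stay inside the domain, so [identity_local] applies at each. *)
Lemma identity_theorem f p (r d : R) : 0 < d -> (forall z, normc (z - p) < r -> diff_at f z) ->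
  (forall z, normc (z - p) < d -> f z = 0) -> forall z, normc (z - p) < r -> f z = 0.
Proof.
move=> d0 df f0 w hw.
pose Z q := exists2 e : R, 0 < e & forall z, normc (z - q) < e -> f z = 0.
set rho := r - normc (w - p); have rho0 : 0 < rho by rewrite subr_gt0.
have loc q : normc (q - p) <= normc (w - p) -> Z q ->
    forall z, normc (z - q) < rho / 20 -> f z = 0.
  move=> hq [e e0 he] z hz.
  have := @identity_local (fun u => f (q + u)) rho e e0 _ _ (z - q) hz.
  rewrite addrC subrK; apply=> u hu; last by apply: he; rewrite addrAC subrr add0r.
  have [|l hl] := df (q + u).
    by have := normcD u (q - p); rewrite addrA [u + q]addrC /rho in hu *; lra.
  exists l => e' /hl[d' d'0 hd']; exists d' => // v hv.
  have E : q + v - (q + u) = v - u by rewrite opprD addrACA subrr add0r.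
  by have := hd' (q + v); rewrite E; apply.
have [N hN] : exists N : nat, normc (w - p) < rho / 20 * N.+1%:R.
  exists (Num.bound (normc (w - p) / (rho / 20))).
  rewrite mulrC -ltr_pdivrMr ?divr_gt0 //.
  apply: lt_trans (archi_boundP _) _; first by rewrite divr_ge0 ?normc_ge0 // divr_ge0 // ltW.
  by rewrite ltr_nat.
pose q (k : nat) : C := p + (k%:R / N.+1%:R)%:C * (w - p).
have qn k : normc (q k - p) = k%:R / N.+1%:R * normc (w - p).
  by rewrite /q addrAC subrr add0r normcM normc_real // divr_ge0.
have Zq k : (k <= N.+1)%N -> Z (q k).
  elim: k => [_|k IH kN].
    by exists d => // z hz; apply: f0; move: hz; rewrite /q mul0r rmorph0 mul0r addr0.
  have hk : normc (q k - p) <= normc (w - p).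
    rewrite qn ler_piMl ?normc_ge0 // ler_pdivrMr ?ltr0n // mul1r ler_nat; exact: ltnW.
  have := loc _ hk (IH (ltnW kN)).
  have st : normc (q k.+1 - q k) < rho / 20.
    have -> : q k.+1 - q k = (N.+1%:R^-1)%:C * (w - p).
      rewrite /q opprD addrACA subrr add0r -mulrBl -rmorphB -mulrBl -natrB //.
      by rewrite subSnn mul1r.
    rewrite normcM normc_real ?invr_ge0 // mulrC ltr_pdivrMr ?ltr0n //.
  move=> hz; exists (rho / 20 - normc (q k.+1 - q k)); first by rewrite subr_gt0.
  move=> z hzq; apply: hz; have := normcD (z - q k.+1) (q k.+1 - q k).
  by rewrite addrA subrK; lra.
have [e e0 he] := Zq N.+1 (leqnn _).
have qw : q N.+1 = w by rewrite /q divff ?rmorph1 ?mul1r ?pnatr_eq0 // addrC subrK.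
by apply: he; rewrite qw subrr normc0.
Qed.

End IdentityTheorem.

(** * Splitting upper semi-Browder operators *)

Section UpperSemiBrowder.
Variables (R : realType) (X : completeNormedModType (Cplx R)).
Local Notation C := (Cplx R).
Implicit Types (x y z e : X) (M N W : set X) (s : seq X) (T : X -> X).

Lemma bnd_iter T K n : 0 < K -> bnd T K -> bnd (iter n T) (K ^+ n).
Proof.
move=> K0 bT; elim: n => [|n IH] x; first by rewrite expr0 mul1r.
by rewrite iterS exprS -mulrA; apply: le_trans (bT _) _; rewrite ler_wpM2l // ltW.
Qed.

Lemma spn_mem s e : e \in s -> spn s e.
Proof.
elim: s => // f s IH; rewrite inE => /orP[/eqP ->|/IH]; first exact: spn_cons_mem.
exact: spn_consr.
Qed.

Lemma spn_sub s (A : set X) : subspace A -> (forall e, e \in s -> A e) -> spn s `<=` A.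
Proof.
move=> sA; elim: s => [_ x /= ->|e s IH h]; first exact: subspace0.
apply: spn_cons_sub => //; first by apply: h; rewrite mem_head.
by apply: IH => f fs; apply: h; rewrite inE fs orbT.
Qed.

Lemma ker_iter_subspace T n : lin T -> subspace [set x | iter n T x = 0].
Proof.
move=> lT; split=> [|a x y /= hx hy] /=; first by rewrite (lin0 (lin_iter n lT)).
by rewrite (lin_iter n lT) hx hy scaler0 addr0.
Qed.

Definition invariant_split M T (M1 N1 : set X) :=
  [/\ closed_subspace M1, closed_subspace N1, invar T M1 & invar T N1] /\
  [/\ M1 `<=` M, N1 `<=` M, M1 `&` N1 = [set 0] &
      forall m, M m -> exists a b, [/\ M1 a, N1 b & m = a + b]].

(** * A Jordan chain and its invariant complement *)

Section JordanChain.
Variables (M : set X) (T : X -> X) (K : R) (p : nat) (x : X) (psi : X -> C) (D : R).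
Hypotheses (cM : closed_subspace M) (lT : lin T) (K0 : 0 < K) (bT : bnd T K) (iT : invar T M)
  (Mx : M x) (px : iter p.+1 T x = 0)
  (lpsi : forall (a : C) y z, psi (a *: y + z) = a * psi y + psi z)
  (D0 : 0 < D) (bpsi : forall y, normc (psi y) <= D * rnm y)
  (psi0 : forall m, M m -> psi (iter p.+1 T m) = 0) (psi1 : psi (iter p T x) = 1).

Let psi00 : psi 0 = 0.
Proof. by have := bpsi 0; rewrite rnm0 mulr0 => h; apply: eq0_normc; apply/eqP; rewrite eq_le h normc_ge0. Qed.

Let psiD y z : psi (y + z) = psi y + psi z.
Proof. by have := lpsi 1 y z; rewrite scale1r mul1r. Qed.

Let psiZ (a : C) y : psi (a *: y) = a * psi y.
Proof. by have := lpsi a y 0; rewrite !addr0 psi00 addr0. Qed.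

Let psiB y z : psi (y - z) = psi y - psi z.
Proof. by rewrite psiD -scaleN1r psiZ mulN1r. Qed.

Let chain0 n : (p < n)%N -> iter n T x = 0.
Proof. by move=> pn; rewrite -(subnK pn) iterD px (lin0 (lin_iter _ lT)). Qed.

Let psi_high n m : M m -> (p < n)%N -> psi (iter n T m) = 0.
Proof. by move=> Mm pn; rewrite -(subnKC pn) iterD psi0 //; exact: invar_iter. Qed.

(** The common kernel of the functionals [psi o T^j], which are dual to the chain: [psi (T^j T^k x)]
    is 0 for [j + k > p] and 1 for [j + k = p]. This triangular pairing gives both disjointness and
    decomposition. *)
Definition chain_compl : set X := [set m | M m /\ forall j, (j <= p)%N -> psi (iter j T m) = 0].
Definition chain_seq k n := [seq iter j T x | j <- iota k n].
Definition chain_span : set X := spn (chain_seq 0 p.+1).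

Let W := chain_compl.
Let Cyc := chain_span.

Lemma chain_compl_closed : closed_subspace W.
Proof.
split.
  split=> [|a y z [My hy] [Mz hz]].
    split=> [|j _]; first exact: subspace0 cM.1.
    by rewrite (lin0 (lin_iter j lT)).
  split=> [|j jp]; first by case: cM => -[_ h] _; exact: h.
  by rewrite (lin_iter j lT) lpsi hy // hz // mulr0 addr0.
apply/closed_rnm => m hm; split.
  by have /closed_rnm := cM.2; apply=> e /hm[y [My _] h]; exists y.
move=> j jp; apply: eq0_normc; apply/eqP; rewrite eq_le normc_ge0 andbT.
apply/ler_addgt0Pl => e e0; rewrite addr0.
have DK : 0 < D * K ^+ j by rewrite mulr_gt0 // exprn_gt0.
have [y [My hy] h] := hm _ (divr_gt0 e0 DK).
have -> : psi (iter j T m) = psi (iter j T (m - y)).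
  by rewrite (linB _ _ (lin_iter j lT)) psiB hy // subr0.
apply: le_trans (bpsi _) _.
apply: le_trans (ler_wpM2l (ltW D0) (bnd_iter j K0 bT (m - y))) _.
by rewrite mulrA mulrC -ler_pdivlMr // ltW.
Qed.

Lemma chain_compl_invar : invar T W.
Proof.
move=> m [Mm hm]; split; first exact: iT.
move=> j jp; rewrite -iterSr; have [jlt|jge] := ltnP j p; first exact: hm.
by apply: psi_high.
Qed.

Lemma chain_span_sub : Cyc `<=` M.
Proof. by apply: spn_sub cM.1 _ => _ /mapP[j _ ->]; exact: invar_iter. Qed.

Lemma chain_span_mem j : Cyc (iter j T x).
Proof.
have [jp|pj] := leqP j p; last by rewrite chain0 //; exact: subspace0 (spn_subspace _).
by apply: spn_mem; apply/mapP; exists j => //; rewrite mem_iota.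
Qed.

Lemma chain_span_invar : invar T Cyc.
Proof.
suff : Cyc `<=` [set y | Cyc (T y)] by [].
apply: spn_sub; last by move=> _ /mapP[j _ ->] /=; rewrite -iterS; exact: chain_span_mem.
split=> [|a y z /= hy hz] /=; first by rewrite (lin0 lT); exact: subspace0 (spn_subspace _).
by rewrite lT; case: (spn_subspace (chain_seq 0 p.+1)) => _; apply.
Qed.

Lemma chain_span_nil y : Cyc y -> iter p.+1 T y = 0.
Proof.
apply: (@spn_sub _ [set y | iter p.+1 T y = 0]); first exact: ker_iter_subspace.
by move=> _ /mapP[j _ ->] /=; rewrite -iterS -iterD chain0 // addSn ltnS leq_addr.
Qed.

Lemma chain_disjoint y : W y -> Cyc y -> y = 0.
Proof.
move=> [_ hy]; rewrite /Cyc /chain_span.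
suff h n : forall k, (k + n)%N = p.+1 -> spn (chain_seq k n) y -> y = 0 by exact: h.
elim: n => [k _ //|n IH k kn [c hc]].
have kp : (k <= p)%N by rewrite -ltnS -kn addnS ltnS leq_addr.
(* [T^(p-k)] kills all chain vectors beyond [T^k x], and applying [psi] then isolates the lowest
   coefficient [c]. *)
have hz : iter (p - k) T (y - c *: iter k T x) = 0.
  apply: (@spn_sub _ [set z | iter (p - k) T z = 0]) hc; first exact: ker_iter_subspace.
  move=> _ /mapP[j + ->] /=; rewrite mem_iota => /andP[kj _].
  by rewrite -iterD chain0 // -ltn_subLR ?subKn // leq_subr.
have c0 : c = 0.
  move/(congr1 psi): hz; rewrite psi00 (linB _ _ (lin_iter _ lT)) (linZ _ _ (lin_iter _ lT)).
  rewrite -iterD subnK // psiB psiZ psi1 mulr1 hy ?leq_subr // sub0r => /eqP.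
  by rewrite oppr_eq0 => /eqP.
apply: (IH k.+1); first by rewrite addSn -addnS.
by move: hc; rewrite c0 scale0r subr0.
Qed.

Lemma chain_decomp m : M m -> exists w c, [/\ W w, Cyc c & m = w + c].
Proof.
move=> Mm.
(* The triangular system is solved one condition at a time: adding [a T^i x] adjusts the condition
   at [p - i] and leaves those at [p - j], [j < i], alone because [T^(p-j+i) x = 0]. *)
have h i : (i <= p.+1)%N -> exists2 c, Cyc c & forall j, (j < i)%N -> psi (iter (p - j) T (m - c)) = 0.
  elim: i => [_|i IH ip]; first by exists 0 => //; exact: subspace0 (spn_subspace _).
  have [c Cc hc] := IH (ltnW ip).
  set a := psi (iter (p - i) T (m - c)).
  exists (c + a *: iter i T x).
    apply: subspaceD (spn_subspace _) Cc _; apply: subspaceZ (spn_subspace _) _.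
    exact: chain_span_mem.
  move=> j; rewrite ltnS leq_eqVlt opprD addrA => /orP[/eqP ->|ji].
    rewrite (linB _ _ (lin_iter _ lT)) (linZ _ _ (lin_iter _ lT)) -iterD subnK //.
    by rewrite psiB psiZ psi1 mulr1 subrr.
  rewrite (linB _ _ (lin_iter _ lT)) (linZ _ _ (lin_iter _ lT)) -iterD chain0.
    by rewrite scaler0 subr0 hc.
  by rewrite -{1}(subnK (leq_trans (ltnW ji) ip)) ltn_add2l.
have [c Cc hc] := h _ (leqnn _); exists (m - c), c; rewrite subrK; split=> //.
split=> [|j jp]; first by apply: subspaceB cM.1 Mm _; exact: chain_span_sub.
by rewrite -(subKn jp); apply: hc; rewrite ltnS leq_subr.
Qed.

End JordanChain.

Lemma usb_split n M s T K : closed_subspace M -> lin T -> 0 < K -> bnd T K -> invar T M ->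
  size s = n -> kerM M T `<=` spn s -> closed (ranM M T) -> finite_ascent_on M T ->
  exists M1 N1, [/\ invariant_split M T M1 N1, finite_dim N1,
    exists q, forall y, N1 y -> iter q T y = 0 & bounded_below_on M1 T].
Proof.
elim: n M s => [|n IH] M s cM lT K0 bT iT sz hs cr fa;
  (have [k0|/existsNP[e0 /not_implyP[ke0 e0n]]] := pselect (kerM M T `<=` [set 0]);
   [exists M, [set 0]; split|]).
- split; split=> //; [exact: closed_subspace0|by move=> _ /= ->; rewrite (lin0 lT)| | |].
  + by move=> _ /= ->; exact: subspace0 cM.1.
  + by apply/seteqP; split=> [y []//|_ ->]; split=> //; exact: subspace0 cM.1.
  + by move=> m Mm; exists m, 0; split=> //; rewrite addr0.
- exact: finite_dim0.
- by exists 0%N.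
- split=> //; apply/seteqP; split=> // _ ->; split; [exact: subspace0 cM.1|exact: lin0].
- by case: e0n; move: (hs _ ke0); case: s sz {hs}.
- split; split=> //; [exact: closed_subspace0|by move=> _ /= ->; rewrite (lin0 lT)| | |].
  + by move=> _ /= ->; exact: subspace0 cM.1.
  + by apply/seteqP; split=> [y []//|_ ->]; split=> //; exact: subspace0 cM.1.
  + by move=> m Mm; exists m, 0; split=> //; rewrite addr0.
- exact: finite_dim0.
- by exists 0%N.
- split=> //; apply/seteqP; split=> // _ ->; split; [exact: subspace0 cM.1|exact: lin0].
have kle j : kerM M (iter j T) `<=` kerM M (iter j.+1 T).
  by move=> y [My hy]; split=> //; rewrite iterS hy (lin0 lT).
(* The ascent is [p.+1]: it is positive because the kernel is nonzero, and its minimality gives a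
   longest chain, ending in the nonzero kernel vector [T^p x]. *)
have [p hp [x Mx [px xn]]] : exists2 p, kerM M (iter p.+1 T) = kerM M (iter p.+2 T) &
    exists2 x, M x & iter p.+1 T x = 0 /\ iter p T x <> 0.
  have fa' : exists p, `[< kerM M (iter p T) = kerM M (iter p.+1 T) >].
    by case: fa => p hp; exists p; apply/asboolP.
  case: (ex_minnP fa') => -[|p] /asboolP hp hmin.
    by case: e0n; move: ke0; rewrite -[kerM M T]/(kerM M (iter 1 T)) -hp => -[].
  exists p => //; apply: contrapT => hno.
  suff : (p.+1 <= p)%N by rewrite ltnn.
  apply: hmin; apply/asboolP/seteqP; split; first exact: kle.
  move=> y [My hy]; split=> //; apply: contrapT => hn; apply: hno.
  by exists y.
have fk : finite_dim (kerM M T) by apply/finite_dimP; exists s.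
pose e := iter p T x.
have cL : closed_subspace (ranM M (iter p.+1 T)).
  by split; [exact: ran_iter_subspace|exact: (usf_ran_iter_closed cM lT K0 bT iT cr)].
(* If [T^p x = T^(p+1) m], then [T^(p+2) m = 0], hence [T^(p+1) m = 0] by the ascent, against
   [T^p x <> 0]. *)
have nLe : ~ ranM M (iter p.+1 T) e.
  move=> [m Mm me]; apply: xn; rewrite -/e -me.
  suff : kerM M (iter p.+1 T) m by case.
  by rewrite hp; split=> //; rewrite iterS me /e -iterS.
have [psi [lpsi [D D0 bpsi] pL p1]] := hahn_banach cL nLe.
have pM m : M m -> psi (iter p.+1 T m) = 0 by move=> Mm; apply: pL; exists m.
set W := chain_compl M T p psi; set Cyc := chain_span T p x.
have cW : closed_subspace W by exact: (chain_compl_closed p cM lT K0 bT lpsi D0 bpsi).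
have iW : invar T W by exact: (chain_compl_invar iT pM).
have WM : W `<=` M by move=> y [].
have CM : Cyc `<=` M by exact: chain_span_sub.
have iC : invar T Cyc by exact: chain_span_invar.
have WC y : W y -> Cyc y -> y = 0 by exact: (chain_disjoint lT px lpsi bpsi p1).
have dec m : M m -> exists w c, [/\ W w, Cyc c & m = w + c] by exact: chain_decomp.
have ke : kerM M T e by split; [exact: invar_iter|rewrite /e -iterS].
have en : e <> 0 by exact: xn.
have [s' hs' ss'] := spn_exchange (hs _ ke) en.
(* [Pf] kills [e] and fixes the kernel of [psi], which contains [W]. So the kernel of [T] on [W] is
   spanned by the images of [s'], one vector fewer than before. *)
pose Pf y := y - psi y *: e.
have lPf : lin Pf.
  move=> a y z; rewrite /Pf lpsi scalerDl opprD addrACA -scalerA -scalerBr.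
  by [].
have kW : kerM W T `<=` spn (map Pf s').
  move=> y [Wy Ty]; have [c hc] := hs' _ (hs _ (conj (WM _ Wy) Ty)).
  have py : psi y = 0 by have := Wy.2 0%N isT.
  have := spn_map lPf hc; rewrite (linB _ _ lPf) (linZ _ _ lPf) /Pf p1 py.
  by rewrite scale1r subrr scaler0 scale0r !subr0.
(* If [T (w + c)] is in [W], then [T c] lies in [W] and in the chain span, so it is zero. Hence the
   range on [W] is an intersection of closed sets. *)
have rW : ranM W T = ranM M T `&` W.
  apply/seteqP; split=> [_ [y Wy <-]|_ [[m Mm <-] Wm]].
    by split; [exists y => //; exact: WM|exact: iW].
  have [w [c [Ww Cc mE]]] := dec m Mm; exists w => //.
  have Tc : T c = T m - T w by rewrite mE (linD _ _ lT) addrC addKr.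
  have T0 : T c = 0.
    by apply: WC; [rewrite Tc; apply: subspaceB cW.1 Wm _; exact: iW|exact: iC].
  by apply/eqP; rewrite eq_sym -subr_eq0 -Tc T0.
have crW : closed (ranM W T) by rewrite rW; apply: closedI => //; case: cW.
have faW : finite_ascent_on W T.
  exists p.+1; apply/seteqP; split=> y [Wy hy]; split=> //.
    by rewrite iterS hy (lin0 lT).
  suff : kerM M (iter p.+1 T) y by case.
  by rewrite hp; split=> //; exact: WM.
have sz' : size (map Pf s') = n by rewrite size_map; move: ss'; rewrite sz => -[].
have [M1 [N1 [[[cM1 cN1 iM1 iN1] [M1W N1W MN dW]] fN1 [q hq] bb]]] :=
  IH W _ cW lT K0 bT iW sz' kW crW faW.
pose N2 : set X := [set z | exists2 m, N1 m & Cyc (z - m)].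
have N2M : N2 `<=` M.
  move=> z [m N1m Cz]; rewrite -(subrK m z); apply: subspaceD cM.1 (CM _ Cz) _.
  by apply: WM; exact: N1W.
exists M1, N2; split=> //.
- split; split=> //; first exact: closed_spn_add.
  + move=> z [m N1m Cz]; exists (T m); first exact: iN1.
    by rewrite -(linB _ _ lT); exact: iC.
  + by move=> y /M1W/WM.
  + apply/seteqP; split=> [z [M1z [m N1m Cz]]|_ ->].
      have zm : z - m = 0.
        by apply: WC => //; apply: subspaceB cW.1 (M1W _ M1z) (N1W _ N1m).
      have zE : z = m by apply/eqP; rewrite -subr_eq0 zm.
      by rewrite -MN; split=> //; rewrite zE.
    split; first exact: subspace0 cM1.1.
    exists 0; first exact: subspace0 cN1.1.
    by rewrite subrr; exact: subspace0 (spn_subspace _).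
  + move=> m Mm; have [w [c [Ww Cc ->]]] := dec m Mm.
    have [a [b [M1a N1b ->]]] := dW w Ww.
    exists a, (b + c); split; rewrite ?addrA //.
    by exists b => //; rewrite addrC addKr.
- apply: (@finite_dimS _ _ _ [set z | exists y y', [/\ N1 y, Cyc y' & z = y + y']]).
    by move=> z [m N1m Cz]; exists m, (z - m); split=> //; rewrite addrC subrK.
  apply: finite_dimD => //; apply/finite_dimP; exists (chain_seq T x 0 p.+1).
  by [].
- exists (p.+1 + q)%N => z [m N1m Cz].
  have l0 k := lin0 (lin_iter k lT).
  have h1 : iter (p.+1 + q) T m = 0 by rewrite iterD (hq _ N1m) l0.
  have h2 : iter (p.+1 + q) T (z - m) = 0.
    by rewrite addnC iterD (chain_span_nil lT px Cz) l0.
  by rewrite -(subrK m z) (linD _ _ (lin_iter _ lT)) h1 h2 addr0.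
Qed.

End UpperSemiBrowder.

(** * Direct sums *)

Section DirectSums.
Variables (R : realType) (X : completeNormedModType (Cplx R)).
Local Notation C := (Cplx R).
Implicit Types (x y z e : X) (M N W A B : set X) (S T P : X -> X).

Lemma preimage_closed P D A : lin P -> bnd P D -> closed A -> closed [set x | A (P x)].
Proof. by move=> lP bP cA; have [_ /continuous_closedP h] := bnd_bounded_op lP bP; exact: h. Qed.

Lemma lower_bound_closed_range M S K D : closed_subspace M -> lin S -> 0 < K -> bnd S K ->
  0 < D -> (forall x, M x -> rnm x <= D * rnm (S x)) -> bounded_below_on M S.
Proof.
move=> cM lS K0 bS D0 h; split.
  apply/seteqP; split=> [x [Mx Sx]|_ ->]; last by split; [exact: subspace0 cM.1|exact: lin0].
  apply: rnm_eq0; apply/eqP; rewrite eq_le rnm_ge0 andbT.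
  by have := h x Mx; rewrite Sx rnm0 mulr0.
apply/closed_rnm => y hy.
have [u hu] : exists u : nat -> X, forall n, M (u n) /\ rnm (y - S (u n)) < 2^-1 ^+ n.
  have /choice[u hu] : forall n : nat, exists x, M x /\ rnm (y - S x) < 2^-1 ^+ n.
    by move=> n; have [|_ [x Mx <-] hx] := hy (2^-1 ^+ n); [rewrite exprn_gt0|exists x].
  by exists u.
have tSu : tends (fun n => S (u n)) y.
  move=> e e0; have [N hN] := @expr_small R 2^-1 e (ltac:(lra)) (ltac:(lra)) e0.
  by exists N => n /hN h1; rewrite rnmBC; apply: lt_trans h1; case: (hu n).
have [|l hl] := @cauchy_tends _ _ u.
  move=> e e0; have [N hN] := tSu (e / (2 * D)) (ltac:(by rewrite divr_gt0 // mulr_gt0)).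
  exists N => m n /hN hm /hN hn.
  have := h (u m - u n) (subspaceB cM.1 (hu m).1 (hu n).1); rewrite (linB _ _ lS) => h1.
  apply: le_lt_trans h1 _; rewrite mulrC -ltr_pdivlMr //.
  have := rnmB_trans (S (u m)) y (S (u n)); rewrite (rnmBC y (S (u n))).
  have -> : e / D = e / (2 * D) + e / (2 * D) by field; rewrite gt_eqF.
  lra.
exists l; first by apply: closed_tends cM.2 _ hl => n; case: (hu n).
exact: tends_unique (bnd_tends lS K0 bS hl) tSu.
Qed.

(** From [|x| <= D |T x| <= D |(T - l) x| + D |l| |x|] and [D |l| < 1 / 2] follows
    [|x| <= 2 D |(T - l) x|]. *)
Lemma bounded_below_perturb M T K : closed_subspace M -> lin T -> 0 < K -> bnd T K ->
  bounded_below_on M T ->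
  exists2 d : R, 0 < d & forall l : C, normc l < d -> bounded_below_on M (shift T l).
Proof.
move=> cM lT K0 bT [k0 cr].
have [D D0 hD] := closed_range_preim cM lT K0 bT cr.
have lb x : M x -> rnm x <= D * rnm (T x).
  move=> Mx; have [y [My Ty ry]] := hD (T x) (ex_intro2 _ _ x Mx erefl).
  suff -> : x = y by rewrite Ty in ry *.
  have : kerM M T (x - y).
    by split; [exact: subspaceB cM.1 Mx My|rewrite (linB _ _ lT) Ty subrr].
  by rewrite k0 /= => /eqP; rewrite subr_eq0 => /eqP.
exists (1 / (2 * D)); first by rewrite divr_gt0 // mulr_gt0.
move=> l; rewrite ltr_pdivlMr ?mulr_gt0 // => hl.
apply: (@lower_bound_closed_range M _ (K + normc l) (2 * D) cM (lin_shift l lT)).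
- by rewrite ltr_pwDl // normc_ge0.
- exact: bnd_shift.
- by rewrite mulr_gt0.
move=> x Mx; have := lb x Mx.
have -> : T x = shift T l x + l *: x by rewrite /shift subrK.
have := rnmD (shift T l x) (l *: x); rewrite rnmZ => h1 h2.
have h3 : D * rnm (shift T l x + l *: x) <= D * (rnm (shift T l x) + normc l * rnm x).
  by rewrite ler_wpM2l // ltW.
have := rnm_ge0 x; set r := rnm x in h1 h2 h3 * => r0.
have : normc l * (2 * D) * r <= 1 * r by rewrite ler_wpM2r // ltW.
lra.
Qed.

Lemma eq_on_iter M S T n x : invar T M -> (forall x, M x -> S x = T x) -> M x ->
  iter n S x = iter n T x.
Proof.
by move=> iT h Mx; elim: n => //= n ->; apply: h; exact: invar_iter.
Qed.

Lemma eq_on_ker M S T : (forall x, M x -> S x = T x) -> kerM M S = kerM M T.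
Proof. by move=> h; apply/seteqP; split=> x [Mx]; rewrite ?h // -?h. Qed.

Lemma eq_on_ran M S T : (forall x, M x -> S x = T x) -> ranM M S = ranM M T.
Proof.
by move=> h; apply/seteqP; split=> _ [x Mx <-]; exists x => //; rewrite h.
Qed.

Lemma eq_on_usb M S T : invar T M -> (forall x, M x -> S x = T x) ->
  upper_semi_browder_on M T -> upper_semi_browder_on M S.
Proof.
move=> iT h [[fk cr] [p hp]]; split; first by split; rewrite ?(eq_on_ker h) ?(eq_on_ran h).
by exists p; rewrite !(eq_on_ker (fun x Mx => eq_on_iter _ iT h Mx)).
Qed.

Lemma bounded_below_usb M S : lin S -> bounded_below_on M S -> upper_semi_browder_on M S.
Proof.
move=> lS [k0 cr]; split; first by split=> //; rewrite k0; exact: finite_dim0.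
exists 0%N; rewrite -[iter 1 S]/S k0; apply/seteqP; split=> [x []//|_ ->].
by have [] : kerM M S 0 by rewrite k0.
Qed.

Lemma ascent_sub A M S : A `<=` M -> finite_ascent_on M S -> finite_ascent_on A S.
Proof.
move=> AM [p hp]; exists p; apply/seteqP; split=> x [Ax hx]; split=> //.
  by have : kerM M (iter p S) x by [split=> //; exact: AM]; rewrite hp => -[].
by have : kerM M (iter p.+1 S) x by [split=> //; exact: AM]; rewrite -hp => -[].
Qed.

(** [P] has range [N] and kernel [M], so [x - P x] is the [M]-component throughout. *)
Lemma projection_exists M N : closed_subspace M -> closed_subspace N -> direct_sum M N ->
  exists P, [/\ lin P, exists2 D : R, 0 < D & bnd P D,
    forall x, N (P x) /\ M (x - P x), forall x, M x -> P x = 0 & forall x, N x -> P x = x].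
Proof.
move=> cM cN ds; have [D D0 hD] := direct_sum_bound cM cN ds.
have [MN MNT] := ds.
have [P hP] : {P : X -> X & forall x, N (P x) /\ M (x - P x)}.
  apply: (@choice _ _ (fun x n => N n /\ M (x - n))) => x.
  by have [m [n [Mm Nn ->]]] := MNT x; exists n; rewrite addrK.
have uniq x m n : M m -> N n -> x = m + n -> P x = n.
  move=> Mm Nn E; have [Nx Mx] := hP x.
  by case: (direct_sum_uniq cM.1 cN.1 MN Mx Nx Mm Nn _) => //; rewrite subrK.
exists P; split=> //.
- move=> a x y; have [Nx Mx] := hP x; have [Ny My] := hP y.
  apply: (uniq _ (a *: (x - P x) + (y - P y))).
  + by case: cM => -[_ h] _; exact: h.
  + by case: cN => -[_ h] _; exact: h.
  + by rewrite addrACA -scalerDr !subrK.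
- exists D => // x; have [Nx Mx] := hP x.
  by have [_] := hD _ _ Mx Nx; rewrite subrK.
- by move=> x Mx; apply: (uniq _ x) => //; [exact: subspace0 cN.1|rewrite addr0].
- by move=> x Nx; apply: (uniq _ 0) => //; [exact: subspace0 cM.1|rewrite add0r].
Qed.

(** * Operators reduced by a direct sum *)

Section Sum.
Variables (M N : set X) (P : X -> X) (D : R).
Hypotheses (cM : closed_subspace M) (cN : closed_subspace N)
  (MN : M `&` N = [set 0]) (lP : lin P) (bP : bnd P D)
  (hP : forall x, N (P x) /\ M (x - P x)) (PM : forall x, M x -> P x = 0)
  (PN : forall x, N x -> P x = x).

Lemma proj_compl_lin : lin (fun x => x - P x).
Proof. by move=> a x y; rewrite lP opprD addrACA scalerBr. Qed.

Lemma proj_compl_bnd : bnd (fun x => x - P x) (1 + D).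
Proof. by move=> x; rewrite mulrDl mul1r; apply: le_trans (rnmB _ _) _; rewrite lerD2l. Qed.

Lemma closed_components A B : closed A -> closed B ->
  closed [set x | A (x - P x) /\ B (P x)].
Proof.
move=> cA cB; apply: closedI.
  exact: (preimage_closed proj_compl_lin proj_compl_bnd cA).
exact: (preimage_closed lP bP cB).
Qed.

Lemma proj_sum m n : M m -> N n -> P (m + n) = n.
Proof. by move=> Mm Nn; rewrite (linD _ _ lP) PM // PN // add0r. Qed.

Section Op.
Variables (S : X -> X).
Hypotheses (lS : lin S) (SM : invar S M) (SN : invar S N).

Lemma proj_commute x : P (S x) = S (P x).
Proof.
have [Nx Mx] := hP x; rewrite -{1}(subrK (P x) x) (linD _ _ lS).
by apply: proj_sum; [exact: SM|exact: SN].
Qed.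

Lemma ker_components x : S x = 0 -> S (x - P x) = 0 /\ S (P x) = 0.
Proof.
move=> Sx; have E : S (P x) = 0 by rewrite -proj_commute Sx (lin0 lP).
by rewrite (linB _ _ lS) Sx E subrr.
Qed.

Lemma ran_components : ranM setT S = [set x | ranM M S (x - P x) /\ ranM N S (P x)].
Proof.
apply/seteqP; split=> [_ [x _ <-]|x [[m Mm hm] [n Nn hn]]].
  have [Nx Mx] := hP x; rewrite /= proj_commute -(linB _ _ lS).
  by split; [exists (x - P x)|exists (P x)].
by exists (m + n) => //; rewrite (linD _ _ lS) hm hn subrK.
Qed.

Lemma ran_closed_sum : closed (ranM M S) -> closed (ranM N S) -> closed (ranM setT S).
Proof. by move=> cA cB; rewrite ran_components; exact: closed_components. Qed.

Lemma ker_inj_sum x : kerM M S = [set 0] -> S x = 0 -> N x.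
Proof.
move=> k0 /ker_components[h _]; have [Nx Mx] := hP x.
have : kerM M S (x - P x) by [].
by rewrite k0 /= => /eqP; rewrite subr_eq0 => /eqP ->.
Qed.

Lemma bounded_below_sum : bounded_below_on M S -> bounded_below_on N S ->
  bounded_below_on setT S.
Proof.
move=> [kM cA] [kN cB]; split; last exact: ran_closed_sum.
apply/seteqP; split=> [x [_ Sx]|_ ->]; last by split=> //; exact: lin0.
by rewrite -kN; split=> //; exact: ker_inj_sum kM Sx.
Qed.

Lemma usb_sum : bounded_below_on M S -> upper_semi_browder_on N S ->
  upper_semi_browder_on setT S.
Proof.
move=> [kM cA] [[fk cB] [p hp]]; split; first split.
- by apply: finite_dimS fk => x [_ Sx]; split=> //; exact: ker_inj_sum kM Sx.
- exact: ran_closed_sum.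
exists p; apply/seteqP; split=> x [_ hx]; split=> //; first by rewrite iterS hx (lin0 lS).
(* Injectivity on [M] forces every vector killed by a power of [S] into [N], where the ascent is
   known. *)
have Nx : N x.
  elim: (p.+1) {hp} x hx => [x /= ->|n IH x]; first exact: subspace0 cN.1.
  rewrite iterSr => /IH NSx; have [Nx Mx] := hP x.
  have : kerM M S (x - P x).
    split=> //; rewrite (linB _ _ lS) -proj_commute PN ?subrr //.
  by rewrite kM /= => /eqP; rewrite subr_eq0 => /eqP ->.
by have : kerM N (iter p.+1 S) x by []; rewrite -hp => -[].
Qed.

End Op.
End Sum.

End DirectSums.

(** * The implications *)

Section Implications.
Variables (R : realType) (X : completeNormedModType (Cplx R)) (T : X -> X).
Hypothesis hT : bounded_op T.
Local Notation C := (Cplx R).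
Implicit Types (x y z e : X) (M N W A B : set X) (S P : X -> X).

Let lT : lin T. Proof. by case: (bounded_op_bnd hT). Qed.

Definition decomposition (PM PN : set X -> Prop) := exists M N : set X,
  [/\ closed_subspace M, closed_subspace N, op_invariant T M, op_invariant T N & direct_sum M N] /\
  PM M /\ PN N.

Let cond_i := decomposition (fun M => bounded_below_on M T) (fun N => riesz_on N T).
Let cond_iv := decomposition (fun M => upper_semi_browder_on M T) (fun N => riesz_on N T).
Let cond_vii := exists P : X -> X, [/\ projection P, P \o T = T \o P,
               upper_semi_browder_on setT (T \+ P) & riesz_on setT (T \o P)].

Lemma i_GKRD : cond_i -> GKRD T.
Proof.
move=> [M [N [hMN [[k0 cr] rN]]]]; exists M, N; split=> //; split=> //; split=> // n x.
rewrite k0 => ->; exists 0; first by case: hMN => -[sM _] *; exact: subspace0 sM.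
exact: lin0 (lin_iter n lT).
Qed.

Lemma i_iv : cond_i -> cond_iv.
Proof.
move=> [M [N [hMN [bb rN]]]]; exists M, N; split=> //; split=> //.
exact: bounded_below_usb.
Qed.

Lemma i_shift_usb : cond_i -> exists2 d : R, 0 < d & forall l : C, l != 0 -> normc l < d ->
  upper_semi_browder_on setT (shift T l).
Proof.
move=> [M [N [[cM cN /op_invariantP iM /op_invariantP iN ds] [bb rN]]]].
have [_ [K K0 bT]] := bounded_op_bnd hT.
have [P [lP [D D0 bP] hP PM PN]] := projection_exists cM cN ds.
have [d d0 hd] := bounded_below_perturb cM lT K0 bT bb.
exists d => // l l0 hl; have sM := invar_shift l cM.1 iM; have sN := invar_shift l cN.1 iN.
apply: (usb_sum cN lP bP hP PM PN (lin_shift l lT) sM sN (hd l hl)).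
have [fa _] := riesz_discrete cN lT K0 bT iN rN l0.
by have [fk cr _] := rN l l0.
Qed.

(** [riesz_discrete] controls punctured discs about nonzero points only. So first a small [l1 <> 0]
    is taken, then [l] so close to [l1] that it remains small and nonzero. *)
Lemma i_shift_bounded_below : cond_i -> forall e : R, 0 < e -> exists l : C, normc l < e /\
  bounded_below_on setT (shift T l).
Proof.
move=> [M [N [[cM cN /op_invariantP iM /op_invariantP iN ds] [bb rN]]]] e e0.
have [_ [K K0 bT]] := bounded_op_bnd hT.
have [P [lP [D D0 bP] hP PM PN]] := projection_exists cM cN ds.
have [d d0 hd] := bounded_below_perturb cM lT K0 bT bb.
have m0 : 0 < Num.min d e by rewrite lt_min d0.
have [l1 [l10 hl1]] := @cplx_near R 0 _ m0; rewrite subr0 in hl1.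
have [_ [d1 d10 hd1]] := riesz_discrete cN lT K0 bT iN rN l10.
have m1 : 0 < Num.min d1 (Num.min (Num.min d e - normc l1) (normc l1)).
  by rewrite !lt_min d10 subr_gt0 normc_gt0 // andbT; move: hl1; rewrite lt_min.
have [l [ll1]] := @cplx_near R l1 _ m1.
rewrite !lt_min => /and3P[h1 h2 h3].
have hl : normc l < Num.min d e by have := normcD (l - l1) l1; rewrite subrK; lra.
have l0 : l != 0 by apply/eqP => l0; move: h3; rewrite l0 sub0r normcN ltxx.
move: hl; rewrite lt_min => /andP[hld hle]; exists l; split=> //.
have sM := invar_shift l cM.1 iM; have sN := invar_shift l cN.1 iN.
apply: (bounded_below_sum lP bP hP PM PN (lin_shift l lT) sM sN (hd l hld)).
have [_ cr _] := rN l l0; split=> //; apply/seteqP; split=> [x [Nx hx]|_ ->].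
  exact: hd1 hx.
by split; [exact: subspace0 cN.1|exact: lin0 (lin_shift l lT)].
Qed.

Lemma i_ii : cond_i -> ~ interior (ap_spectrum T) 0.
Proof.
move=> hi /nbhs_normc[e e0 he]; have [l [hl bb]] := i_shift_bounded_below hi e0.
by apply: (he l); rewrite ?subr0.
Qed.

Lemma i_v : cond_i -> ~ limit_point (usb_spectrum T) 0.
Proof.
move=> hi hlim; have [d d0 hd] := i_shift_usb hi.
have [|y [y0 hy yd]] := hlim [set l | normc l < d].
  by apply/nbhs_normc; exists d => // w; rewrite subr0.
by apply: hy; apply: hd.
Qed.

Lemma limit_point_interior (A : set C) : interior A 0 -> limit_point A 0.
Proof.
move=> /nbhs_normc[d d0 hd] U /nbhs_normc[e e0 he].
have m0 : 0 < Num.min d e by rewrite lt_min d0.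
have [l [l0]] := @cplx_near R 0 _ m0; rewrite lt_min => /andP[h1 h2].
by exists l; split=> //; [exact: hd|exact: he].
Qed.

(** The identity theorem is used twice: from a small disc about [l], where [T - u] is injective, to
    the disc of radius [e - |l|] about [l]. As [|l| < e / 4], that disc contains a disc about 0,
    from which the whole domain is reached. *)
Lemma i_iii : cond_i -> SVEP_at T 0.
Proof.
move=> hi r r0 f df hf z hz.
have [e rE ze] := ball_normc hz.
have e0 : 0 < e by apply: le_lt_trans ze; rewrite normc_ge0.
have [_ [K K0 bT]] := bounded_op_bnd hT.
have [l [hl bb]] := i_shift_bounded_below hi (divr_gt0 e0 (ltr0n R 4)).
have Kl : 0 < K + normc l by rewrite ltr_pwDl // normc_ge0.
have cT : closed_subspace [set: X] by split; [split|exact: closedT].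
have [d d0 hd] := bounded_below_perturb cT (lin_shift l lT) Kl (bnd_shift l bT) bb.
have dfz w : normc w < e -> diff_at f w.
  by move=> hw; apply/derivable_rnm; apply: df; rewrite rE; apply/normc_ball.
have sfz w : normc w < e -> shift T w (f w) = 0.
  by move=> hw; apply: hf; rewrite rE; apply/normc_ball.
have f1 w : normc (w - l) < e - normc l -> f w = 0.
  have in_e u : normc (u - l) < e - normc l -> normc u < e.
    by move=> hu; have := normcD (u - l) l; rewrite subrK; lra.
  have m0 : 0 < Num.min d (e - normc l) by rewrite lt_min d0 subr_gt0; lra.
  apply: (@identity_theorem _ _ f l _ _ m0) => [u hu|u].
    by apply: dfz; exact: in_e.
  rewrite lt_min => /andP[ud ue]; have [k0 _] := hd _ ud.
  have : kerM setT (shift (shift T l) (u - l)) (f u).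
    by split=> //; rewrite shiftD addrC subrK; apply: sfz; exact: in_e.
  by rewrite k0.
have e2 : 0 < e / 2 by lra.
apply: (@identity_theorem _ _ f 0 e _ e2) => [u|u|]; rewrite subr0 //.
  exact: dfz.
move=> hu; apply: f1; have := normcD u (- l); rewrite normcN; lra.
Qed.

Lemma GKRD_i : GKRD T -> (forall M, closed_subspace M -> invar T M -> kato_on M T ->
  (exists2 x, kerM M T x & x <> 0) -> False) -> cond_i.
Proof.
move=> [M [N [hMN [kM rN]]]] h; exists M, N; split=> //; split=> //.
case: hMN => cM _ /op_invariantP iM _ _; case: (kM) => cr _; split=> //.
apply/seteqP; split=> [x kx|_ ->]; last by split; [exact: subspace0 cM.1|exact: lin0].
by apply: contrapT => x0; apply: (h M cM iM kM); exists x.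
Qed.

Lemma ii_i : GKRD T -> ~ interior (ap_spectrum T) 0 -> cond_i.
Proof.
move=> hG hn; apply: GKRD_i hG _ => M cM iM kM hx; apply: hn.
have [_ [K K0 bT]] := bounded_op_bnd hT.
have [d d0 hd] := kato_perturb cM lT K0 bT iM kM hx.
apply/nbhs_normc; exists d => // l; rewrite subr0 => /hd[[x [_ x0 hlx]] _] [k0 _].
apply: x0; have : kerM setT (shift T l) x by [].
by rewrite k0.
Qed.

Lemma vi_i : GKRD T -> ~ interior (usb_spectrum T) 0 -> cond_i.
Proof.
move=> hG hn; apply: GKRD_i hG _ => M cM iM kM hx; apply: hn.
have [_ [K K0 bT]] := bounded_op_bnd hT.
have [d d0 hd] := kato_perturb cM lT K0 bT iM kM hx.
apply/nbhs_normc; exists d => // l; rewrite subr0 => /hd[_ nfa] [_ fa].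
by apply: nfa; apply: ascent_sub fa.
Qed.

Lemma iii_i : GKRD T -> SVEP_at T 0 -> cond_i.
Proof.
move=> hG hs; apply: GKRD_i hG _ => M cM iM kM [x0 kx x0n]; apply: x0n.
have [_ [K K0 bT]] := bounded_op_bnd hT.
have [r r0 [f [f0 df sf]]] := kato_eigenfunction cM lT K0 bT iM kM kx.
rewrite -f0; apply: (hs (real_complex R r)).
- by rewrite ltcR.
- by move=> z /normc_ball; exact: df.
- by move=> z /normc_ball; exact: sf.
- by apply/normc_ball; rewrite normc0.
Qed.

(** If [(T - l) x = T y], then [(T - l) (x - y) = l y]; replacing [y] by [T y] lowers the nilpotency
    order. *)
Lemma nilpotent_shift_surj A (l : C) q : subspace A -> invar T A -> l != 0 ->
  forall y, A y -> iter q T y = 0 -> exists2 x, A x & shift T l x = y.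
Proof.
move=> sA iA l0; elim: q => [|q IH] y Ay hy.
  by exists 0; [exact: subspace0|rewrite -[y]/(iter 0 T y) hy; exact: lin0 (lin_shift l lT)].
have [|x Ax hx] := IH (T y) (iA _ Ay); first by rewrite -iterSr.
exists (l^-1 *: (x - y)); first by apply: subspaceZ => //; exact: subspaceB.
rewrite (linZ _ _ (lin_shift l lT)) (linB _ _ (lin_shift l lT)) hx /shift.
by rewrite opprB addrC subrK scalerA mulVf // scale1r.
Qed.

(** The set is [N1 + N], written through the [M]-component so that closedness and components come
    from [P]. As [T - l] is bijective on [N1], the Fredholm data are those on [N]. *)
Lemma riesz_nilpotent_sum M N P D N1 q : closed_subspace M -> closed_subspace N ->
  lin P -> bnd P D -> (forall x, N (P x) /\ M (x - P x)) ->
  (forall x, M x -> P x = 0) -> (forall x, N x -> P x = x) ->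
  invar T M -> invar T N -> closed_subspace N1 -> N1 `<=` M -> invar T N1 ->
  (forall y, N1 y -> iter q T y = 0) ->
  riesz_on N T -> riesz_on [set x | N1 (x - P x)] T.
Proof.
move=> cM cN lP bP hP PM PN iM iN cN1 N1M iN1 nil rN l l0.
have [fk cr [F [fF FN hF]]] := rN l l0.
have lL := lin_shift l lT; have sM := invar_shift l cM.1 iM; have sN := invar_shift l cN.1 iN.
have sN1 := invar_shift l cN1.1 iN1.
have N1N' y : N1 y -> N1 (y - P y) by move=> N1y; rewrite PM ?subr0 //; exact: N1M.
have NN' y : N y -> N1 (y - P y) by move=> Ny; rewrite PN // subrr; exact: subspace0 cN1.1.
have sN' : subspace [set x | N1 (x - P x)].
  split=> [|a x y /= hx hy]; first by rewrite /= (lin0 lP) subr0; exact: subspace0 cN1.1.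
  by rewrite /= (proj_compl_lin lP); case: cN1 => -[_ h] _; exact: h.
have rE : ranM [set x | N1 (x - P x)] (shift T l) =
    [set x | N1 (x - P x) /\ ranM N (shift T l) (P x)].
  apply/seteqP; split=> [_ [x N1x <-]|x [N1x [n Nn hn]]].
    rewrite /= (proj_commute lP hP PM PN lL sM sN) -(linB _ _ lL).
    by split; [exact: sN1|exists (P x); case: (hP x)].
  have [m N1m hm] := nilpotent_shift_surj cN1.1 iN1 l0 N1x (nil _ N1x).
  exists (m + n); first by apply: subspaceD sN' (N1N' _ N1m) (NN' _ Nn).
  by rewrite (linD _ _ lL) hm hn subrK.
split.
- apply: finite_dimS fk => x [N1x /(ker_components lP hP PM PN lL sM sN)[h1 h2]].
  have E := iter_eigen q lT (shiftE h1); rewrite (nil _ N1x) in E.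
  have x0 : x - P x = 0.
    by have /eqP := E; rewrite eq_sym scaler_eq0 expf_eq0 (negPf l0) andbF => /eqP.
  have <- : P x = x by apply/eqP; rewrite eq_sym -subr_eq0 x0.
  by split=> //; case: (hP x).
- by rewrite rE; apply: (closed_components lP bP) => //; case: cN1.
- exists F; split=> //; first by move=> x /FN /NN'.
  move=> x N1x; have [Nx Mx] := hP x; have [y [f [ry Ff E]]] := hF _ Nx.
  exists (x - P x + y), f; split=> //; last by rewrite -addrA -E subrK.
  have Ny : N y by case: ry => n Nn <-; exact: sN.
  rewrite rE /=; have -> : P (x - P x + y) = y by exact: (proj_sum lP PM PN).
  by rewrite addrK.
Qed.

Lemma iv_i : cond_iv -> cond_i.
Proof.
move=> [M [N [[cM cN /op_invariantP iM /op_invariantP iN ds] [[[fk cr] fa] rN]]]].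
have [_ [K K0 bT]] := bounded_op_bnd hT.
have [P [lP [D D0 bP] hP PM PN]] := projection_exists cM cN ds.
have [s hs] := (finite_dimP _).1 fk.
have [M1 [N1 [[[cM1 cN1 iM1 iN1] [M1M N1M MN1 dec]] fN1 [q nil] bb]]] :=
  usb_split cM lT K0 bT iM erefl hs cr fa.
have lc := proj_compl_lin lP.
exists M1, [set x | N1 (x - P x)]; split; last first.
  by split=> //; exact: (riesz_nilpotent_sum cM cN lP bP hP PM PN iM iN cN1 N1M iN1 nil rN).
split=> //; [|exact/op_invariantP| |].
- split; last exact: preimage_closed lc (proj_compl_bnd bP) cN1.2.
  split=> [|a x y hx hy]; first by rewrite /= (lin0 lP) subr0; exact: subspace0 cN1.1.
  by rewrite /= lc; case: cN1 => -[_ h] _; exact: h.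
- apply/op_invariantP => x /= hx.
  by rewrite (proj_commute lP hP PM PN lT iM iN) -(linB _ _ lT); exact: iN1.
- split.
    apply/seteqP; split=> [x [M1x /=]|_ ->].
      rewrite PM ?subr0 => [N1x|]; last exact: M1M.
      by have : (M1 `&` N1) x by []; rewrite MN1.
    split; first exact: subspace0 cM1.1.
    by rewrite /= (lin0 lP) subr0; exact: subspace0 cN1.1.
  move=> x; have [Nx Mx] := hP x; have [a [b [M1a N1b E]]] := dec _ Mx.
  exists a, (b + P x); split=> //; last by rewrite addrA -E subrK.
  by rewrite /= (proj_sum lP PM PN) ?addrK //; exact: N1M.
Qed.

Lemma i_vii : cond_i -> cond_vii.
Proof.
move=> [M [N [[cM cN /op_invariantP iM /op_invariantP iN ds] [bb rN]]]].
have [_ [K K0 bT]] := bounded_op_bnd hT.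
have [P [lP [D D0 bP] hP PM PN]] := projection_exists cM cN ds.
have PT x : P (T x) = T (P x) by exact: (proj_commute lP hP PM PN lT iM iN).
exists P; split.
- split; first exact: bnd_bounded_op bP.
  by apply/funext => x; rewrite /= PN //; case: (hP x).
- exact/funext.
- have eM x : M x -> (T \+ P) x = T x by move=> Mx; rewrite /= PM // addr0.
  (* On [N] the operator [T + P] is [T - (-1)], so the Riesz condition and finite ascent are used at
     the single value -1. *)
  have eN x : N x -> (T \+ P) x = shift T (-1) x.
    by move=> Nx; rewrite /= PN // /shift scaleN1r opprK.
  have n10 : (-1 : C) != 0 by rewrite oppr_eq0 oner_eq0.
  have lS : lin (T \+ P) by move=> a x y /=; rewrite lT lP addrACA scalerDr.
  apply: (usb_sum cN lP bP hP PM PN lS).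
  + by move=> x Mx; rewrite eM //; exact: iM.
  + by move=> x Nx; rewrite eN //; apply: (invar_shift (-1) cN.1 iN).
  + by rewrite /bounded_below_on (eq_on_ker eM) (eq_on_ran eM).
  + apply: (eq_on_usb (invar_shift (-1) cN.1 iN) eN).
    have [fa _] := riesz_discrete cN lT K0 bT iN rN n10.
    by have [fk cr _] := rN _ n10.
move=> l l0; have [fk cr [F [fF FN hF]]] := rN l l0.
have lS : lin (shift (T \o P) l) by apply: lin_shift => a x y /=; rewrite lP lT.
(* On [M] the shifted operator is multiplication by [- l], which is invertible, so only [N]
   contributes to kernel and cokernel. *)
have eM x : M x -> shift (T \o P) l x = - l *: x.
  by move=> Mx; rewrite /shift /= PM // (lin0 lT) sub0r scaleNr.
have eN x : N x -> shift (T \o P) l x = shift T l x by move=> Nx; rewrite /shift /= PN.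
have sM : invar (shift (T \o P) l) M by move=> x Mx; rewrite eM //; apply: subspaceZ cM.1 Mx.
have sN : invar (shift (T \o P) l) N.
  by move=> x Nx; rewrite eN //; apply: (invar_shift l cN.1 iN).
have rM : ranM M (shift (T \o P) l) = M.
  apply/seteqP; split=> [_ [x Mx <-]|x Mx]; first exact: sM.
  exists ((- l)^-1 *: x); first exact: subspaceZ cM.1 Mx.
  by rewrite eM ?scalerA ?divff ?oppr_eq0 ?scale1r //; exact: subspaceZ cM.1 Mx.
split.
- apply: finite_dimS fk; rewrite -(eq_on_ker eN) => x [_ Sx]; split=> //.
  apply: (ker_inj_sum lP hP PM PN lS sM sN _ Sx).
  apply/seteqP; split=> [y [My]|_ ->]; last by split; [exact: subspace0 cM.1|exact: lin0].
  by rewrite eM // => /eqP; rewrite scaler_eq0 oppr_eq0 (negPf l0) => /eqP.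
- apply: (ran_closed_sum lP bP hP PM PN lS sM sN); first by rewrite rM; case: cM.
  by rewrite (eq_on_ran eN).
- exists F; split=> // x _; have [Nx Mx] := hP x; have [y [f [ry Ff E]]] := hF _ Nx.
  exists (x - P x + y), f; split=> //; last by rewrite -addrA -E subrK.
  have Ny : N y by case: ry => n Nn <-; exact: (invar_shift l cN.1 iN).
  rewrite (ran_components lP hP PM PN lS sM sN) /= (proj_sum lP PM PN) // addrK rM.
  by rewrite (eq_on_ran eN).
Qed.

Lemma vii_iv : cond_vii -> cond_iv.
Proof.
move=> [P [[bP PP] PT [[fk cr] [p hp]] rTP]].
have [lP [D D0 bnP]] := bounded_op_bnd bP.
have PPx x : P (P x) = P x by rewrite -[LHS]/((P \o P) x) PP.
have PTx x : P (T x) = T (P x) by rewrite -[LHS]/((P \o T) x) PT.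
have lc := proj_compl_lin lP.
have c0 := closed_subspace0 X.
(* [M] and [N] are the kernel and the range of [P]; the range is written as the kernel of [1 - P] to
   make it closed. [T] agrees with [T + P] on [M] and with [T P] on [N]. *)
pose M := [set x | P x = 0]; pose N := [set x | x - P x = 0].
have PN x : N x -> P x = x by move=> /eqP; rewrite subr_eq0 => /eqP.
have NP x : N (P x) by rewrite /N /= PPx subrr.
have cM : closed_subspace M.
  split; last exact: (preimage_closed lP bnP c0.2).
  by split=> [|a x y /= hx hy] /=; rewrite /M /= ?(lin0 lP) // lP hx hy scaler0 addr0.
have cN : closed_subspace N.
  split; last exact: (preimage_closed lc (proj_compl_bnd bnP) c0.2).
  by split=> [|a x y hx hy]; rewrite /N /= ?(lin0 lP) ?subr0 // lc hx hy scaler0 addr0.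
have iM : invar T M by move=> x Mx; rewrite /M /= PTx Mx (lin0 lT).
have iN : invar T N by move=> x Nx; rewrite /N /= PTx (PN x Nx) subrr.
exists M, N; split; first split=> //.
- exact/op_invariantP.
- exact/op_invariantP.
- split; last by move=> x; exists (x - P x), (P x); rewrite subrK /M /= (linB _ _ lP) PPx subrr.
  apply/seteqP; split=> [x [Mx /PN <-]//|_ ->].
  by split; [exact: subspace0 cM.1|exact: subspace0 cN.1].
split.
  have eM x : M x -> T x = (T \+ P) x by move=> Mx; rewrite /= Mx addr0.
  have iM' : invar (T \+ P) M by move=> x Mx; rewrite -eM //; exact: iM.
  apply: (eq_on_usb iM' eM); split; first split.
  + by apply: finite_dimS fk => x [].
  + suff -> : ranM M (T \+ P) = ranM setT (T \+ P) `&` M by apply: closedI => //; case: cM.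
    apply/seteqP; split=> [_ [x Mx <-]|_ [[x _ <-] Mx]]; first by split; [exists x|exact: iM'].
    have E : P ((T \+ P) x) = T (P x) + P x by rewrite /= (linD _ _ lP) PTx PPx.
    exists (x - P x); first by rewrite /M /= (linB _ _ lP) PPx subrr.
    rewrite -[RHS]subr0 -Mx E /= (linB _ _ lT) (linB _ _ lP) PPx opprD addrACA.
    by [].
  + by apply: (@ascent_sub _ _ M setT) => //; exists p.
move=> l l0; have [fk' cr' [F [fF _ hF]]] := rTP l l0.
have eN x : N x -> shift T l x = shift (T \o P) l x by move=> Nx; rewrite /shift /= PN.
have lS : lin (shift (T \o P) l) by apply: lin_shift => a x y /=; rewrite lP lT.
have cS x : P (shift (T \o P) l x) = shift (T \o P) l (P x).
  by rewrite /shift (linB _ _ lP) (linZ _ _ lP) /= PTx.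
split.
- by rewrite (eq_on_ker eN); apply: finite_dimS fk' => x [].
- rewrite (eq_on_ran eN).
  suff -> : ranM N (shift (T \o P) l) = ranM setT (shift (T \o P) l) `&` N.
    by apply: closedI => //; case: cN.
  apply/seteqP; split=> [_ [x Nx <-]|_ [[x _ <-] Nx]].
    by split; [exists x|rewrite -eN //; exact: (invar_shift l cN.1 iN)].
  by exists (P x); rewrite // -cS PN.
(* The finite-dimensional supplement [F] need not lie in [N]. Applying [P], which commutes with the
   operator, moves the whole decomposition into [N]. *)
- exists (P @` F); split; first exact: finite_dim_image.
    by move=> _ [f Ff <-].
  move=> x Nx; have [_ [f [[y _ <-] Ff E]]] := hF x I.
  exists (shift (T \o P) l (P y)), (P f); split; last by rewrite -cS -(linD _ _ lP) -E PN.
    by rewrite (eq_on_ran eN); exists (P y).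
  by exists f.
Qed.

End Implications.

Theorem theorem2p7 (R : realType) (X : completeNormedModType (Cplx R))
  (T : X -> X) (hT : bounded_op T) (hinf : ~ finite_dim [set: X]) :
  let DEC (PM PN : set X -> Prop) :=
    exists M N : set X, [/\ closed_subspace M, closed_subspace N,
      op_invariant T M, op_invariant T N & direct_sum M N] /\ PM M /\ PN N in
  let i   := DEC (fun M => bounded_below_on M T) (fun N => riesz_on N T) in
  let ii  := GKRD T /\ ~ interior (ap_spectrum T) 0 in
  let iii := GKRD T /\ SVEP_at T 0 in
  let iv  := DEC (fun M => upper_semi_browder_on M T) (fun N => riesz_on N T) in
  let v   := GKRD T /\ ~ limit_point (usb_spectrum T) 0 in
  let vi  := GKRD T /\ ~ interior (usb_spectrum T) 0 in
  let vii := exists P : X -> X, [/\ projection P, P \o T = T \o P,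
               upper_semi_browder_on setT (T \+ P) & riesz_on setT (T \o P)] in
  [/\ (i <-> ii), (i <-> iii), (i <-> iv) & (i <-> v)] /\ (i <-> vi) /\ (i <-> vii).
Proof.
move=> DEC i ii iii iv v vi vii.
have no_int : ~ limit_point (usb_spectrum T) 0 -> ~ interior (usb_spectrum T) 0.
  by move=> h /limit_point_interior.
split; [split; split|split; split].
- by move=> hi; split; [exact: i_GKRD hi|exact: i_ii hi].
- by move=> [hG h]; exact: ii_i.
- by move=> hi; split; [exact: i_GKRD hi|exact: i_iii hi].
- by move=> [hG h]; exact: iii_i.
- exact: i_iv.
- exact: iv_i.
- by move=> hi; split; [exact: i_GKRD hi|exact: i_v hi].
- by move=> [hG /no_int h]; exact: vi_i.
- by move=> hi; split; [exact: i_GKRD hi|apply: no_int; exact: i_v hi].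
- by move=> [hG h]; exact: vi_i.
- exact: i_vii.
- by move=> /(vii_iv hT); exact: iv_i.
Qed.
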